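(* The word problem of the Behnke–Leptin C*-algebra $\mathcal A_{0,1}$ has polynomial time complexity: there exist a polynomial $T$ and a Turing machine which, on input any two formulas $\phi,\psi$, decides in fewer than $T(\|\phi\|+\|\psi\|)$ steps whether $\phi$ and $\psi$ code the same element of $E(\mathcal A_{0,1})$.
   Context: An AF algebra is the norm closure of an ascending union of finite-dimensional C*-algebras with common unit; an AF$\ell$ algebra is one whose Murray–von Neumann order of projections is a lattice, and its Elliott involutive monoid $E(\mathfrak B)$ is the set of Murray–von Neumann classes of projections with the unique total extension $\oplus$ of Elliott's partial addition and involution $[p]^*=[1-p]$ (equivalently, the unit interval $[0,u]$ of the unital $\ell$-group $K_0(\mathfrak B)$ with $x^*=u-x$, $x\oplus y=(x+y)\wedge u$). Let $M_1$ be the unital $\ell$-group of continuous piecewise linear $f:[0,1]\to\mathbb R$ with integer-coefficient linear pieces (unit the constant $1$), and $\mathfrak M_1$ (the Farey AF algebra) the unital AF algebra with $K_0(\mathfrak M_1)\cong(M_1,1)$. $E(\mathfrak M_1)$ is isomorphic to the free one-generator MV-algebra $\mathcal M_1$ of McNaughton functions ($[0,1]$-valued members of $M_1$, with $f^*=1-f$, $f\oplus g=\min(1,f+g)$), freely generated by $\mathrm{id}_{[0,1]}$; fix a projection $\mathsf p$ with $[\mathsf p]$ generating $E(\mathfrak M_1)$. Ideals of $\mathfrak M_1$ correspond bijectively to ideals of $K_0(\mathfrak M_1)=M_1$ (an ideal $\mathfrak J$ maps to its image in $K_0$). Let $J_0^+=\{f\in M_1\mid f(0)=0,\ \partial f(0)/\partial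 x^+=0\}$ (right derivative) and $\mathfrak J_0^+$ the corresponding ideal of $\mathfrak M_1$. The Behnke–Leptin algebra $\mathcal A_{0,1}$ is the AF$\ell$ algebra $\mathfrak M_1/\mathfrak J_0^+$ (equivalently, the AF algebra with $K_0\cong(\mathbb Z\times_{\mathrm{lex}}\mathbb Z,(1,0))$); $E(\mathcal A_{0,1})$ is generated by $[\mathsf p/\mathfrak J_0^+]$. Formulas are strings over $\{0,X,{}^*,\oplus,(,)\}$ built inductively: $0$, $X$ are formulas; if $\phi,\psi$ are, so are $\phi^*$ and $(\phi\oplus\psi)$. A formula codes the element of $E(\mathcal A_{0,1})$ obtained by interpreting $0$ as $0$, $X$ as $[\mathsf p/\mathfrak J_0^+]$, ${}^*$ and $\oplus$ as the monoid operations. $\|\phi\|$ is the number of symbol occurrences in $\phi$. The word problem asks whether two given formulas code the same element. *)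

(* Defs.v *)
From HB Require Import structures.
From mathcomp Require Import all_boot all_order all_algebra.
From mathcomp Require Import generic_quotient.
From mathcomp Require Import all_classical all_reals topology normedtype.
From mathcomp Require Import complex.

Set Implicit Arguments.
Unset Strict Implicit.
Unset Printing Implicit Defensive.

Import Order.TTheory GRing.Theory Num.Theory.
Import numFieldNormedType.Exports.

Local Open Scope classical_set_scope.
Local Open Scope ring_scope.
Local Open Scope complex_scope.
Local Open Scope quotient_scope.

(* The library's normed modules cannot be joined with its algebra structures
   over R[i], hence the R-valued norm and explicit completeness below. *)
HB.mixin Record isCStar (R : realType) A of GRing.Algebra R[i] A := {
  star : A -> A;
  starD : forall x y, star (x + y) = star x + star y;
  starZ : forall (c : R[i]) x, star (c *: x) = c^* *: star x;
  starM : forall x y, star (x * y) = star y * star x;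
  starK : forall x, star (star x) = x;
  cnorm : A -> R;
  cnorm_eq0 : forall x, cnorm x = 0 -> x = 0;
  cnormD_le : forall x y, cnorm (x + y) <= cnorm x + cnorm y;
  cnormZ : forall (c : R[i]) x, cnorm (c *: x) = complex.Re `|c| * cnorm x;
  cnormM_le : forall x y, cnorm (x * y) <= cnorm x * cnorm y;
  cnorm_starM : forall x, cnorm (star x * x) = cnorm x ^+ 2;
  cnorm_complete : forall u : nat -> A,
    (forall e : R, 0 < e -> exists N, forall m n, (N <= m)%N -> (N <= n)%N ->
      cnorm (u m - u n) < e) ->
    exists l, (cnorm (u n - l) @[n --> \oo] --> (0 : R))
}.

#[short(type="cstarAlgType")]
HB.structure Definition CStarAlg (R : realType) :=
  {A of GRing.Algebra R[i] A & isCStar R A}.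

Section AF.
Context {R : realType} (A : cstarAlgType R).

Definition norm_closure (B : set A) : set A :=
  [set x | forall e : R, 0 < e -> exists2 y, B y & cnorm (x - y) < e].

(* A finite-dimensional *-subspace of A is automatically norm closed, so this
   says that B is a finite-dimensional C*-subalgebra with the unit of A. *)
Record fd_unital_subCstar (B : set A) : Prop := {
  fd_one : B 1;
  fd_add : forall x y, B x -> B y -> B (x + y);
  fd_scale : forall (c : R[i]) x, B x -> B (c *: x);
  fd_mul : forall x y, B x -> B y -> B (x * y);
  fd_star : forall x, B x -> B (star x);
  fd_dim : exists (d : nat) (b : 'I_d -> A),
    forall x, B x -> exists c : 'I_d -> R[i], x = \sum_i c i *: b i
}.

Definition AF_algebra : Prop :=
  exists F : nat -> set A,
    [/\ forall n, fd_unital_subCstar (F n),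
        forall n, F n `<=` F n.+1
      & norm_closure (\bigcup_n F n) = setT].

Record closed_ideal (J : set A) : Prop := {
  ideal_closed : norm_closure J `<=` J;
  ideal0 : J 0;
  idealD : forall x y, J x -> J y -> J (x + y);
  idealMl : forall a x, J x -> J (a * x);
  idealMr : forall a x, J x -> J (x * a)
}.

End AF.

(* Q, with the quotient map cq_map, is the C*-algebra A / J: a *-homomorphism
   onto Q with kernel J, where Q carries the quotient norm
   inf_(j in J) cnorm (a + j). *)
Record cstar_quotient (R : realType) (A : cstarAlgType R) (J : set A)
    (Q : cstarAlgType R) := CStarQuotient {
  cq_map :> {lrmorphism A -> Q};
  cq_star : forall a, cq_map (star a) = star (cq_map a);
  cq_surj : forall b : Q, exists a, cq_map a = b;
  cq_ker : forall a, cq_map a = 0 <-> J a;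
  cq_norm_le : forall a j, J j -> cnorm (cq_map a) <= cnorm (a + j);
  cq_norm_inf : forall (a : A) (e : R), 0 < e ->
    exists2 j, J j & cnorm (a + j) < cnorm (cq_map a) + e
}.

Section Elliott.
Context {R : realType} (A : cstarAlgType R).
Implicit Types x y : A.

Lemma star0 : star 0 = 0 :> A.
Proof. by apply: (addrI (star 0)); rewrite -starD !addr0. Qed.

Lemma starN x : star (- x) = - star x.
Proof. by apply: (addrI (star x)); rewrite -starD !subrr star0. Qed.

Lemma star1 : star 1 = 1 :> A.
Proof. by rewrite -[LHS]mulr1 -{2}[1]starK -starM mulr1 starK. Qed.

Definition is_proj x : bool := (x * x == x) && (star x == x).

Definition projection := {x : A | is_proj x}.

Lemma is_proj0 : is_proj 0.
Proof. by rewrite /is_proj mulr0 star0 !eqxx. Qed.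

Lemma is_projC (p : projection) : is_proj (1 - val p).
Proof.
case: p => p /= /andP[/eqP pp /eqP sp]; rewrite /is_proj starD starN star1 sp.
by rewrite eqxx andbT mulrBr mulr1 mulrBl mul1r pp subrr subr0.
Qed.

Definition proj0 : projection := exist _ 0 is_proj0.
Definition projC (p : projection) : projection := exist _ (1 - val p) (is_projC p).

Definition mvn (p q : projection) : bool :=
  `[< exists v : A, star v * v = val p /\ v * star v = val q >].

Lemma mvn_refl : reflexive mvn.
Proof.
case=> p /= pP; apply/asboolP; exists p => /=.
by case/andP: (pP) => /eqP pp /eqP ->; rewrite pp.
Qed.

Lemma mvn_sym : symmetric mvn.
Proof.
by move=> p q; apply/asboolP/asboolP => -[v [vp vq]];
  exists (star v); rewrite starK.
Qed.

Lemma mvn_trans : transitive mvn.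
Proof.
move=> q p r /asboolP[v [vp vq]] /asboolP[w [wq wr]].
apply/asboolP; exists (w * v); rewrite starM; split.
  rewrite mulrA -(mulrA (star v)) wq -vq mulrA vp -mulrA vp.
  by case: (p) => x /= /andP[/eqP].
rewrite mulrA -(mulrA w) vq -wq mulrA wr -mulrA wr.
by case: (r) => x /= /andP[/eqP].
Qed.

Canonical mvn_equiv := EquivRel mvn mvn_refl mvn_sym mvn_trans.

Definition elliott := {eq_quot mvn_equiv}.

Definition mvn_class (p : projection) : elliott := \pi_elliott p.

Definition mvn_le (a b : elliott) : Prop :=
  exists p q : projection, [/\ a = mvn_class p, b = mvn_class q
                       & val p * val q = val p].

(* Elliott's partial addition is [p] + [q] = [p + q] for orthogonal p, q.  For
   an AF algebra its total extension (which is unique, and exists exactly when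
   mvn_le is a lattice: Mundici and Panti) is the associative commutative
   monotone one for which [1 - p] is the smallest class b with
   [p] (+) b = [1]. *)
Record elliottMonoid := ElliottMonoid {
  estar : elliott -> elliott;
  eplus : elliott -> elliott -> elliott;
  estarE : forall p, estar (mvn_class p) = mvn_class (projC p);
  eplusE : forall p q r : projection, val p * val q = 0 -> val r = val p + val q ->
    eplus (mvn_class p) (mvn_class q) = mvn_class r;
  eplusA : associative eplus;
  eplusC : commutative eplus;
  eplus_mono : forall a a' b, mvn_le a a' -> mvn_le (eplus a b) (eplus a' b);
  estar_min : forall a b, eplus a b = mvn_class (projC proj0) ->
    mvn_le (estar a) b
}.

End Elliott.

Section QuotientProj.
Context {R : realType} {A Q : cstarAlgType R} {J : set A}.
Context (pi : cstar_quotient J Q).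

Lemma is_proj_quot (p : projection A) : is_proj (pi (val p)).
Proof.
case: p => p /= /andP[/eqP pp /eqP sp].
by rewrite /is_proj -rmorphM pp -cq_star sp !eqxx.
Qed.

Definition proj_quot (p : projection A) : projection Q :=
  exist _ (pi (val p)) (is_proj_quot p).

End QuotientProj.

Section K0.
Context {R : realType} (A : cstarAlgType R).

Definition adjmx m n (x : 'M[A]_(m, n)) : 'M[A]_(n, m) := map_mx star x^T.

Definition is_projmx n (p : 'M[A]_n) : Prop := p *m p = p /\ adjmx p = p.

Definition mvn_mx m n (p : 'M[A]_m) (q : 'M[A]_n) : Prop :=
  exists v : 'M[A]_(n, m), adjmx v *m v = p /\ v *m adjmx v = q.

Definition dsum m n (p : 'M[A]_m) (q : 'M[A]_n) : 'M[A]_(m + n) :=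
  block_mx p 0 0 q.

(* cls exhibits (K_0(A), K_0(A)^+, [1]) as (G, P, u), where G is a subgroup of
   V: cls induces an isomorphism onto G from the Grothendieck group of the
   monoid of Murray-von Neumann classes of projections in matrices over A,
   carrying the cone {[p]} onto {g in G | P g} and [1] to u.  The values of
   cls at matrices that are not projections are irrelevant. *)
Record K0_iso (V : zmodType) (G P : set V) (u : V)
    (cls : forall n, 'M[A]_n -> V) : Prop := {
  K0_eq : forall m n (p : 'M[A]_m) (q : 'M[A]_n),
    is_projmx p -> is_projmx q ->
    (cls m p = cls n q <->
     exists k (r : 'M[A]_k), is_projmx r /\ mvn_mx (dsum p r) (dsum q r));
  K0_add : forall m n (p : 'M[A]_m) (q : 'M[A]_n),
    is_projmx p -> is_projmx q -> cls _ (dsum p q) = cls m p + cls n q;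
  K0_onto : G = [set g | exists m n (p : 'M[A]_m) (q : 'M[A]_n),
    [/\ is_projmx p, is_projmx q & g = cls m p - cls n q]];
  K0_pos : G `&` P =
    [set g | exists n (p : 'M[A]_n), is_projmx p /\ g = cls n p];
  K0_unit : cls 1%N 1%:M = u
}.

(* For J a closed ideal of an AF algebra, K_0(J) is generated by the classes of
   projections in matrices over J, so this is the image of K_0(J). *)
Definition K0_image (V : zmodType) (cls : forall n, 'M[A]_n -> V)
    (J : set A) : set V :=
  [set g | exists m n (p : 'M[A]_m) (q : 'M[A]_n),
    [/\ is_projmx p /\ (forall i j, J (p i j)),
        is_projmx q /\ (forall i j, J (q i j))
      & g = cls m p - cls n q]].

End K0.

Section McNaughton.
Context (R : realType).

Definition I01 : Type := `[0%R, 1%R]%classic : set R.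

Lemma I01_0_subproof : (0 : R) \in (`[0%R, 1%R]%classic : set R).
Proof. by rewrite inE /= in_itv /= lexx ler01. Qed.

Definition I01_0 : I01 := exist _ 0 I01_0_subproof.

Definition M1 : set (I01 -> R) :=
  [set f | continuous f /\ exists s : seq (int * int), forall x : I01,
    exists2 ab, ab \in s & f x = ab.1%:~R + ab.2%:~R * val x].

Definition M1_pos : set (I01 -> R) := [set f | forall x, 0 <= f x].

(* Punctured neighbourhoods of 0 in [0, 1] give the right derivative. *)
Definition J0plus : set (I01 -> R) :=
  [set f | [/\ M1 f, f I01_0 = 0
             & (f x - f I01_0) / val x @[x --> I01_0^'] --> (0 : R)]].

End McNaughton.

Inductive symbol := SZero | SX | SStar | SPlus | SOpen | SClose.

Definition symbol_to_ord (s : symbol) : 'I_6 :=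
  match s with
  | SZero => inord 0 | SX => inord 1 | SStar => inord 2
  | SPlus => inord 3 | SOpen => inord 4 | SClose => inord 5
  end.

Definition ord_to_symbol (i : 'I_6) : symbol :=
  nth SZero [:: SZero; SX; SStar; SPlus; SOpen; SClose] i.

Lemma symbol_to_ordK : cancel symbol_to_ord ord_to_symbol.
Proof. by case; rewrite /ord_to_symbol /= inordK. Qed.

HB.instance Definition _ := Equality.copy symbol (can_type symbol_to_ordK).
HB.instance Definition _ := Choice.copy symbol (can_type symbol_to_ordK).
HB.instance Definition _ := Countable.copy symbol (can_type symbol_to_ordK).
HB.instance Definition _ := Finite.copy symbol (can_type symbol_to_ordK).

Inductive formula :=
  | FZero | FX | FStar of formula | FPlus of formula & formula.

Fixpoint fstr (phi : formula) : seq symbol :=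
  match phi with
  | FZero => [:: SZero]
  | FX => [:: SX]
  | FStar a => rcons (fstr a) SStar
  | FPlus a b => SOpen :: fstr a ++ SPlus :: fstr b ++ [:: SClose]
  end.

Definition flen (phi : formula) : nat := size (fstr phi).

Fixpoint code_of (R : realType) (A : cstarAlgType R) (E : elliottMonoid A)
    (g : elliott A) (phi : formula) : elliott A :=
  match phi with
  | FZero => mvn_class (proj0 A)
  | FX => g
  | FStar a => estar E (code_of E g a)
  | FPlus a b => eplus E (code_of E g a) (code_of E g b)
  end.

Definition generates (R : realType) (A : cstarAlgType R) (E : elliottMonoid A)
    (g : elliott A) : Prop :=
  forall x, exists phi, code_of E g phi = x.

Inductive move := MLeft | MStay | MRight.

(* Deterministic one-tape machines over the input alphabet S.  A tape cell
   holds None (blank), an input symbol, or an auxiliary symbol. *)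
Record turing_machine (S : finType) := TuringMachine {
  tm_state : finType;
  tm_aux : finType;
  tm_start : tm_state;
  tm_accept : tm_state;
  tm_reject : tm_state;
  tm_accept_neq_reject : tm_accept != tm_reject;
  tm_delta : tm_state -> option (S + tm_aux) ->
             tm_state * option (S + tm_aux) * move
}.

Section TuringMachine.
Context (S : finType) (M : turing_machine S).

Local Notation cell := (option (S + tm_aux M)).

(* cfg_left lists the cells left of the head from nearest to farthest;
   cfg_right lists the scanned cell and those right of it.  The tape is
   two-way infinite: cells beyond either list are blank. *)
Record config := Config {
  cfg_state : tm_state M;
  cfg_left : seq cell;
  cfg_right : seq cell
}.

Definition initial_config (w : seq S) : config :=
  Config (tm_start M) [::] [seq Some (inl s) | s <- w].

Definition halted (c : config) : bool :=
  (cfg_state c == tm_accept M) || (cfg_state c == tm_reject M).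

Definition step (c : config) : config :=
  if halted c then c else
  let l := cfg_left c in
  let r := cfg_right c in
  let: (q, b, d) := tm_delta (cfg_state c) (head None r) in
  match d with
  | MLeft => Config q (behead l) (head None l :: b :: behead r)
  | MStay => Config q l (b :: behead r)
  | MRight => Config q (b :: l) (behead r)
  end.

(* On input w, M halts in fewer than N steps, accepting exactly when P. *)
Definition decides_within (N : nat) (w : seq S) (P : Prop) : Prop :=
  exists t, let c := iter t step (initial_config w) in
    [/\ (t < N)%N, halted c & cfg_state c = tm_accept M <-> P].

End TuringMachine.

(* The separator None delimits the two formulas on the input tape. *)
Definition pair_input (phi psi : formula) : seq (option symbol) :=
  map Some (fstr phi) ++ None :: map Some (fstr psi).

(* Main.v *)
(* The class of a projection x of M_1 is determined by the germ at 0 of the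
   McNaughton function [x], modulo the ideal J_0^+: the pair (value, right
   derivative), a point of the unit interval of Z x_lex Z.  Hence formulas are
   evaluated in Chang's MV-algebra, where the operations on pairs (e, n) are
   unary additions and truncated subtractions, which a one-tape machine performs
   in place in cubic time.

   To pass from K_0 back to Murray-von Neumann classes one needs cancellation
   for projections in matrices over an AF algebra.  An equivalence between
   p + r and q + r is approximated inside a finite-dimensional *-subalgebra,
   where a small perturbation makes its r-corner invertible; the Schur
   complement of that corner is then an invertible element from p to q, and its
   unitary part a *-equivalence.  All limits are limits of Newton iterations, so
   only a complete submultiplicative norm is used on matrices.  The total
   addition of the Elliott monoid is forced because the order on the relevant
   classes of the quotient is total and the quotient is finite. *)
Require Import Defs.
From HB Require Import structures.
From mathcomp Require Import all_boot all_order all_algebra.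
From mathcomp Require Import all_classical all_reals topology normedtype.
From mathcomp Require Import complex ring lra zify.

Set Implicit Arguments.
Unset Strict Implicit.
Unset Printing Implicit Defensive.

Import Order.TTheory GRing.Theory Num.Theory.
Import numFieldNormedType.Exports.

Local Open Scope ring_scope.

(** * Spectral decompositions in algebraic *-algebras *)

(** The obstacle is that cancellation concerns projections in matrices over [A], while constructing
    the C*-norm of a matrix algebra is avoided. Matrices carry the entrywise sum norm, which is
    complete and submultiplicative but violates the C*-identity and gives large identity matrices a
    large norm. What the C*-identity would provide is recovered algebraically: in a
    finite-dimensional *-subalgebra each element has an annihilating polynomial, and the spectral
    theorem needs only this together with properness. Properness for matrices says that a vanishing
    sum of elements [x_i^* x_i] has all [x_i = 0], a statement about [A] itself, proved there with
    the C*-norm. Hence the theory is developed for an abstract [star_alg] and instantiated twice, at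
    [A] and at its matrices.

    On the machine side, the germ of the generator may be any pair [(e, n)]. Multiplying the
    infinitesimal coordinate by a positive integer is an injective endomorphism of Chang's algebra,
    so [n] may be replaced by 0 or 1. Each [X] then contributes at most one tick, and the cells of a
    formula always suffice to hold its value. *)

Record star_alg (R : realType) (T : nzRingType) := StarAlg {
  scal : {rmorphism R[i] -> T};
  scalC : forall c x, scal c * x = x * scal c;
  adj : T -> T;
  adjD : forall x y, adj (x + y) = adj x + adj y;
  adjM : forall x y, adj (x * y) = adj y * adj x;
  adjK : forall x, adj (adj x) = x;
  adjZ : forall c, adj (scal c) = scal (conjc c)
}.

Section PolyEval.
Context {R : realType} {T : nzRingType} (S : star_alg R T).
Implicit Types (x y h : T) (p q : {poly R[i]}).

Definition pev h p : T := (map_poly (scal S) p).[h].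

Lemma pev_comm h : commr_rmorph (scal S) h.
Proof. by move=> c; rewrite /GRing.comm scalC. Qed.

Lemma pevD h p q : pev h (p + q) = pev h p + pev h q.
Proof. by rewrite /pev rmorphD hornerD. Qed.

Lemma pevM h p q : pev h (p * q) = pev h p * pev h q.
Proof. exact: (rmorphM (horner_morph (pev_comm h))). Qed.

Lemma pevC h c : pev h c%:P = scal S c.
Proof. by rewrite /pev map_polyC hornerC. Qed.

Lemma pevX h : pev h 'X = h.
Proof. by rewrite /pev map_polyX hornerX. Qed.

Lemma pevN h p : pev h (- p) = - pev h p.
Proof. by rewrite /pev rmorphN hornerN. Qed.

Lemma pevB h p q : pev h (p - q) = pev h p - pev h q.
Proof. by rewrite pevD pevN. Qed.

Lemma pev0 h : pev h 0 = 0.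
Proof. by rewrite /pev rmorph0 horner0. Qed.

Lemma pev1 h : pev h 1 = 1.
Proof. by rewrite /pev rmorph1 hornerC. Qed.

Lemma pevXsubC h c : pev h ('X - c%:P) = h - scal S c.
Proof. by rewrite pevB pevX pevC. Qed.

Lemma pev_commute h y p : h * y = y * h -> pev h p * y = y * pev h p.
Proof.
move=> hy; elim/poly_ind: p => [|p c IH]; first by rewrite pev0 mul0r mulr0.
by rewrite pevD pevM pevX pevC mulrDl mulrDr -mulrA hy mulrA IH scalC mulrA.
Qed.

Lemma pev_commute_self h p : pev h p * h = h * pev h p.
Proof. exact: pev_commute. Qed.

Lemma adj0 : adj S 0 = 0.
Proof. by apply: (addrI (adj S 0)); rewrite -adjD !addr0. Qed.

Lemma adjN x : adj S (- x) = - adj S x.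
Proof. by apply: (addrI (adj S x)); rewrite -adjD !subrr adj0. Qed.

Lemma adjB x y : adj S (x - y) = adj S x - adj S y.
Proof. by rewrite adjD adjN. Qed.

Lemma adj1 : adj S 1 = 1.
Proof. by rewrite -[LHS]mulr1 -{2}[1](adjK S) -adjM mulr1 adjK. Qed.

Lemma adj_sum I (r : seq I) (f : I -> T) :
  adj S (\sum_(i <- r) f i) = \sum_(i <- r) adj S (f i).
Proof. by apply: (big_morph (adj S)); [exact: adjD | exact: adj0]. Qed.

Lemma adjZr (a : R) : adj S (scal S a%:C%C) = scal S a%:C%C.
Proof. by rewrite adjZ conjc_real. Qed.

End PolyEval.

Section Spectral.
Context {R : realType} {T : nzRingType} (S : star_alg R T).
Implicit Types (x y h : T) (p q : {poly R[i]}) (F : set T).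
Local Notation rs a := (scal S a%:C%C).

(* Abstracts a finite-dimensional *-subalgebra: finite dimension is only used
   through algebraicity of the elements, the C*-identity through properness. *)
Record algebraic_sub F : Prop := AlgebraicSub {
  asD : forall x y, F x -> F y -> F (x + y);
  asM : forall x y, F x -> F y -> F (x * y);
  asZ : forall c, F (scal S c);
  asadj : forall x, F x -> F (adj S x);
  as_alg : forall x, F x -> exists2 p, p != 0 & pev S x p = 0;
  as_proper : forall x, F x -> adj S x * x = 0 -> x = 0
}.

Section Sub.
Context (F : set T) (FA : algebraic_sub F).

Lemma as1 : F 1.
Proof. by rewrite -(rmorph1 (scal S)); apply: asZ. Qed.

Lemma as0 : F 0.
Proof. by rewrite -(rmorph0 (scal S)); apply: asZ. Qed.

Lemma asN x : F x -> F (- x).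
Proof.
move=> Fx; rewrite -mulN1r -(rmorph1 (scal S)) -rmorphN.
by apply: (asM FA) => //; apply: asZ.
Qed.

Lemma asB x y : F x -> F y -> F (x - y).
Proof. by move=> Fx Fy; apply: asD => //; apply: asN. Qed.

Lemma as_sum (I : eqType) (r : seq I) (f : I -> T) :
  (forall i, i \in r -> F (f i)) -> F (\sum_(i <- r) f i).
Proof.
move=> Ff; rewrite big_seq; elim/big_ind: _ => //; first exact: as0.
exact: asD.
Qed.

Lemma as_pev x p : F x -> F (pev S x p).
Proof.
move=> Fx; elim/poly_ind: p => [|p c IH]; first by rewrite pev0; exact: as0.
rewrite pevD pevM pevX pevC; apply: (asD FA); last exact: (asZ FA).
exact: (asM FA).
Qed.

(* A nonreal root z of a self-adjoint h is spurious: if (h - z) y = 0 then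
   y^* h y is both self-adjoint and z y^* y.  A repeated real root is spurious
   since ((h - z) y)^* ((h - z) y) = y^* (h - z)^2 y. *)
Lemma nonreal_root h y (z : R[i]) : F y -> adj S h = h ->
  complex.Im z != 0 -> h * y = scal S z * y -> y = 0.
Proof.
move=> Fy hh zR hy; apply: (as_proper FA) => //.
have e1 : adj S y * (h * y) = scal S z * (adj S y * y).
  by rewrite hy !mulrA scalC.
have e2 : adj S y * (h * y) = scal S (conjc z) * (adj S y * y).
  rewrite -{1}hh mulrA -adjM hy adjM adjZ.
  by rewrite [RHS]mulrA [in RHS]scalC.
have : scal S (z - conjc z) * (adj S y * y) = 0.
  by rewrite rmorphB mulrBl -e1 -e2 subrr.
have zz : z - conjc z != 0.
  case: z zR {hy e1 e2} => a b /= b0; apply/eqP => -[_ /eqP].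
  by rewrite opprK -mulr2n mulrn_eq0 /= (negbTE b0).
move=> /(congr1 (fun x => scal S (z - conjc z)^-1 * x)).
by rewrite mulrA -rmorphM mulVf // rmorph1 mul1r mulr0.
Qed.

Lemma double_root h y (a : R) : F h -> F y -> adj S h = h ->
  (h - rs a) * ((h - rs a) * y) = 0 -> (h - rs a) * y = 0.
Proof.
move=> Fh Fy hh hy; apply: (as_proper FA).
  apply: (asM FA) => //; apply: asB => //; exact: (asZ FA).
by rewrite adjM adjB adjZr hh -mulrA hy mulr0.
Qed.

Definition rpoly (s : seq R) : {poly R[i]} := \prod_(a <- s) ('X - (a%:C%C)%:P).

(** Over the complex numbers an annihilating polynomial splits. Its roots leave the list [r] one by
    one: nonreal and repeated ones are dropped as spurious, the others move to the accumulator [s],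
    which starts empty. *)
Lemma real_simple_roots h : F h -> adj S h = h ->
  exists2 s : seq R, uniq s & pev S h (rpoly s) = 0.
Proof.
move=> Fh hh; have [p p0 hp] := as_alg FA Fh.
have [r pE] := closed_field_poly_normal p.
have hr : pev S h (rpoly [::] * \prod_(z <- r) ('X - z%:P)) = 0.
  rewrite /rpoly big_nil mul1r; move: hp; rewrite {1}pE -mul_polyC pevM pevC.
  move=> /(congr1 (fun x => scal S (lead_coef p)^-1 * x)).
  by rewrite mulrA -rmorphM mulVf ?lead_coef_eq0 // rmorph1 mul1r mulr0.
have : uniq (Nil R) by [].
elim: r (Nil R) hr {pE hp} => [|z r IH] s.
  by rewrite big_nil mulr1 => hs us; exists s.
rewrite big_cons mulrCA pevM pevXsubC => hs us.
set y := pev S h _ in hs.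
have Fy : F y by exact: as_pev.
have [zR|zR] := eqVneq (complex.Im z) 0; last first.
  apply: (IH s) => //; apply: (@nonreal_root h _ z) => //.
  by apply/eqP; rewrite -subr_eq0 -mulrBl hs.
have zE : z = ((complex.Re z)%:C)%C by case: z zR {hs} => a b /= ->.
move: hs; rewrite zE; set a := complex.Re z => hs.
have [as_|as_] := boolP (a \in s); last first.
  apply: (IH (a :: s)); last by rewrite /= as_.
  by rewrite /rpoly big_cons -mulrA pevM pevXsubC.
apply: (IH s) => //.
have yE : y = (h - rs a) * pev S h (rpoly (rem a s) * \prod_(z <- r) ('X - z%:P)).
  by rewrite /y /rpoly (perm_big _ (perm_to_rem as_)) /= big_cons -mulrA
    [LHS]pevM pevXsubC.
(* Since [a] is already in [s], the element [y] has a factor [h - a]; [hs] is then a square of that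
   factor killing the rest, and one occurrence can be removed. *)
rewrite -/y yE; apply: double_root => //; first exact: as_pev.
by rewrite -yE.
Qed.

(** Lagrange interpolation by induction on the nodes. With [c] the value of [rpoly s] at the new
    node [b], the component at [b] is [v = c^-1 * rpoly s * q], and [rpoly s] kills the remainder
    [q - v] because [1 - c^-1 * rpoly s] is divisible by ['X - b]. *)
Lemma eigen_split h (s : seq R) (q : {poly R[i]}) : uniq s ->
  pev S h (rpoly s * q) = 0 ->
  exists2 w : R -> {poly R[i]},
    forall a, a \in s -> h * pev S h (w a) = rs a * pev S h (w a)
    & \sum_(a <- s) pev S h (w a) = pev S h q.
Proof.
elim: s q => [|b s IH] q.
  rewrite /rpoly big_nil mul1r => _ q0; exists (fun=> 0) => //.
  by rewrite big_nil q0.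
rewrite /= => /andP[bs us]; rewrite /rpoly big_cons -mulrA.
rewrite -/(rpoly s) => hs.
pose c : R[i] := (rpoly s).[b%:C%C].
have c0 : c != 0.
  rewrite /c /rpoly horner_prod prodf_seq_neq0; apply/allP => a as_ /=.
  rewrite hornerXsubC subr_eq0; apply/eqP => -[ba].
  by rewrite ba as_ in bs.
have [g gE] : exists g, rpoly s = g * ('X - (b%:C%C)%:P) + c%:P.
  have /factor_theorem[g gE] : root (rpoly s - c%:P) b%:C%C.
    by rewrite rootE !hornerE subrr.
  by exists g; rewrite -gE subrK.
pose v := c^-1%:P * (rpoly s * q).
have [|w hw sw] := IH (q - v) us.
  have -> : rpoly s * (q - v) =
      - (c^-1%:P * g) * (('X - (b%:C%C)%:P) * (rpoly s * q)).
    have cc : c^-1%:P * c%:P = 1 :> {poly R[i]} by rewrite -polyCM mulVf.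
    transitivity ((1 - c^-1%:P * rpoly s) * (rpoly s * q)).
      by rewrite /v; ring.
    by rewrite [in X in 1 - X]gE mulrDr cc; ring.
  by rewrite pevM hs mulr0.
exists (fun a => if a == b then v else w a).
  move=> a; rewrite inE; have [-> _|_ /= /hw//] := eqVneq a b.
  apply/eqP; rewrite -subr_eq0 -mulrBl -pevXsubC -pevM /v mulrCA pevM.
  by rewrite hs mulr0.
rewrite big_cons eqxx big_seq (eq_bigr (fun a => pev S h (w a))); last first.
  by move=> a as_; case: eqVneq => // ab; rewrite -ab as_ in bs.
by rewrite -big_seq sw -pevD addrC subrK.
Qed.

(** The list [s] comes from an annihilating polynomial and may contain numbers that are not
    eigenvalues; then [e a = 0]. This is why later arguments distinguish whether [e a] vanishes. *)
Record spectral_dec h (s : seq R) (e : R -> T) : Prop := SpectralDec {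
  sd_uniq : uniq s;
  sd_in : forall a, a \in s -> F (e a);
  sd_adj : forall a, a \in s -> adj S (e a) = e a;
  sd_idem : forall a, a \in s -> e a * e a = e a;
  sd_orth : forall a b, a \in s -> b \in s -> a != b -> e a * e b = 0;
  sd_sum : \sum_(a <- s) e a = 1;
  sd_eig : forall a, a \in s -> h * e a = rs a * e a;
  sd_comm : forall y a, h * y = y * h -> a \in s -> e a * y = y * e a
}.

(** The components [e a] are polynomials with complex coefficients in [h], so self-adjointness is
    not automatic. Eigenspaces of different eigenvalues give [e a * adj S (e b) = 0], and the
    adjoints also sum to 1; hence [e a = e a * adj S (e a)], which is self-adjoint and therefore
    idempotent. *)
Theorem spectral h : F h -> adj S h = h -> exists s e, spectral_dec h s e.
Proof.
move=> Fh hh; have [s us hs] := real_simple_roots Fh hh.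
have [|w hw sw] := @eigen_split h s 1 us; first by rewrite mulr1.
rewrite pev1 in sw; pose e a := pev S h (w a).
have eh a : a \in s -> e a * h = rs a * e a.
  by move=> /hw <-; rewrite /e pev_commute_self.
have he a : a \in s -> h * adj S (e a) = rs a * adj S (e a).
  by move=> /eh /(congr1 (adj S)); rewrite !adjM adjZr hh scalC.
have cancel_ab (a b : R) x : a != b -> rs a * x = rs b * x -> x = 0.
  move=> ab /eqP; rewrite -subr_eq0 -mulrBl -!rmorphB /= => /eqP ax.
  have ab0 : ((a - b)%:C%C : R[i]) != 0.
    by apply/eqP => -[/eqP]; rewrite subr_eq0 (negbTE ab).
  by rewrite -[x]mul1r -(rmorph1 (scal S)) -(mulVf ab0) rmorphM -mulrA ax mulr0.
have orth x y (a b : R) : x * h = rs a * x -> h * y = rs b * y -> a != b ->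
    x * y = 0.
  move=> xh hy ab; apply: (cancel_ab _ _ _ ab).
  by rewrite mulrA -xh -mulrA hy !mulrA scalC.
have sum1 a (y : R -> T) : a \in s -> (forall b, b \in s -> a != b -> e a * y b = 0) ->
    \sum_(b <- s) y b = 1 -> e a = e a * y a.
  move=> as_ ay y1; rewrite -[LHS]mulr1 -y1 mulr_sumr.
  rewrite (bigD1_seq a) //= big1_seq ?addr0 // => b /andP[ba bs].
  by apply: ay; rewrite // eq_sym.
have eadj a : a \in s -> e a = e a * adj S (e a).
  move=> as_; apply: (sum1 a (fun b => adj S (e b))) => //.
    by move=> b bs ab; apply: (orth _ _ a b) => //; [exact: eh | exact: he].
  by rewrite -adj_sum sw adj1.
have esa a : a \in s -> adj S (e a) = e a.
  by move=> as_; rewrite [in LHS]eadj // adjM adjK -eadj.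
exists s, e; split=> //.
- by move=> a _; apply: as_pev.
- by move=> a as_; rewrite -{2}esa // -eadj.
- by move=> a b as_ bs; apply: (orth _ _ a b) => //; [exact: eh|exact: hw].
- by move=> y a hy _; apply: pev_commute.
Qed.

(** * Functional calculus on a spectral decomposition *)

Section FunCalc.
Context (h : T) (s : seq R) (e : R -> T) (sd : spectral_dec h s e).

Definition fcalc (f : R -> R) : T := \sum_(a <- s) rs (f a) * e a.

Lemma fcalc_eig f a : a \in s -> fcalc f * e a = rs (f a) * e a.
Proof.
move=> as_; rewrite mulr_suml (bigD1_seq a) ?(sd_uniq sd) //=.
rewrite -mulrA (sd_idem sd) // big1_seq ?addr0 // => b /andP[ba bs].
by rewrite -mulrA (sd_orth sd) ?mulr0.
Qed.

Lemma eq_fcalc f g : {in s, f =1 g} -> fcalc f = fcalc g.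
Proof. by move=> fg; apply: eq_big_seq => a /fg ->. Qed.

Lemma fcalcM f g : fcalc f * fcalc g = fcalc (fun a => f a * g a).
Proof.
rewrite mulr_sumr; apply: eq_big_seq => a as_.
rewrite mulrA -[fcalc f * _]scalC -mulrA fcalc_eig //.
by rewrite mulrA -rmorphM -rmorphM /= mulrC.
Qed.

Lemma fcalc1 : fcalc (fun=> 1) = 1.
Proof.
by rewrite -[RHS](sd_sum sd); apply: eq_bigr => a _; rewrite !rmorph1 mul1r.
Qed.

Lemma fcalc_id : fcalc id = h.
Proof.
rewrite -[RHS]mulr1 -(sd_sum sd) mulr_sumr; apply: eq_big_seq => a as_.
by rewrite (sd_eig sd).
Qed.

Lemma fcalc_adj f : adj S (fcalc f) = fcalc f.
Proof.
rewrite adj_sum; apply: eq_big_seq => a as_.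
by rewrite adjM adjZr (sd_adj sd) // scalC.
Qed.

Lemma fcalc_in f : F (fcalc f).
Proof.
apply: as_sum => a as_; apply: (asM FA); first exact: (asZ FA).
exact: (sd_in sd).
Qed.

Lemma fcalc_comm f y : h * y = y * h -> fcalc f * y = y * fcalc f.
Proof.
move=> hy; rewrite mulr_suml mulr_sumr; apply: eq_big_seq => a as_.
by rewrite -mulrA (sd_comm sd) // mulrA scalC mulrA.
Qed.

End FunCalc.

(** * Inverses and small perturbations in algebraic subalgebras *)

Definition sub_inv x y := [/\ F y, x * y = 1 & y * x = 1].

(** Take an annihilating polynomial [p]. If [p = g * 'X], injectivity of [x] lets [g] replace [p],
    of smaller degree. If the constant term is nonzero, solving [p(x) = 0] for it displays an
    inverse that is a polynomial in [x]. *)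
Lemma alg_inv x : F x -> (forall y, F y -> x * y = 0 -> y = 0) ->
  exists y, sub_inv x y.
Proof.
move=> Fx xcan; have [p] := as_alg FA Fx; have [n] := ubnP (size p).
elim: n p => // n IH p; rewrite ltnS => sp p0 px.
have [/factor_theorem[g gE]|p00] := boolP (root p 0).
  rewrite subr0 in gE; have g0 : g != 0.
    by apply: contraNneq p0 => g0; rewrite gE g0 mul0r.
  apply: (IH g) => //; first by rewrite gE size_mulX in sp.
  apply: xcan; first exact: as_pev.
  by rewrite -pev_commute_self -[X in _ * X](pevX S) -pevM -gE.
have /factor_theorem[g gE] : root (p - p.[0]%:P) 0.
  by rewrite rootE !hornerE subrr.
rewrite subr0 in gE.
have gx : pev S x g * x = scal S (- p.[0]).
  by rewrite -[X in _ * X](pevX S) -pevM -gE pevB px pevC sub0r rmorphN.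
have c0 : - p.[0] != 0 by rewrite oppr_eq0.
exists (scal S (- p.[0])^-1 * pev S x g); split.
- by apply: (asM FA); [exact: asZ | exact: as_pev].
- by rewrite mulrA -scalC -mulrA -pev_commute_self gx -rmorphM mulVf // rmorph1.
- by rewrite -mulrA gx -rmorphM mulVf // rmorph1.
Qed.

Lemma alg_perturb x (eps : R) : F x -> 0 < eps ->
  exists2 d, 0 < d < eps & exists y, sub_inv (x + rs d) y.
Proof.
move=> Fx eps0; have [p p0 px] := as_alg FA Fx.
(* The shift is invertible as soon as [- d] is not a root of [p]. There are [size p] distinct
   candidates, more than [p] has roots; the denominator [k.+2] keeps each strictly below [eps]. *)
pose dd k : R := eps / k.+2%:R.
pose r : seq R[i] := [seq (- dd k)%:C%C | k <- iota 0 (size p)].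
have ddinj : injective dd.
  move=> i j /(mulfI (lt0r_neq0 eps0)) /invr_inj /eqP.
  by rewrite eqr_nat => /eqP [].
have : ~~ all (root p) r.
  apply/negP => /(max_poly_roots p0); rewrite size_map size_iota ltnn => H.
  suff: false by []; apply: H; rewrite map_inj_uniq ?iota_uniq //.
  by move=> i j [/oppr_inj /ddinj].
case/allPn => _ /mapP[k _ ->] pd.
exists (dd k).
  rewrite divr_gt0 //= /dd ltr_pdivrMr // ltr_pMr // ltr1n //.
set d := dd k in pd *; pose c := p.[(- d)%:C%C].
have /factor_theorem[g gE] : root (p - c%:P) (- d)%:C%C.
  by rewrite rootE !hornerE subrr.
have gx : pev S x g * (x + rs d) = scal S (- c).
  have -> : x + rs d = pev S x ('X - ((- d)%:C%C)%:P).
    by rewrite pevXsubC !rmorphN /= opprK.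
  by rewrite -pevM -gE pevB px pevC sub0r rmorphN.
have c0 : - c != 0 by rewrite oppr_eq0.
exists (scal S (- c)^-1 * pev S x g); split.
- by apply: (asM FA); [exact: asZ | exact: as_pev].
- rewrite mulrA -scalC -mulrA (_ : (x + _) * _ = pev S x g * (x + rs d)).
    by rewrite gx -rmorphM mulVf // rmorph1.
  by symmetry; apply: pev_commute; rewrite mulrDl mulrDr scalC.
- by rewrite -mulrA gx -rmorphM mulVf // rmorph1.
Qed.

End Sub.
End Spectral.

(** * Polar decompositions and Schur complements *)

Section Polar.
Context {R : realType} {T : nzRingType} (S : star_alg R T).
Local Notation rs a := (scal S a%:C%C).
Implicit Types p q r s t u v w : T.

Definition sa_proj p := p * p = p /\ adj S p = p.

Definition star_equiv p q u := adj S u * u = p /\ u * adj S u = q.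

Lemma star_equiv_sym p q u : star_equiv p q u -> star_equiv q p (adj S u).
Proof. by rewrite /star_equiv adjK => -[]. Qed.

(* Compressing a *-equivalence to the corner makes [u = q u p] available
   without any properness assumption. *)
Lemma star_equiv_corner p q u : sa_proj p -> sa_proj q -> star_equiv p q u ->
  star_equiv p q (q * u * p).
Proof.
move=> [pp ph] [qq qh] [up uq]; rewrite /star_equiv !adjM ph qh; split.
  have -> : p * (adj S u * q) * (q * u * p)
      = p * (adj S u * (q * q) * u) * p by rewrite !mulrA.
  by rewrite qq -uq !mulrA -(mulrA p) up pp -(mulrA p) up pp pp.
have -> : q * u * p * (p * (adj S u * q))
    = q * (u * (p * p) * adj S u) * q by rewrite !mulrA.
by rewrite pp -up !mulrA -(mulrA q) uq qq -(mulrA q) uq qq qq.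
Qed.

Lemma star_equiv_trans p q r u v : sa_proj p -> sa_proj q -> sa_proj r ->
  star_equiv p q u -> star_equiv q r v -> star_equiv p r (v * u).
Proof.
move=> [pp _] [qq _] [rr _] [up uq] [vq vr]; rewrite /star_equiv !adjM; split.
  by rewrite mulrA -(mulrA (adj S u)) vq -uq !mulrA up -mulrA up pp.
by rewrite mulrA -(mulrA v) uq -vq !mulrA vr -mulrA vr rr.
Qed.

Lemma projC_corner p : sa_proj p -> sa_proj (1 - p).
Proof.
move=> [pp ph]; split; last by rewrite adjB adj1 ph.
by rewrite mulrBr mulr1 mulrBl mul1r pp subrr subr0.
Qed.

(* The Schur complement of the r-corner of an invertible v : p + r -> q + r. *)
Lemma schur_complement p q r v w d' : p * p = p -> q * q = q -> r * r = r ->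
  p * r = 0 -> r * p = 0 -> q * r = 0 -> r * q = 0 ->
  w * v = p + r -> v * w = q + r ->
  (p + r) * w = w -> w * (q + r) = w -> (q + r) * v = v -> v * (p + r) = v ->
  r * d' = d' -> d' * r = d' -> (r * v * r) * d' = r -> d' * (r * v * r) = r ->
  let s := q * (v - v * d' * v) * p in let t := p * w * q in
  t * s = p /\ s * t = q.
Proof.
move=> pp qq rr pr rp qr rq wv vw pw wq qv vp rd dr dd1 dd2 s t.
(* [m] is killed by [r] on both sides. So in [t * s] the middle [q] may be completed to [q + r], and
   in [s * t] the middle [p] to [p + r], after which [w] and [v] cancel. *)
have [m mE] : exists m, m = v - v * d' * v by exists (v - v * d' * v).
have pd : p * d' = 0 by rewrite -rd mulrA pr mul0r.
have dq : d' * q = 0 by rewrite -dr -mulrA rq mulr0.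
have rmp : r * m = 0.
  have vdv : r * v * d' = r.
    by rewrite -[in RHS]dd1 -mulrA -[in LHS]rd !mulrA.
  by rewrite mE mulrBr !mulrA vdv subrr.
have mr : m * r = 0.
  have vdv : d' * v * r = r.
    by rewrite -[in RHS]dd2 -[in LHS]dr !mulrA.
  by rewrite mE mulrBl -(mulrA v) -(mulrA v) vdv subrr.
have wm : w * m = (p + r) * (1 - d' * v).
  by rewrite mE mulrBr !mulrA wv mulrBr mulr1 !mulrA.
have mw : m * w = (1 - v * d') * (q + r).
  by rewrite mE mulrBl -[v * d' * v * w]mulrA vw mulrBl mul1r.
split; rewrite /s /t -mE.
  have -> : p * w * q * (q * m * p) = p * (w * (q * q) * m) * p by rewrite !mulrA.
  have -> : w * (q * q) * m = w * m.
    rewrite qq -[in RHS]wq mulrDr mulrDl -[w * r * m]mulrA rmp mulr0 addr0.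
    by [].
  rewrite wm mulrA [p * (p + r)]mulrDr pp pr addr0 mulrBr mulr1 mulrA pd mul0r subr0.
  exact: pp.
have -> : q * m * p * (p * w * q) = q * (m * (p * p) * w) * q by rewrite !mulrA.
have -> : m * (p * p) * w = m * w.
  by rewrite pp -[in RHS]pw mulrA mulrDr mr addr0.
rewrite mw -!mulrA [(q + r) * q]mulrDl qq rq addr0 mulrBl mul1r.
by rewrite -mulrA dq mulr0 subr0 qq.
Qed.

Context (F : set T) (FA : algebraic_sub S F).
Hypothesis Fpos : forall x y z, F x -> F y -> F z ->
  adj S x * x + adj S y * y + adj S z * z = 0 -> x = 0.

(** The *-equivalence is [s * h^(-1/2)], where adding [1 - p] makes the positive element
    [adj S s * s] of the corner invertible in the whole algebra. *)
Lemma polar p q s t : F p -> sa_proj p -> F s -> q * s = s -> s * p = s ->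
  p * t = t -> t * s = p -> s * t = q -> adj S q = q ->
  exists2 u, F u & star_equiv p q u.
Proof.
move=> Fp [pp ph] Fs qs sp pt ts st qh.
have F1 := as1 FA.
have Fc : F (1 - p) by apply: (asB FA).
have [qcc qch] : sa_proj (1 - p) by apply: projC_corner.
pose h := adj S s * s + (1 - p).
have Fh : F h by apply: (asD FA) => //; apply: (asM FA) => //; exact: (asadj FA).
have hh : adj S h = h by rewrite /h adjD adjM adjK qch.
have [l [e sd]] := spectral FA Fh hh.
(* For [a <= 0] the equation [h e = a e] becomes a vanishing sum of three squares, from [s e],
   [(1 - p) e] and [sqrt (- a) e]. This is the origin of the three terms in [Fpos]. Then [s e = 0]
   and [e = p e = t s e = 0]. *)
have epos a : a \in l -> e a != 0 -> 0 < a.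
  move=> al; apply: contraNT; rewrite -leNgt => a0; apply/eqP.
  have Fe := sd_in sd al; have ea := sd_adj sd al; have ee := sd_idem sd al.
  pose z := rs (Num.sqrt (- a)) * e a.
  have Fz : F z by apply: (asM FA) => //; exact: (asZ FA).
  have zz : adj S z * z = - (rs a * e a).
    rewrite /z adjM adjZr ea mulrA -(mulrA (e a)) -rmorphM -rmorphM /=.
    rewrite -expr2 sqr_sqrtr ?oppr_ge0 // !rmorphN /= mulrN mulNr.
    by rewrite -scalC -mulrA ee.
  have Fse : F (s * e a) by apply: (asM FA).
  have Fce : F ((1 - p) * e a) by apply: (asM FA).
  have sum0 : adj S (s * e a) * (s * e a)
      + adj S ((1 - p) * e a) * ((1 - p) * e a) + adj S z * z = 0.
    rewrite zz !adjM qch ea.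
    have -> : e a * adj S s * (s * e a) + e a * (1 - p) * ((1 - p) * e a)
       = e a * (adj S s * s + (1 - p) * (1 - p)) * e a.
      by rewrite [in RHS]mulrDr [in RHS]mulrDl !mulrA.
    by rewrite qcc -/h -mulrA (sd_eig sd al) mulrA -scalC -mulrA ee subrr.
  have se : s * e a = 0 by exact: (Fpos Fse Fce Fz sum0).
  have ce : (1 - p) * e a = 0.
    by apply: (Fpos Fce Fse Fz); rewrite [X in X + _]addrC sum0.
  have -> : e a = p * e a by apply/eqP; rewrite -subr_eq0 -{1}[e a]mul1r -mulrBl ce.
  by rewrite -ts -mulrA se mulr0.
pose k := fcalc S l e (fun a => (Num.sqrt a)^-1).
have Fk : F k by apply: (fcalc_in FA sd).
have kh : adj S k = k by apply: (fcalc_adj sd).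
have khk : k * h * k = 1.
  rewrite -(fcalc_id sd) /k !(fcalcM sd) -(fcalc1 sd).
  apply: eq_big_seq => a al; have [->|/(epos _ al) a0] := eqVneq (e a) 0.
    by rewrite !mulr0.
  congr (rs _ * _); rewrite -{2}(sqr_sqrtr (ltW a0)) expr2.
  have s0 : Num.sqrt a != 0 by rewrite gt_eqF // sqrtr_gt0.
  by rewrite mulrA mulVf // mul1r mulfV.
have kkh : (k * k) * h = 1.
  have kc : k * h = h * k by apply: (fcalc_comm sd).
  by rewrite -mulrA kc mulrA.
have ps : p * adj S s = adj S s by rewrite -{1}ph -adjM sp.
have hp : h * p = adj S s * s.
  by rewrite /h mulrDl -mulrA sp mulrBl mul1r pp subrr addr0.
have ph' : p * h = adj S s * s.
  by rewrite /h mulrDr mulrA ps mulrBr mulr1 pp subrr addr0.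
have kp : k * p = p * k by apply: (fcalc_comm sd); rewrite hp ph'.
exists (s * k); first by apply: (asM FA).
rewrite /star_equiv adjM kh; split.
  have -> : k * adj S s * (s * k) = k * (adj S s * s) * k by rewrite !mulrA.
  by rewrite -ph' mulrA kp -!mulrA [k * (h * k)]mulrA khk mulr1.
(* The range projection fixes [s]; multiplying by [t] on the right, where [s * t = q], identifies it
   with [q]. *)
have us : s * k * (k * adj S s) * s = s.
  have -> : s * k * (k * adj S s) * s = s * ((k * k) * (adj S s * s)).
    by rewrite !mulrA.
  by rewrite -hp (mulrA (k * k)) kkh mul1r.
have -> : s * k * (k * adj S s) = s * k * (k * adj S s) * q.
  have sq : adj S s * q = adj S s by rewrite -[in LHS]qh -adjM qs.
  by rewrite -!mulrA sq.
by rewrite -[in LHS]st mulrA us.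
Qed.
End Polar.

(** * Newton iteration in Banach *-algebras *)

Section Geometric.
Context {R : realType}.

Definition half_pow (n : nat) : R := (2 ^+ n)^-1.

Lemma half_pow_gt0 n : 0 < half_pow n.
Proof. by rewrite invr_gt0 exprn_gt0. Qed.

Lemma half_powS n : half_pow n = half_pow n.+1 + half_pow n.+1.
Proof. by rewrite /half_pow exprS; field; rewrite expf_neq0 // pnatr_eq0. Qed.

Lemma half_pow_le1 n : half_pow n <= 1.
Proof.
elim: n => [|n IH]; first by rewrite /half_pow expr0 invr1.
by have := half_powS n; have := half_pow_gt0 n.+1; lra.
Qed.

Lemma half_pow_small (c e : R) : 0 <= c -> 0 < e -> exists n, c * half_pow n < e.
Proof.
move=> c0 e0; pose n := Num.bound (c / e); exists n.
rewrite /half_pow ltr_pdivrMr ?exprn_gt0 // mulrC -ltr_pdivrMr //.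
have := archi_boundP (divr_ge0 c0 (ltW e0)); rewrite -/n => /lt_le_trans; apply.
by rewrite -natrX ler_nat ltnW // ltn_expl.
Qed.

End Geometric.

(** The norm of 1 is not normalised, so projections can have norm above 1. The estimates below
    therefore carry factors such as [N p]. *)
Record banach_norm (R : realType) (T : nzRingType) (S : star_alg R T) :=
    BanachNorm {
  nrm : T -> R;
  nrm_eq0 : forall x, nrm x = 0 -> x = 0;
  nrmD : forall x y, nrm (x + y) <= nrm x + nrm y;
  nrmM : forall x y, nrm (x * y) <= nrm x * nrm y;
  nrmZ : forall (a : R) x, nrm (scal S a%:C%C * x) = `|a| * nrm x;
  nrm_adj : forall x, nrm (adj S x) = nrm x;
  nrm_complete : forall u : nat -> T,
    (forall e : R, 0 < e -> exists N, forall m n, (N <= m)%N -> (N <= n)%N ->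
      nrm (u m - u n) < e) ->
    exists l, forall e : R, 0 < e -> exists N, forall n, (N <= n)%N ->
      nrm (u n - l) < e
}.

Section Banach.
Context {R : realType} {T : nzRingType} {S : star_alg R T}.
Context (B : banach_norm S).
Local Notation rs a := (scal S a%:C%C).
Local Notation N := (nrm B).
Implicit Types p q r s t w x y h l : T.

Lemma nrmN x : N (- x) = N x.
Proof.
have -> : - x = rs (-1) * x by rewrite rmorphN rmorph1 rmorphN rmorph1 mulN1r.
by rewrite nrmZ normrN normr1 mul1r.
Qed.

Lemma nrm0 : N 0 = 0.
Proof. by rewrite -[0](mulr0 (rs 0)) nrmZ normr0 mul0r. Qed.

Lemma nrm_ge0 x : 0 <= N x.
Proof. by have := nrmD B x (- x); rewrite subrr nrm0 nrmN; lra. Qed.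

Lemma nrmB x y : N (x - y) <= N x + N y.
Proof. by rewrite -(nrmN y); apply: nrmD. Qed.

Lemma nrm_sym x y : N (x - y) = N (y - x).
Proof. by rewrite -nrmN opprB. Qed.

Lemma nrm_tri z x y : N (x - y) <= N (x - z) + N (z - y).
Proof. by rewrite -(subrKA z); apply: nrmD. Qed.

Lemma nrmM_le x y a b : N x <= a -> N y <= b -> N (x * y) <= a * b.
Proof.
by move=> xa yb; apply: (le_trans (nrmM B x y)); apply: ler_pM => //; exact: nrm_ge0.
Qed.

Lemma nrmD_le x y a b : N x <= a -> N y <= b -> N (x + y) <= a + b.
Proof. by move=> xa yb; apply: (le_trans (nrmD B x y)); apply: lerD. Qed.

Lemma nrm_small0 x : (forall e : R, 0 < e -> N x < e) -> x = 0.
Proof.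
move=> H; apply: (nrm_eq0 (b := B)); apply/eqP; rewrite eq_le nrm_ge0 andbT.
by have [//|/H] := lerP (N x) 0; rewrite ltxx.
Qed.

Lemma nrm_le_small0 x (c : R) : 0 <= c -> (forall n, N x <= c * half_pow n) -> x = 0.
Proof.
move=> c0 H; apply: nrm_small0 => e e0; have [n] := half_pow_small c0 e0.
exact: le_lt_trans.
Qed.

Lemma geometric_limit (u : nat -> T) (c : R) : 0 <= c ->
  (forall n, N (u n.+1 - u n) <= c * half_pow n) ->
  exists l, forall n, N (u n - l) <= 2 * c * half_pow n.
Proof.
move=> c0 uc.
have u_far k n : N (u (n + k)%N - u n) <= 2 * c * (half_pow n - half_pow (n + k)).
  elim: k => [|k IH]; first by rewrite addn0 !subrr nrm0 mulr0.
  rewrite addnS; apply: (le_trans (nrm_tri (u (n + k)%N) _ _)).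
  apply: (le_trans (lerD (uc _) IH)).
  have E : c * half_pow (n + k) = c * half_pow (n + k).+1 + c * half_pow (n + k).+1.
    by rewrite -mulrDr -half_powS.
  by lra.
have u_far' m n : (n <= m)%N -> N (u m - u n) <= 2 * c * half_pow n.
  move=> nm; have := u_far (m - n)%N n; rewrite subnKC //.
  by have := mulr_ge0 c0 (ltW (half_pow_gt0 (R := R) m)); lra.
have [e e0|l ul] := nrm_complete (b := B) (u := u).
  have [n0 H] := @half_pow_small R (2 * (2 * c)) e ltac:(lra) e0.
  exists n0 => m n hm hn; apply: (le_lt_trans (nrm_tri (u n0) _ _)).
  rewrite [X in _ + X]nrm_sym.
  by have := u_far' _ _ hm; have := u_far' _ _ hn; lra.
exists l => n; apply/ler_addgt0Pr => e /ul[m0 Hm].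
apply: (le_trans (nrm_tri (u (maxn m0 n)) _ _)); rewrite nrm_sym.
apply: lerD; first by apply: u_far'; exact: leq_maxr.
by apply/ltW/Hm; exact: leq_maxl.
Qed.

(* The Newton-Schulz iteration x (3 - x^* x) / 2 for the polar part of x. *)
Definition polar_step p x := x + x * (rs 2^-1 * (p - adj S x * x)).

Lemma polar_step_sub p x :
  polar_step p x - x = x * (rs 2^-1 * (p - adj S x * x)).
Proof. by rewrite /polar_step addrAC subrr add0r. Qed.

(** The defect [2 g] becomes [3 g^2 + 2 g^3], so convergence is quadratic. Adding [1 - p] removes
    the corner and leaves the identity [(1 + g)^2 (1 - 2 g) = 1 - 3 g^2 - 2 g^3] in one variable,
    checked on polynomials and transported by [pev]. *)
Lemma polar_step_defect p x : sa_proj S p -> x * p = x ->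
  let g := rs 2^-1 * (p - adj S x * x) in
  p - adj S (polar_step p x) * polar_step p x =
  g * g + g * g + g * g + g * g * g + g * g * g.
Proof.
move=> [pp ph] xp g0; rewrite {}/g0 /polar_step; set e := p - adj S x * x.
have eh : adj S e = e by rewrite /e adjB adjM adjK ph.
have pax : p * adj S x = adj S x by rewrite -{1}ph -adjM xp.
have ep : e * p = e by rewrite /e mulrBl pp -mulrA xp.
have pe : p * e = e by rewrite /e mulrBr pp mulrA pax.
pose g := rs 2^-1 * e.
have gh : adj S g = g by rewrite /g adjM eh adjZr scalC.
have eE : e = g + g.
  rewrite /g -mulrDl -rmorphD -rmorphD /= -[e in LHS]mul1r -(rmorph1 (scal S)).
  by congr (scal S _%:C%C * _); field.
have xx : adj S x * x = (1 - e) - (1 - p) by by rewrite /e !opprB addrA -[1 + _ + p]addrA subrK [RHS]addrC addKr.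
have gp : (1 + g) * (1 - p) = 1 - p.
  by rewrite mulrDl mul1r /g -mulrA mulrBr mulr1 ep subrr mulr0 addr0.
have pg : (1 - p) * (1 + g) = 1 - p.
  by rewrite mulrDr mulr1 /g mulrA -scalC -mulrA mulrBl mul1r pe subrr mulr0 addr0.
have -> : x + x * g = x * (1 + g) by rewrite mulrDr mulr1.
rewrite adjM adjD adj1 gh mulrA -(mulrA (1 + g)) xx mulrBr mulrBl gp pg.
have -> : (1 + g) * (1 - e) * (1 + g) =
    1 - (g * g + g * g + g * g + g * g * g + g * g * g).
  rewrite eE; pose X : {poly R[i]} := 'X.
  transitivity (pev S g ((1 + X) * (1 - (X + X)) * (1 + X))).
    by rewrite !(pevM, pevD, pevN, pev1, pevX).
  rewrite (_ : _ * _ = 1 - (X * X + X * X + X * X + X * X * X + X * X * X));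
    last by ring.
  by rewrite !(pevM, pevD, pevN, pev1, pevX).
by rewrite opprB addrA [p + _]addrC subrK opprB addrC subrK.
Qed.


(** Convergence with an explicit geometric rate is stable under sums, products and adjoints, which
    makes a topology on [T] unnecessary. *)
Definition geo_lim (u : nat -> T) l :=
  exists2 c, 0 <= c & forall n, N (u n - l) <= c * half_pow n.

Lemma geo_lim_uniq (u : nat -> T) l (m : T) : geo_lim u l -> geo_lim u m -> l = m.
Proof.
move=> [c c0 ul] [d d0 um]; apply/eqP; rewrite -subr_eq0; apply/eqP.
apply: (@nrm_le_small0 _ (c + d)); first exact: addr_ge0.
move=> n; apply: (le_trans (nrm_tri (u n) _ _)).
by rewrite nrm_sym mulrDl lerD.
Qed.

Lemma geo_lim_cst l : geo_lim (fun=> l) l.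
Proof. by exists 0 => // n; rewrite subrr nrm0 mul0r. Qed.

Lemma geo_limD (u v : nat -> T) l (m : T) : geo_lim u l -> geo_lim v m ->
  geo_lim (fun n => u n + v n) (l + m).
Proof.
move=> [c c0 ul] [d d0 um]; exists (c + d); first exact: addr_ge0.
by move=> n; rewrite opprD addrACA mulrDl; apply: nrmD_le.
Qed.

Lemma geo_limN (u : nat -> T) l : geo_lim u l -> geo_lim (fun n => - u n) (- l).
Proof. by move=> [c c0 ul]; exists c => // n; rewrite -opprD nrmN. Qed.

Lemma geo_limB (u v : nat -> T) l (m : T) : geo_lim u l -> geo_lim v m ->
  geo_lim (fun n => u n - v n) (l - m).
Proof. by move=> ul vm; apply: geo_limD => //; apply: geo_limN. Qed.

Lemma geo_lim_adj (u : nat -> T) l : geo_lim u l -> geo_lim (fun n => adj S (u n)) (adj S l).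
Proof. by move=> [c c0 ul]; exists c => // n; rewrite -adjB nrm_adj. Qed.

Lemma nrm_prod_diff (a b c d : T) : N (a * b - c * d) <= N a * N (b - d) + N (a - c) * N d.
Proof.
have -> : a * b - c * d = a * (b - d) + (a - c) * d.
  by rewrite mulrBr mulrBl addrA subrK.
by apply: nrmD_le; apply: nrmM.
Qed.

Lemma geo_limM (u v : nat -> T) l (m : T) : geo_lim u l -> geo_lim v m ->
  geo_lim (fun n => u n * v n) (l * m).
Proof.
move=> [c c0 ul] [d d0 vm].
exists ((c + N l) * d + c * N m).
  by rewrite addr_ge0 // mulr_ge0 ?addr_ge0 ?nrm_ge0.
move=> n; apply: (le_trans (nrm_prod_diff _ _ _ _)).
rewrite (_ : _ * half_pow n = (c + N l) * (d * half_pow n) + c * half_pow n * N m);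
  last by ring.
apply: lerD.
  apply: ler_pM => //; try exact: nrm_ge0.
  rewrite -(subrK l (u n)); apply: (nrmD_le _ (lexx _)).
  apply: (le_trans (ul n)); rewrite -[X in _ <= X]mulr1.
  by rewrite ler_wpM2l // half_pow_le1.
by apply: ler_pM => //; try exact: nrm_ge0.
Qed.

Lemma geo_lim_bound0 (u : nat -> T) (c : R) : 0 <= c ->
  (forall n, N (u n) <= c * half_pow n) -> geo_lim u 0.
Proof. by move=> c0 H; exists c => // n; rewrite subr0. Qed.

Lemma nrm_half x : N (rs 2^-1 * x) = N x / 2.
Proof. by rewrite nrmZ ger0_norm ?invr_ge0 // mulrC. Qed.

(** For [N g <= 1/4] the new defect [3 g^2 + 2 g^3] has norm at most [7/8 * N g], that is, [7/16] of
    the old one. *)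
Lemma polar_step_bound p x : sa_proj S p -> x * p = x ->
  N (p - adj S x * x) <= 1 / 2 ->
  N (p - adj S (polar_step p x) * polar_step p x) <= N (p - adj S x * x) / 2.
Proof.
move=> pP xp; rewrite polar_step_defect //=; set e := p - _.
set g := rs 2^-1 * e; have Ng : N g = N e / 2 by exact: nrm_half.
have g0 := nrm_ge0 g; move=> e2.
have gg : N (g * g) <= N g * N g by exact: nrmM.
have ggg : N (g * g * g) <= N g * N g * N g by apply: nrmM_le.
have H := nrmD_le (nrmD_le (nrmD_le (nrmD_le gg gg) gg) ggg) ggg.
apply: (le_trans H); nra.
Qed.

(** The factor [2 - half_pow n] is designed to absorb the growth [1 + half_pow n / 4] of one step,
    so the iterates stay bounded by [2 * N x]. *)
Lemma polar_iterP p x n : sa_proj S p -> x * p = x ->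
  N (p - adj S x * x) <= 1 / 2 ->
  let u := iter n (polar_step p) x in
  [/\ u * p = u, N (p - adj S u * u) <= half_pow n / 2 &
      N u <= N x * (2 - half_pow n)].
Proof.
move=> pP xp x2; elim: n => [|n [IH1 IH2 IH3]] /=.
  by rewrite /half_pow expr0 invr1; split=> //; lra.
set u := iter n _ x in IH1 IH2 IH3 *.
have u2 : N (p - adj S u * u) <= 1 / 2.
  by have := half_pow_le1 (R := R) n; lra.
have h0 := half_pow_gt0 (R := R) n; have hS := half_powS (R := R) n.
split.
- have [pp ph] := pP.
  by rewrite /polar_step mulrDl IH1 -!mulrA mulrBl pp -mulrA IH1.
- by have := polar_step_bound pP IH1 u2; lra.
- apply: (@le_trans _ _ (N u * (1 + half_pow n / 4))).
    rewrite mulrDr mulr1; apply: (nrmD_le (lexx _)).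
    by apply: nrmM_le => //; rewrite nrm_half; lra.
  apply: (@le_trans _ _ (N x * (2 - half_pow n) * (1 + half_pow n / 4))).
    by rewrite ler_wpM2r //; lra.
  rewrite -mulrA ler_wpM2l ?nrm_ge0 //.
  by have := half_pow_le1 (R := R) n; nra.
Qed.

Lemma polar_step_adj p q x : sa_proj S p -> sa_proj S q ->
  q * x = x -> x * p = x -> adj S (polar_step p x) = polar_step q (adj S x).
Proof.
move=> [pp ph] [qq qh] qx xp; rewrite /polar_step adjD adjK; congr (_ + _).
have pax : p * adj S x = adj S x by rewrite -{1}ph -adjM xp.
have axq : adj S x * q = adj S x by rewrite -{1}qh -adjM qx.
have eh : adj S (p - adj S x * x) = p - adj S x * x by rewrite adjB adjM adjK ph.
rewrite adjM adjM eh adjZr -scalC -mulrA mulrBl pax -mulrA.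
by rewrite [RHS]mulrA -scalC -[RHS]mulrA [adj S x * (_ - _)]mulrBr axq.
Qed.

(** The iteration is built to repair only the initial projection [p]. By [polar_step_adj] the
    adjoints of its iterates form the same iteration for [q] started at [adj S x], so the final
    projection converges to [q] simultaneously. *)
Lemma newton_polar p q x : sa_proj S p -> sa_proj S q -> q * x = x -> x * p = x ->
  N (p - adj S x * x) <= 1 / 2 -> N (q - x * adj S x) <= 1 / 2 ->
  exists u, star_equiv S p q u.
Proof.
move=> pP qP qx xp px xq; pose u n := iter n (polar_step p) x.
have axq : adj S x * q = adj S x by case: qP => _ qh; rewrite -{1}qh -adjM qx.
have uq n : q * u n = u n.
  by elim: n => //= n IH; rewrite /polar_step mulrDr IH mulrA IH.
have up n : u n * p = u n by have [] := polar_iterP n pP xp px.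
have uadj n : adj S (u n) = iter n (polar_step q) (adj S x).
  by elim: n => //= n IH; rewrite (polar_step_adj pP qP) ?IH.
have [||l ul] := @geometric_limit u (N x).
- exact: nrm_ge0.
- move=> n; have [_ H1 H2] := polar_iterP n pP xp px.
  rewrite /= polar_step_sub -/(u n) in H1 H2 *.
  have h0 := half_pow_gt0 (R := R) n; have x0 := nrm_ge0 x.
  apply: (@le_trans _ _ (N x * (2 - half_pow n) * (half_pow n / 4))).
    by apply: nrmM_le => //; rewrite nrm_half; lra.
  rewrite -mulrA ler_wpM2l //.
  by have := half_pow_le1 (R := R) n; nra.
have {}ul : geo_lim u l by exists (2 * N x) => //; rewrite mulr_ge0 ?nrm_ge0.
exists l; split; apply/esym/eqP; rewrite -subr_eq0; apply/eqP.
  apply: geo_lim_uniq (geo_limB (geo_lim_cst p) (geo_limM (geo_lim_adj ul) ul)) _.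
  apply: (@geo_lim_bound0 _ 2^-1) => [|n]; first by rewrite invr_ge0.
  by have [_ H _] := polar_iterP n pP xp px; rewrite mulrC.
apply: geo_lim_uniq (geo_limB (geo_lim_cst q) (geo_limM ul (geo_lim_adj ul))) _.
apply: (@geo_lim_bound0 _ 2^-1) => [|n]; first by rewrite invr_ge0.
have [|_ H _] := polar_iterP n qP axq; first by rewrite adjK.
by move: H; rewrite -uadj adjK mulrC.
Qed.

Lemma close_proj_equiv p q : sa_proj S p -> sa_proj S q ->
  N p * N (p - q) * N p <= 1 / 2 -> N q * N (p - q) * N q <= 1 / 2 ->
  exists u, star_equiv S p q u.
Proof.
move=> pP qP pq qp; have [pp ph] := pP; have [qq qh] := qP.
apply: (@newton_polar _ _ (q * p)) => //.
- by rewrite mulrA qq.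
- by rewrite -mulrA pp.
- rewrite adjM ph qh; have -> : p - p * q * (q * p) = p * (p - q) * p.
    by rewrite mulrBr mulrBl pp pp -!mulrA (mulrA q q) qq.
  by apply: le_trans pq; do !apply: nrmM_le.
- rewrite adjM ph qh; have -> : q - q * p * (p * q) = q * (q - p) * q.
    by rewrite mulrBr mulrBl qq qq -!mulrA (mulrA p p) pp.
  by apply: le_trans qp; do !apply: nrmM_le => //; rewrite nrm_sym.
Qed.

End Banach.

(** * Idempotents close to a subalgebra *)

Lemma small_factor3 (R : realFieldType) (A B C a b c : R) :
  0 <= A -> 0 <= B -> 0 <= C -> 0 < a -> 0 < b -> 0 < c ->
  exists2 t, 0 < t & [/\ t * A < a, t * B < b & t * C < c].
Proof.
move=> A0 B0 C0 a0 b0 c0; pose m := Num.min a (Num.min b c).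
have m0 : 0 < m by rewrite !lt_min a0 b0.
pose D := A + B + C + 1; have D0 : 0 < D by rewrite /D; lra.
have key X y : 0 <= X -> X < D -> m <= y -> m / D * X < y.
  move=> X0 XD my; apply: lt_le_trans my; rewrite mulrAC -mulrA gtr_pMr //.
  by rewrite ltr_pdivrMr // mul1r.
exists (m / D); first by rewrite divr_gt0.
split; apply: key => //; rewrite /D /m ?ge_min ?lexx ?orbT //; lra.
Qed.

Section IdemStep.
Context {Q : nzRingType}.

(** Stated over any ring because it is used three times: in the algebra, on polynomials to verify
    identities, and on real eigenvalues. Multiples are spelled out as sums so that ring morphisms
    and the triangle inequality apply directly. *)
Definition idem_step (x : Q) := x * x + x * x + x * x - (x * x * x + x * x * x).

Definition idem_defect (x : Q) := x * x - x.

End IdemStep.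

Section NearProj.
Context {R : realType} {T : nzRingType} {S : star_alg R T} (B : banach_norm S).
Local Notation rs a := (scal S a%:C%C).
Local Notation N := (nrm B).

Lemma idem_step_defect (x : T) : let d := idem_defect x in
  idem_defect (idem_step x) = d * d * (d + d + d + d) - (d * d + d * d + d * d).
Proof.
move=> d; rewrite {}/d; pose X : {poly R[i]} := 'X.
pose dX := idem_defect X.
transitivity (pev S x (idem_defect (idem_step X))).
  by rewrite /idem_defect /idem_step !(pevM, pevD, pevN, pevX).
transitivity (pev S x (dX * dX * (dX + dX + dX + dX) - (dX * dX + dX * dX + dX * dX))).
  by congr (pev S x _); rewrite /dX /idem_defect /idem_step; ring.
by rewrite /dX /idem_defect !(pevM, pevD, pevN, pevX).
Qed.

Lemma idem_step_sub (x : T) :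
  idem_step x - x = idem_defect x - (x * idem_defect x + x * idem_defect x).
Proof.
pose X : {poly R[i]} := 'X.
transitivity (pev S x (idem_step X - X)).
  by rewrite /idem_step !(pevM, pevD, pevN, pevX).
transitivity (pev S x (idem_defect X - (X * idem_defect X + X * idem_defect X))).
  by congr (pev S x _); rewrite /idem_defect /idem_step; ring.
by rewrite /idem_defect !(pevM, pevD, pevN, pevX).
Qed.

(** The defect evolves by [4 d^3 - 3 d^2], which [1/16] makes at most half of [d]. The step is
    [d - 2 u d], of norm at most [(1 + 2 * N u) * N d]; tracking [1 + 2 * N u] turns the growth into
    a convergent product. *)
Lemma idem_iter_bound (x : T) n : N (idem_defect x) <= 1 / 16 ->
  let u := iter n idem_step x in
  N (idem_defect u) <= N (idem_defect x) * half_pow n /\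
  1 + 2 * N u <= (1 + 2 * N x) * (2 - half_pow n).
Proof.
move=> d1; elim: n => [|n [IH1 IH2]] /=.
  by rewrite /half_pow expr0 invr1 mulr1; split=> //; lra.
set u := iter n _ x in IH1 IH2 *; set d := idem_defect u in IH1.
have h0 := half_pow_gt0 (R := R) n; have hS := half_powS (R := R) n.
have h1 := half_pow_le1 (R := R) n.
have d0 := nrm_ge0 B d; have x0 := nrm_ge0 B (idem_defect x).
have nu := nrm_ge0 B u; have nx := nrm_ge0 B x.
have dx : N d <= half_pow n / 16.
  apply: (le_trans IH1); rewrite mulrC ler_wpM2l ?(ltW h0) //; lra.
split.
  rewrite idem_step_defect -/d.
  apply: (@le_trans _ _ (N d * N d * (N d + N d + N d + N d)
                         + (N d * N d + N d * N d + N d * N d))).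
    apply: (le_trans (nrmB B _ _)).
    by apply: lerD; do ?[apply: nrmM_le | apply: nrmD_le].
  apply: (@le_trans _ _ (N d / 2)); first by nra.
  have := IH1; rewrite [half_pow n]half_powS mulrDr; lra.
have := nrm_tri B u (idem_step u) 0; rewrite !subr0 idem_step_sub -/d => H.
have : N (d - (u * d + u * d)) <= N d + (N u * N d + N u * N d).
  apply: (le_trans (nrmB B _ _)); apply: lerD => //.
  by apply: nrmD_le; apply: nrmM.
move=> H2.
have H3 : 1 + 2 * N (idem_step u) <= (1 + 2 * N u) * (1 + half_pow n / 4) by nra.
apply: (le_trans H3).
apply: (@le_trans _ _ ((1 + 2 * N x) * (2 - half_pow n) * (1 + half_pow n / 4))).
  by rewrite ler_wpM2r //; lra.
rewrite -mulrA ler_wpM2l //; first by lra.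
nra.
Qed.

Lemma small_idem0 (y : T) : y * y = y -> N y < 1 -> y = 0.
Proof.
move=> yy y1; apply: (nrm_eq0 (b := B)); apply/eqP.
have := nrmM B y y; rewrite yy; have := nrm_ge0 B y; rewrite le_eqVlt.
by case/orP => [/eqP <- //|y0]; nra.
Qed.

Context (F : set T) (FA : algebraic_sub S F).

(* The limit of the Newton iteration x -> 3x^2 - 2x^3 lies in F: on each
   spectral subspace it is an idempotent close to a scalar, hence 0 or 1. *)
Lemma near_proj x : F x -> adj S x = x -> N (idem_defect x) <= 1 / 16 ->
  exists l, [/\ F l, sa_proj S l,
    N (x - l) <= 4 * (1 + 2 * N x) * N (idem_defect x) &
    forall y, x * y = 0 -> l * y = 0].
Proof.
move=> Fx xh d1; pose u n := iter n idem_step x.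
set d := N (idem_defect x) in d1 *; pose K := 1 + 2 * N x.
have nx := nrm_ge0 B x; have d0 : 0 <= d by exact: nrm_ge0.
have K0 : 0 < K by rewrite /K; lra.
have dK0 : 0 <= d * K by rewrite mulr_ge0 // ltW.
have ub n := idem_iter_bound n d1.
have [||l ul] := @geometric_limit R T S B u (2 * (d * K)).
- by rewrite mulr_ge0.
- move=> n; have [H1 H2] := ub n; rewrite -/(u n) -/d -/K in H1 H2.
  have h0 := half_pow_gt0 (R := R) n.
  rewrite /u /= -/(u n) idem_step_sub.
  apply: (@le_trans _ _ (d * half_pow n * (K * (2 - half_pow n)))); last by nra.
  apply: (@le_trans _ _ (N (idem_defect (u n)) * (1 + 2 * N (u n)))); last first.
    apply: ler_pM => //; first exact: nrm_ge0.
    by have := nrm_ge0 B (u n); lra.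
  apply: (le_trans (nrmB B _ _)).
  have := nrmD_le (nrmM B (u n) (idem_defect (u n))) (nrmM B (u n) (idem_defect (u n))).
  by lra.
have {}ul' : geo_lim B u l by exists (2 * (2 * (d * K))) => //; lra.
have llim : geo_lim B (fun n => idem_defect (u n)) (l * l - l).
  by apply: geo_limB => //; apply: geo_limM.
have ll : l * l = l.
  apply/eqP; rewrite -subr_eq0; apply/eqP; apply: geo_lim_uniq llim _.
  by apply: (@geo_lim_bound0 _ _ _ _ _ d) => // n; have [] := ub n.
have uh n : adj S (u n) = u n.
  elim: n => //= n IH; rewrite /idem_step !(adjB, adjD, adjM) -/(u n) IH.
  by rewrite !mulrA.
have lh : adj S l = l.
  apply: geo_lim_uniq (geo_lim_adj ul') _.
  by case: ul' => c c0 H; exists c => // n; rewrite uh.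
have ly y : x * y = 0 -> l * y = 0.
  move=> xy; apply: geo_lim_uniq (geo_limM ul' (geo_lim_cst B y)) _.
  apply: (@geo_lim_bound0 _ _ _ _ _ 0) => // n.
  suff -> : u n * y = 0 by rewrite nrm0 mul0r.
  elim: n => //= n IH; rewrite /idem_step mulrBl !mulrDl -/(u n) -!mulrA IH.
  by rewrite !mulr0 !addr0 subrr.
have [s [e sd]] := spectral FA Fx xh.
have uF n : F (u n).
  elim: n => //= n IH; rewrite /idem_step -/(u n).
  by apply: (asB FA); do ?[apply: (asD FA) | apply: (asM FA)].
have ue n a : a \in s -> u n * e a = rs (iter n idem_step a) * e a.
  move=> as_; have ea := sd_eig sd as_.
  elim: n => //= n IH; rewrite /idem_step -/(u n) mulrBl !mulrDl -!mulrA.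
  set c := iter n _ a in IH *.
  have uc z : u n * (rs z * e a) = rs (z * c) * e a.
    by rewrite mulrA -scalC -mulrA IH mulrA -rmorphM -rmorphM.
  rewrite !IH !uc -!mulrDl -mulrBl; congr (_ * _).
  by rewrite !(mulrDl, rmorphB, rmorphD) -!mulrA.
have eu n a : a \in s -> e a * u n = u n * e a.
  move=> as_; apply: (sd_comm sd) => //.
  elim: n => //= n IH; rewrite /idem_step -/(u n) mulrBr mulrBl !mulrDr !mulrDl.
  have cu y z : x * y = y * x -> x * z = z * x -> x * (y * z) = (y * z) * x.
    by move=> xy xz; rewrite mulrA xy -mulrA xz mulrA.
  by rewrite !cu.
have le a : a \in s -> e a * l = l * e a.
  move=> as_; apply: geo_lim_uniq (geo_limM (geo_lim_cst B (e a)) ul') _.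
  have [c c0 H] := geo_limM ul' (geo_lim_cst B (e a)).
  by exists c => // n; rewrite eu.
have lea a : a \in s -> l * e a = 0 \/ l * e a = e a.
  move=> as_; have ee := sd_idem sd as_; set y := l * e a.
  have yy : y * y = y by rewrite /y mulrA -(mulrA l) le // mulrA ll -mulrA ee.
  have [e0|e0] := eqVneq (e a) 0; first by left; rewrite /y e0 mulr0.
  have Ne : 0 < N (e a).
    rewrite lt_neqAle nrm_ge0 andbT eq_sym; apply: contra_neq e0.
    exact: nrm_eq0.
  (* The threshold 1 is the one of [small_idem0]. The term [4 d K] bounds the distance from the
     [n]-th iterate to [l], and [2 d] that from the iterated eigenvalue [c] to 0 or 1: one of [c],
     [1 - c] has absolute value at least [1/2], and their product is small. *)
  have [n Hn] := @half_pow_small R ((4 * (d * K) + 2 * d) * N (e a)) 1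
    ltac:(rewrite mulr_ge0 ?(ltW Ne) //; lra) ltr01.
  pose c := iter n idem_step a.
  have uy : N (rs c * e a - y) <= 4 * (d * K) * half_pow n * N (e a).
    rewrite -ue // /y -mulrBl; apply: nrmM_le => //.
    by have := ul n; rewrite mulrA -[2 * 2]/(2 * 2 : R); lra.
  have cc : `|idem_defect c| <= d * half_pow n.
    have [H _] := ub n; rewrite -/(u n) -/d in H; apply: le_trans H.
    rewrite -(ler_pM2r Ne) -nrmZ.
    have -> : rs (idem_defect c) * e a = idem_defect (u n) * e a.
      rewrite /idem_defect mulrBl -mulrA !ue // mulrA -scalC -mulrA ue // mulrA.
      by rewrite -rmorphM -rmorphM /= -mulrBl -!rmorphB.
    exact: nrmM.
  have c01 : `|c| <= 2 * (d * half_pow n) \/ `|1 - c| <= 2 * (d * half_pow n).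
    have cE : `|idem_defect c| = `|c| * `|1 - c|.
      by rewrite -normrM -normrN /idem_defect; congr `|_|; ring.
    rewrite cE in cc; have := ler_normD c (1 - c); rewrite addrC subrK normr1.
    have := normr_ge0 c; have := normr_ge0 (1 - c).
    set A := `|c| in cc *; set D := `|1 - c| in cc *; move=> A0 D0 AD.
    have [A2|A2] := lerP A (1 / 2); [left|right]; nra.
  have Ne0 := ltW Ne.
  case: c01 => c01; [left | right].
    apply: small_idem0 => //; rewrite -[y]subr0.
    apply: le_lt_trans (nrm_tri B (rs c * e a) _ _) _.
    by rewrite subr0 nrmZ nrm_sym; nra.
  apply/eqP; rewrite eq_sym -subr_eq0; apply/eqP; apply: small_idem0.
    by rewrite mulrBr !mulrBl ee yy /y -(mulrA l) ee mulrA le // -mulrA ee subrr subr0.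
  apply: le_lt_trans (nrm_tri B (rs c * e a) _ _) _.
  have -> : e a - rs c * e a = rs (1 - c) * e a.
    by rewrite rmorphB rmorphB !rmorph1 mulrBl mul1r.
  by rewrite nrmZ; nra.
exists l; split=> //.
- rewrite -[l]mulr1 -(sd_sum sd) mulr_sumr; apply: (as_sum FA) => a as_.
  have [->|->] := lea a as_; [exact: (as0 FA)|exact: (sd_in sd)].
- have := ul 0; rewrite /half_pow expr0 invr1 mulr1 /u /= -/K; lra.
Qed.

End NearProj.

(** * Cancellation and finiteness *)

Section Cancellation.
Context {R : realType} {T : nzRingType} {S : star_alg R T} (B : banach_norm S).
Local Notation rs a := (scal S a%:C%C).
Local Notation N := (nrm B).
Implicit Types c p q r v w x y : T.

Lemma left_cancel1 w : N (1 - w) < 1 -> forall y, w * y = 0 -> y = 0.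
Proof.
move=> w1 y wy; apply: (nrm_eq0 (b := B)); apply/eqP.
have := nrmM B (1 - w) y; rewrite mulrBl mul1r wy subr0.
by have := nrm_ge0 B y; rewrite le_eqVlt => /orP[/eqP <- //|]; nra.
Qed.

Lemma star_equivD p q p' q' u v : sa_proj S p -> sa_proj S q ->
  sa_proj S p' -> sa_proj S q' -> p * q = 0 -> p' * q' = 0 ->
  p' * u * p = u -> q' * v * q = v ->
  star_equiv S p p' u -> star_equiv S q q' v -> star_equiv S (p + q) (p' + q') (u + v).
Proof.
move=> [_ ph] [_ qh] [_ ph'] [_ qh'] pq pq' uE vE [up up'] [vq vq'].
have qp' : q' * p' = 0 by rewrite -ph' -qh' -adjM pq' adj0.
have qp : q * p = 0 by rewrite -ph -qh -adjM pq adj0.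
rewrite /star_equiv adjD !mulrDl !mulrDr up up' vq vq'.
have -> : adj S u * v = 0.
  rewrite -uE -vE !adjM ph' -!mulrA [p' * (q' * _)]mulrA pq'.
  by rewrite !(mul0r, mulr0).
have -> : adj S v * u = 0.
  rewrite -uE -vE !adjM qh' -!mulrA [q' * (p' * _)]mulrA qp'.
  by rewrite !(mul0r, mulr0).
have -> : u * adj S v = 0.
  rewrite -uE -vE !adjM qh -!mulrA [p * (q * _)]mulrA pq.
  by rewrite !(mul0r, mulr0).
have -> : v * adj S u = 0.
  rewrite -uE -vE !adjM ph -!mulrA [q * (p * _)]mulrA qp.
  by rewrite !(mul0r, mulr0).
by rewrite !addr0 !add0r.
Qed.

Lemma sa_projD p q : sa_proj S p -> sa_proj S q -> p * q = 0 -> sa_proj S (p + q).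
Proof.
move=> [pp ph] [qq qh] pq; have qp : q * p = 0 by rewrite -ph -qh -adjM pq adj0.
by split; rewrite ?adjD ?ph ?qh // mulrDl !mulrDr pp qq pq qp addr0 add0r.
Qed.

Context (F : nat -> set T).
Hypothesis FA : forall k, algebraic_sub S (F k).
Hypothesis Fpos : forall k x y z, F k x -> F k y -> F k z ->
  adj S x * x + adj S y * y + adj S z * z = 0 -> x = 0.
Hypothesis F_incr : forall k x, F k x -> F k.+1 x.
Hypothesis F_dense : forall x (e : R), 0 < e -> exists k y, F k y /\ N (x - y) < e.

Lemma F_le k k' x : (k <= k')%N -> F k x -> F k' x.
Proof.
by move=> /subnK <-; elim: (k' - k)%N => //= n IH /IH; exact: F_incr.
Qed.

Lemma F_dense_ge k x (e : R) : 0 < e ->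
  exists k' y, [/\ (k <= k')%N, F k' y & N (x - y) < e].
Proof.
move=> /(F_dense x)[k' [y [Fy xy]]]; exists (maxn k k'), y.
by split; rewrite ?leq_maxl //; apply: F_le Fy; exact: leq_maxr.
Qed.

(** The corner projection [c], common to all [F k], is carried along so that approximants of
    projections in orthogonal corners are exactly orthogonal. An approximant [y] of [p] is
    symmetrised, compressed to the corner, and then corrected by [near_proj]. *)
Lemma proj_approx c p : (forall k, F k c) -> sa_proj S c -> sa_proj S p ->
  c * p = p ->
  exists k p' u, [/\ F k p', sa_proj S p', c * p' = p' & star_equiv S p p' u].
Proof.
move=> Fc [cc ch] [pp ph] cp.
have pc : p * c = p by rewrite -{1}ph -ch -adjM cp ph.
have np := nrm_ge0 B p; have nc := nrm_ge0 B c.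
set P := N p + 1; set C := N c * N c.
have C0 : 0 <= C by exact: mulr_ge0.
have P0 : 1 <= P by rewrite /P; lra.
(* The three bounds serve [N (p - x) < 1], the hypothesis [1/16] of [near_proj], and the hypothesis
   [1/2] of [close_proj_equiv]. The last combines [N (p - x)] with [4 * (1 + 2 * P)] times the
   defect bound. *)
have [t t0 [t1 t2 t3]] : exists2 t, 0 < t &
    [/\ t * C < 1, t * (C * (2 * P)) < 1 / 16 &
      t * (C * (1 + 8 * P * (1 + 2 * P)) * (P * P)) < 1 / 2].
  apply: small_factor3; lra || (do !apply: mulr_ge0 => //; nra).
have [k [y [Fy py]]] := F_dense p t0.
pose y1 := rs 2^-1 * (y + adj S y); pose x := c * y1 * c.
have Fx : F k x.
  apply: (asM (FA k)) => //; apply: (asM (FA k)) => //.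
  apply: (asM (FA k)); first exact: (asZ (FA k)).
  by apply: (asD (FA k)) => //; apply: (asadj (FA k)).
have y1h : adj S y1 = y1 by rewrite /y1 adjM adjD adjK adjZr -scalC [adj S y + y]addrC.
have xh : adj S x = x by rewrite /x adjM adjM ch y1h mulrA.
have py1 : N (p - y1) <= t.
  have -> : p - y1 = rs 2^-1 * ((p - y) + adj S (p - y)).
    rewrite adjB ph /y1 addrACA -opprD mulrBr; congr (_ - _).
    rewrite -[p in p + p]mul1r -mulrDl mulrA -(rmorph1 (scal S)) -rmorphD -rmorphM.
    rewrite (_ : (2^-1)%:C%C * (1 + 1) = 1) ?rmorph1 ?mul1r //.
    rewrite -(rmorph1 (real_complex R)) -rmorphD -rmorphM /=; congr (_ %:C)%C.
    by field.
  rewrite nrm_half; have := nrmD B (p - y) (adj S (p - y)); rewrite nrm_adj; lra.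
have px : N (p - x) <= t * C.
  have -> : p - x = c * (p - y1) * c by rewrite mulrBr mulrBl cp pc.
  rewrite /C mulrCA mulrA; apply: nrmM_le => //; exact: nrmM_le.
have nx : N x <= P.
  have := nrm_tri B p x 0; rewrite !subr0 nrm_sym /P; lra.
have nx0 := nrm_ge0 B x.
have dx : N (idem_defect x) <= t * (C * (2 * P)).
  have -> : idem_defect x = (x - p) * x + p * (x - p) - (x - p).
    by rewrite /idem_defect mulrBl mulrBr pp subrKA opprB addrA subrK.
  apply: (le_trans (nrmB B _ _)); rewrite nrm_sym in px.
  have := nrmD_le (nrmM_le px nx) (nrmM_le (lexx (N p)) px).
  by have : N p = P - 1 by [rewrite /P; lra]; nra.
have [|l [Fl lP xl ly]] := near_proj (B := B) (FA k) Fx xh; first by lra.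
(* [x] kills [1 - c], and [near_proj] guarantees that [l] kills whatever [x] does. *)
have lc : l * c = l.
  apply/eqP; rewrite eq_sym -subr_eq0 -{1}[l]mulr1 -mulrBr; apply/eqP; apply: ly.
  by rewrite /x -mulrA mulrBr mulr1 cc subrr mulr0.
have cl : c * l = l by case: (lP) => _ lh; rewrite -{1}lh -ch -adjM lc lh.
have pl : N (p - l) <= t * (C * (1 + 8 * P * (1 + 2 * P))).
  apply: (le_trans (nrm_tri B x _ _)).
  have : N (x - l) <= 4 * (1 + 2 * P) * (t * (C * (2 * P))).
    apply: (le_trans xl); apply: ler_pM => //; last by lra.
      by rewrite mulr_ge0 //; lra.
    exact: nrm_ge0.
  by lra.
have pl1 : N (p - l) <= 1 by nra.
have nl : N l <= P by have := nrm_tri B p l 0; rewrite !subr0 nrm_sym /P; lra.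
have PPl : P * P * N (p - l) <= 1 / 2.
  have PP0 : 0 <= P * P by nra.
  by have := ler_wpM2r PP0 pl; lra.
have [||u uP] := close_proj_equiv (B := B) (conj pp ph : sa_proj S p) lP.
- rewrite mulrAC; apply: (@le_trans _ _ (P * P * N (p - l))).
    by rewrite ler_wpM2r ?nrm_ge0 // ler_pM //; rewrite /P; lra.
  exact: PPl.
- rewrite mulrAC; apply: (@le_trans _ _ (P * P * N (p - l))).
    by rewrite ler_wpM2r ?nrm_ge0 // ler_pM //; exact: nrm_ge0.
  exact: PPl.
by exists k, l, u.
Qed.

(** [adj S w * w] is close to [P], so adding [1 - P] gives an element close to 1. It is thus
    injective, and an injective element of an algebraic subalgebra is invertible inside it. *)
Lemma near_unitary_inv k v w P : F k w -> F k P -> sa_proj S P ->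
  adj S v * v = P -> N (adj S v * v - adj S w * w) < 1 -> w * P = w ->
  exists2 y, F k y & [/\ (adj S w * w + (1 - P)) * y = 1,
     y * (adj S w * w + (1 - P)) = 1 & P * y = y * P].
Proof.
move=> Fw FP [PP Ph] vP vw wP; set h := _ + (1 - P).
have Fh : F k h.
  apply: (asD (FA k)); first by apply: (asM (FA k)) => //; apply: (asadj (FA k)).
  by apply: (asB (FA k)) => //; exact: (as1 (FA k)).
have hP : h * P = adj S w * w.
  by rewrite /h mulrDl -mulrA wP mulrBl mul1r PP subrr addr0.
have Paw : P * adj S w = adj S w by rewrite -{1}Ph -adjM wP.
have Ph' : P * h = adj S w * w.
  by rewrite /h mulrDr mulrA Paw mulrBr mulr1 PP subrr addr0.
have [|y [Fy hy yh]] := alg_inv (FA k) Fh.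
  move=> y _; apply: left_cancel1; rewrite (_ : 1 - h = adj S v * v - adj S w * w) //.
  by rewrite vP /h opprD opprB addrA [LHS]addrC addrA subrK.
exists y => //; split=> //.
by rewrite -[LHS]mul1r -yh -mulrA [h * _]mulrA hP -Ph' -!mulrA hy mulr1.
Qed.

Lemma cancel_approx k p q r v : F k p -> F k q -> F k r ->
  sa_proj S p -> sa_proj S q -> sa_proj S r -> p * r = 0 -> q * r = 0 ->
  star_equiv S (p + r) (q + r) v -> exists u, star_equiv S p q u.
Proof.
move=> Fp Fq Fr pP qP rP pr qr vE0.
have PP := sa_projD pP rP pr; have QP := sa_projD qP rP qr.
set P := p + r in vE0 PP *; set Q := q + r in vE0 QP *.
have := star_equiv_corner PP QP vE0; set v1 := Q * v * P => -[vP vQ].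
have [pp ph] := pP; have [qq qh] := qP; have [rr rh] := rP.
have [PPP Ph] := PP; have [QQ Qh] := QP.
have rp : r * p = 0 by rewrite -ph -rh -adjM pr adj0.
have rq : r * q = 0 by rewrite -qh -rh -adjM qr adj0.
have rPr : r * P = r by rewrite /P mulrDr rp rr add0r.
have Qr : Q * r = r by rewrite /Q mulrDl qr rr add0r.
have rQ : r * Q = r by rewrite /Q mulrDr rq rr add0r.
have Pr : P * r = r by rewrite /P mulrDl pr rr add0r.
have Qv1 : Q * v1 = v1 by rewrite /v1 !mulrA QQ.
have v1P : v1 * P = v1 by rewrite /v1 -!mulrA PPP.
have n1 := nrm_ge0 B v1; have nr := nrm_ge0 B r.
(* If [v2] is within [tau] of [v1], then [v1^* v1] and [v2^* v2] differ by at most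
   [tau * (2 * N v1 + tau)], hence by less than 1. *)
have [tau tau0 [tau1 tau2 _]] : exists2 t, 0 < t &
    [/\ t * (1 : R) < 1, t * (2 * N v1 + 1) < 1 & t * 0 < 1 :> R].
  by apply: small_factor3; lra.
have [t t0 [t1 t2 _]] : exists2 t, 0 < t &
    [/\ t * (N Q * N P) < tau / 2, t * N r < tau / 2 & t * 0 < 1 :> R].
  by apply: small_factor3; rewrite ?mulr_ge0 ?nrm_ge0 //; lra.
have [k' [y [kk' Fy vy]]] := F_dense_ge k v1 t0.
have Fp' := F_le kk' Fp; have Fq' := F_le kk' Fq; have Fr' := F_le kk' Fr.
have A := FA k'.
have FP : F k' P by apply: (asD A).
have FQ : F k' Q by apply: (asD A).
pose d0 := r * (Q * y * P) * r.
have Fd0 : F k' d0 by do !apply: (asM A).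
have [dl /andP[dl0 dlt] [yi [Fyi yi1 yi2]]] := alg_perturb A Fd0 t0.
(* Adding a small multiple of [r] changes the [r]-corner of the compressed approximant from [d0] to
   [r * (d0 + dl)], invertible in the corner by the choice of [dl]. *)
have [v2 v2E] : exists x, x = Q * y * P + rs dl * r by eexists.
have Fv2 : F k' v2.
  rewrite v2E; apply: (asD A); first by do !apply: (asM A).
  by apply: (asM A) => //; apply: (asZ A).
have Qv2 : Q * v2 = v2 by rewrite v2E mulrDr !mulrA QQ -scalC -(mulrA (rs dl)) Qr.
have v2P : v2 * P = v2 by rewrite v2E mulrDl -!mulrA PPP rPr.
have v12 : N (v1 - v2) < tau.
  have -> : v1 - v2 = Q * (v1 - y) * P - rs dl * r.
    by rewrite v2E opprD addrA mulrBr mulrBl -/v1 Qv1 v1P.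
  apply: le_lt_trans (nrmB B _ _) _; rewrite nrmZ ger0_norm ?(ltW dl0) //.
  have : N (Q * (v1 - y) * P) <= N Q * t * N P.
    by apply: nrmM_le => //; apply: nrmM_le => //; apply: ltW.
  nra.
have n2 : N v2 <= N v1 + tau.
  by have := nrm_tri B v1 v2 0; rewrite !subr0 nrm_sym; lra.
have n12 := nrm_ge0 B (v1 - v2).
have E1 : N (adj S v1 * v1 - adj S v2 * v2) < 1.
  apply: le_lt_trans (nrm_prod_diff B _ _ _ _) _; rewrite -adjB !nrm_adj.
  by have := nrm_ge0 B v2; nra.
have E2 : N (v1 * adj S v1 - v2 * adj S v2) < 1.
  apply: le_lt_trans (nrm_prod_diff B _ _ _ _) _; rewrite -adjB !nrm_adj.
  by have := nrm_ge0 B v2; nra.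
have [h1 Fh1 [yh1 hy1 Ph1]] := near_unitary_inv Fv2 FP PP vP E1 v2P.
have Fav2 : F k' (adj S v2) by apply: (asadj A).
have aQ : adj S v2 * Q = adj S v2 by rewrite -Qh -adjM Qv2.
have Pa : P * adj S v2 = adj S v2 by rewrite -Ph -adjM v2P.
have [|||h2 Fh2 [yh2 hy2 Qh2]] := @near_unitary_inv k' (adj S v1) (adj S v2) Q Fav2 FQ QP.
- by rewrite adjK.
- by rewrite !adjK.
- exact: aQ.
rewrite adjK in yh2 hy2.
(* The inverse of [v2] between the corners [P] and [Q]: [h1] inverts [v2^* v2] and [h2] inverts
   [v2 v2^*]. Associativity gives [v2 * h1 = h2 * v2], so [w] inverts on both sides. *)
pose w := h1 * adj S v2.
have wv : w * v2 = P.
  have -> : w * v2 = h1 * (adj S v2 * v2) by rewrite /w mulrA.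
  have -> : adj S v2 * v2 = (adj S v2 * v2 + (1 - P)) * P.
    by rewrite mulrDl -mulrA v2P mulrBl mul1r PPP subrr addr0.
  by rewrite mulrA hy1 mul1r.
have vw : v2 * w = Q.
  have e1 : v2 * h1 = h2 * v2.
    have e2 : v2 * (adj S v2 * v2 + (1 - P)) = (v2 * adj S v2 + (1 - Q)) * v2.
      by rewrite mulrDr mulrDl mulrBr mulrBl mul1r mulr1 v2P Qv2 !subrr mulrA.
    by rewrite -[LHS]mul1r -hy2 -mulrA [X in h2 * X]mulrA -e2 -mulrA yh1 mulr1.
  have -> : v2 * w = h2 * (v2 * adj S v2) by rewrite /w mulrA e1 mulrA.
  have -> : v2 * adj S v2 = (v2 * adj S v2 + (1 - Q)) * Q.
    by rewrite mulrDl -mulrA aQ mulrBl mul1r QQ subrr addr0.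
  by rewrite mulrA hy2 mul1r.
have d0r : d0 * r = d0 by rewrite /d0 -mulrA rr.
have rd0 : r * d0 = d0 by rewrite /d0 !mulrA rr.
have xr : (d0 + rs dl) * r = r * (d0 + rs dl) by rewrite mulrDl mulrDr d0r rd0 scalC.
have yr : yi * r = r * yi.
  by rewrite -[LHS]mulr1 -yi1 mulrA -[yi * r * _]mulrA -xr !mulrA yi2 mul1r.
have rvr : r * v2 * r = r * (d0 + rs dl).
  have -> : r * (d0 + rs dl) = d0 + r * rs dl by rewrite mulrDr rd0.
  rewrite v2E mulrDr mulrDl; congr (_ + _).
  by rewrite scalC mulrA rr -scalC -mulrA rr scalC.
pose d' := r * yi.
have rd' : r * d' = d' by rewrite /d' mulrA rr.
have d'r : d' * r = d' by rewrite /d' -mulrA yr mulrA rr.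
have dd1 : (r * v2 * r) * d' = r.
  by rewrite rvr -xr /d' -mulrA [r * (r * _)]mulrA rr -yr mulrA yi1 mul1r.
have dd2 : d' * (r * v2 * r) = r.
  by rewrite rvr /d' -yr -mulrA [r * (r * _)]mulrA rr -xr mulrA yi2 mul1r.
have Pw : P * w = w by rewrite /w mulrA Ph1 -mulrA Pa.
have wQ : w * Q = w by rewrite /w -mulrA aQ.
have /= [ts st] := schur_complement pp qq rr pr rp qr rq wv vw Pw wQ Qv2 v2P rd' d'r dd1 dd2.
have Fd' : F k' d' by apply: (asM A).
have Fs : F k' (q * (v2 - v2 * d' * v2) * p).
  by do ![apply: (asM A) | apply: (asB A)].
have [||| u _ uE] := polar A (@Fpos k') Fp' pP Fs _ _ _ ts st qh.
- by rewrite !mulrA qq.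
- by rewrite -!mulrA pp.
- by rewrite !mulrA pp.
by exists u.
Qed.

Theorem cancellation cp cq cr p q r v :
  (forall k, F k cp) -> (forall k, F k cq) -> (forall k, F k cr) ->
  sa_proj S cp -> sa_proj S cq -> sa_proj S cr -> cp * cr = 0 -> cq * cr = 0 ->
  sa_proj S p -> sa_proj S q -> sa_proj S r ->
  cp * p = p -> cq * q = q -> cr * r = r ->
  star_equiv S (p + r) (q + r) v -> exists u, star_equiv S p q u.
Proof.
move=> Fcp Fcq Fcr cpP cqP crP cpr cqr pP qP rP cpp cqq crr vE.
have [kp [p' [up [Fp pP' cpp' upE0]]]] := proj_approx Fcp cpP pP cpp.
have [kq [q' [uq [Fq qP' cqq' uqE0]]]] := proj_approx Fcq cqP qP cqq.
have [kr [r' [ur [Fr rP' crr' urE0]]]] := proj_approx Fcr crP rP crr.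
have orth c d x y : sa_proj S c -> sa_proj S x -> c * d = 0 -> c * x = x ->
    d * y = y -> x * y = 0.
  move=> [_ ch] [_ xh] cd cx <-; rewrite -xh -cx adjM ch -mulrA.
  by rewrite [c * (d * _)]mulrA cd mul0r mulr0.
have pr := orth _ _ _ _ cpP pP cpr cpp crr.
have qr := orth _ _ _ _ cqP qP cqr cqq crr.
have pr' := orth _ _ _ _ cpP pP' cpr cpp' crr'.
have qr' := orth _ _ _ _ cqP qP' cqr cqq' crr'.
have corner x x' u : sa_proj S x -> sa_proj S x' ->
    x' * (x' * u * x) * x = x' * u * x.
  by move=> [xx _] [xx' _]; rewrite -!mulrA xx !mulrA xx'.
have upE := star_equiv_corner pP pP' upE0.
have uqE := star_equiv_corner qP qP' uqE0.
have urE := star_equiv_corner rP rP' urE0.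
have PE := star_equivD pP rP pP' rP' pr pr' (corner _ _ _ pP pP')
  (corner _ _ _ rP rP') upE urE.
have QE := star_equivD qP rP qP' rP' qr qr' (corner _ _ _ qP qP')
  (corner _ _ _ rP rP') uqE urE.
have PP := sa_projD pP rP pr; have QP := sa_projD qP rP qr.
have PP' := sa_projD pP' rP' pr'; have QP' := sa_projD qP' rP' qr'.
have vE' := star_equiv_trans PP' PP QP' (star_equiv_sym PE)
  (star_equiv_trans PP QP QP' vE QE).
pose k := maxn kp (maxn kq kr).
have [|||u uE] := @cancel_approx k p' q' r' _ _ _ _ pP' qP' rP' pr' qr' vE'.
- by apply: F_le Fp; rewrite leq_maxl.
- by apply: F_le Fq; rewrite /k leq_max leq_maxl orbT.
- by apply: F_le Fr; rewrite /k !leq_max leqnn !orbT.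
exists (adj S (q' * uq * q) * (u * (p' * up * p))).
apply: (star_equiv_trans pP qP' qP _ (star_equiv_sym uqE)).
exact: (star_equiv_trans pP pP' qP' upE uE).
Qed.

(* An isometry v is a limit of algebraic elements w, which are injective and
   hence invertible; as 1 - v v^* kills v it is small compared to itself. *)
Theorem isometry_unitary v : adj S v * v = 1 -> (forall y, N (v * y) = N y) ->
  v * adj S v = 1.
Proof.
move=> v1 viso.
have [e e0 [e1 e2 _]] : exists2 t, 0 < t &
    [/\ t * (2 : R) < 1, t * (2 * N 1) < 1 & t * 0 < 1 :> R].
  by apply: small_factor3; have := nrm_ge0 B 1; lra.
have [k [w [Fw vw]]] := F_dense v e0.
have wlow y : N y <= N (w * y) + e * N y.
  rewrite -{1}viso; have -> : v * y = w * y + (v - w) * y by rewrite mulrBl addrC subrK.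
  apply: nrmD_le => //; apply: nrmM_le => //; exact: ltW.
have [|y [Fy wy _]] := alg_inv (FA k) Fw.
  move=> y _ wy; apply: (nrm_eq0 (b := B)); apply/eqP.
  have := wlow y; rewrite wy nrm0; have := nrm_ge0 B y; rewrite le_eqVlt.
  by case/orP => [/eqP <- //|y0]; nra.
have ny : N y <= 2 * N 1 by have := wlow y; rewrite wy; have := nrm_ge0 B y; nra.
set d := 1 - v * adj S v.
have dv : d * v = 0 by rewrite mulrBl mul1r -mulrA v1 mulr1 subrr.
have dE : d = d * ((w - v) * y).
  by rewrite mulrA mulrBr dv subr0 -mulrA wy mulr1.
apply/esym/eqP; rewrite -subr_eq0 -/d; apply/eqP.
apply: (nrm_eq0 (b := B)); apply/eqP.
have : N d <= N d * (e * (2 * N 1)).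
  rewrite {1}dE; apply: nrmM_le => //; apply: nrmM_le => //.
  by rewrite nrm_sym ltW.
by have := nrm_ge0 B d; rewrite le_eqVlt => /orP[/eqP <- //|d0]; nra.
Qed.

End Cancellation.

(** * Positivity in C*-algebras *)

Section CStarBasics.
Context {R : realType} (A : cstarAlgType R).
Implicit Types x y : A.

Lemma cstar_scalC (c : R[i]) x : in_alg A c * x = x * in_alg A c.
Proof. by rewrite mulr_algl mulr_algr. Qed.

Lemma cstar_adjZ (c : R[i]) : star (in_alg A c) = in_alg A (conjc c).
Proof. by rewrite /= starZ star1. Qed.

Definition cstar_alg : star_alg R A :=
  @StarAlg R A (in_alg A) cstar_scalC star starD starM starK cstar_adjZ.

Lemma normcR (a : R) : complex.Re `|a%:C%C| = `|a|.
Proof. by rewrite normc_def /= expr0n /= addr0 sqrtr_sqr. Qed.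

Lemma cnormZr (a : R) x : cnorm (scal cstar_alg a%:C%C * x) = `|a| * cnorm x.
Proof. by rewrite /= mulr_algl cnormZ normcR. Qed.

Lemma star_rs (a : R) : star (scal cstar_alg a%:C%C) = scal cstar_alg a%:C%C.
Proof. exact: (adjZr cstar_alg). Qed.

Lemma cnorm_ge0 x : 0 <= cnorm x.
Proof.
have n0 : cnorm (0 : A) = 0 by rewrite -(mulr0 (scal cstar_alg 0%:C%C)) cnormZr normr0 mul0r.
have nN : cnorm (- x) = cnorm x.
  have -> : - x = scal cstar_alg (-1)%:C%C * x.
    by rewrite rmorphN rmorph1 rmorphN rmorph1 mulN1r.
  by rewrite cnormZr normrN normr1 mul1r.
by have := cnormD_le x (- x); rewrite subrr n0 nN; lra.
Qed.

Lemma cnorm_star x : cnorm (star x) = cnorm x.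
Proof.
have le y : cnorm y <= cnorm (star y).
  have := cnormM_le (star y) y; rewrite cnorm_starM expr2.
  have := cnorm_ge0 y; rewrite le_eqVlt => /orP[/eqP <- _|y0].
    exact: cnorm_ge0.
  by rewrite ler_pM2r.
by apply/eqP; rewrite eq_le le -{2}[x]starK le.
Qed.

Lemma cnorm_cauchy (u : nat -> A) :
  (forall e : R, 0 < e -> exists N, forall m n, (N <= m)%N -> (N <= n)%N ->
      cnorm (u m - u n) < e) ->
  exists l, forall e : R, 0 < e -> exists N, forall n, (N <= n)%N ->
      cnorm (u n - l) < e.
Proof.
move=> /cnorm_complete[l ul]; exists l => e e0.
have /cvgrPdist_lt /(_ e e0) [N _ NP] := ul.
exists N => n /NP; rewrite sub0r normrN; apply: le_lt_trans.
exact: ler_norm.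
Qed.

Definition cstar_norm : banach_norm cstar_alg :=
  @BanachNorm R A cstar_alg cnorm (@cnorm_eq0 R A) cnormD_le cnormM_le cnormZr
    cnorm_star cnorm_cauchy.

Lemma cnorm0 : cnorm (0 : A) = 0.
Proof. exact: (nrm0 cstar_norm). Qed.

Lemma star_mul_eq0 x : star x * x = 0 -> x = 0.
Proof.
move=> xx; apply: cnorm_eq0; apply/eqP.
by rewrite -sqrf_eq0 -cnorm_starM xx cnorm0.
Qed.

Lemma cnorm_proj_le1 x : star x = x -> x * x = x -> cnorm x <= 1.
Proof.
move=> xh xx; have := cnorm_starM x; rewrite xh xx expr2.
by have := cnorm_ge0 x; rewrite le_eqVlt => /orP[/eqP <-|]; nra.
Qed.

End CStarBasics.

Section FiniteDim.
Context {R : realType} {T : nzRingType} (S : star_alg R T).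

(** The [#|I|.+1] lowest powers of [x] lie in the span of [#|I|] elements. A nonzero vector of the
    left kernel of their coefficient matrix is the list of coefficients of [p]. *)
Lemma algebraic_of_span (I : finType) (b : I -> T) x :
  (forall i, exists c : I -> R[i], x ^+ i = \sum_j scal S (c j) * b j) ->
  exists2 p, p != 0 & pev S x p = 0.
Proof.
move=> /choice[c cE].
pose M := \matrix_(i < #|I|.+1, j < #|I|) c i (enum_val j).
have : kermx M != 0.
  rewrite -mxrank_eq0 mxrank_ker -lt0n subn_gt0.
  exact: leq_ltn_trans (rank_leq_col M) _.
case/rowV0Pn => v /sub_kermxP vM v0.
exists (\poly_(i < #|I|.+1) v 0 (inord i)).
  apply: contraNneq v0 => p0; apply/eqP/rowP => i; rewrite mxE.
  have := congr1 (fun p : {poly _} => p`_i) p0.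
  by rewrite coef_poly ltn_ord inord_val coef0.
rewrite poly_def (big_morph (pev S x) (pevD S x) (pev0 S x)).
transitivity (\sum_(i < #|I|.+1) \sum_j scal S (v 0 i * c i j) * b j).
  apply: eq_bigr => i _; rewrite -mul_polyC inord_val.
  rewrite -[LHS]/(pev S x _) pevM pevC.
  have -> : pev S x 'X^i = x ^+ i.
    by rewrite -{2}(pevX S x) -[LHS]/(horner_morph (pev_comm S x) _) rmorphXn.
  by rewrite cE mulr_sumr; apply: eq_bigr => j _; rewrite mulrA -rmorphM.
rewrite exchange_big /= big1 // => j _.
rewrite -mulr_suml -rmorph_sum /=.
have := congr1 (fun N : 'rV_ _ => N 0 (enum_rank j)) vM.
rewrite !mxE => H; rewrite (_ : \sum_i _ = 0) ?rmorph0 ?mul0r // -[RHS]H.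
by apply: eq_bigr => i _; rewrite !mxE enum_rankK.
Qed.

End FiniteDim.

Lemma bernoulli (R : realFieldType) (x : R) m : 0 <= x -> 1 + x *+ m <= (1 + x) ^+ m.
Proof.
move=> x0; elim: m => [|m IH]; first by rewrite mulr0n addr0 expr0.
rewrite exprS mulrS; apply: (@le_trans _ _ ((1 + x) * (1 + x *+ m))).
  have : 0 <= x *+ m by rewrite mulrn_wge0.
  by set z := x *+ m => z0; have := mulr_ge0 x0 z0; lra.
by rewrite ler_wpM2l // addr_ge0.
Qed.

(** The constant [K] is lost in the limit of [2^k]-th roots; Bernoulli's inequality replaces the
    roots. *)
Lemma pow2_bound (R : realType) (a t K : R) : 0 <= a -> 0 <= t ->
  (forall k, a ^+ (2 ^ k) <= K * t ^+ (2 ^ k)) -> a <= t.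
Proof.
move=> a0 t0 H; rewrite leNgt; apply/negP => ta.
move: t0; rewrite le_eqVlt => /orP[/eqP t0|t0].
  by have := H 0; rewrite expn0 !expr1 -t0 mulr0 leNgt t0 ta.
pose x := a / t - 1; have x0 : 0 < x by rewrite subr_gt0 ltr_pdivlMr // mul1r.
have HK k : x *+ k <= K.
  have k2 : (k <= 2 ^ k)%N by rewrite ltnW // ltn_expl.
  apply: (@le_trans _ _ (1 + x *+ (2 ^ k))).
    by rewrite -[X in X <= _]add0r lerD // ler_wpMn2l // ltW.
  apply: (le_trans (bernoulli _ (ltW x0))).
  by rewrite /x addrC subrK expr_div_n ler_pdivrMr ?exprn_gt0.
have K0 : 0 <= K by have := HK 0%N; rewrite mulr0n.
have := archi_boundP (divr_ge0 K0 (ltW x0)); set n := Num.bound _.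
by rewrite ltr_pdivrMr // mulr_natl ltNge HK.
Qed.

Section Positivity.
Context {R : realType} (A : cstarAlgType R).
Local Notation S := (cstar_alg A).
Local Notation rs a := (scal S a%:C%C).
Context (F : set A) (FA : algebraic_sub S F).
Implicit Types x y h e : A.

(** The triangle inequality only gives [size s * t]. Repeated squaring by the C*-identity, applied
    to the self-adjoint element, removes the factor [size s] through [pow2_bound]. *)
Lemma cnorm_fcalc h s (e : R -> A) (f : R -> R) (t : R) :
  spectral_dec S F h s e -> 0 <= t -> {in s, forall a, `|f a| <= t} ->
  cnorm (fcalc S s e f) <= t.
Proof.
move=> sd t0 ft.
have bound g u : {in s, forall a, `|g a| <= u} ->
    cnorm (fcalc S s e g) <= (size s)%:R * u.
  move=> gu; have -> : (size s)%:R * u = \sum_(a <- s) u.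
    by rewrite big_const_seq count_predT iter_addr_0 mulr_natl.
  rewrite /fcalc [X in _ <= X]big_seq big_seq.
  elim/big_rec2: _ => [|a y x as_ IH]; first by rewrite cnorm0.
  apply: (le_trans (cnormD_le _ _)); apply: lerD => //.
  rewrite cnormZr; apply: le_trans (gu a as_); rewrite -[X in _ <= X]mulr1.
  rewrite ler_wpM2l //; apply: cnorm_proj_le1; first exact: (sd_adj sd).
  exact: (sd_idem sd).
apply: (@pow2_bound _ _ _ (size s)%:R) => //; first exact: cnorm_ge0.
move=> k.
have -> : cnorm (fcalc S s e f) ^+ (2 ^ k) = cnorm (fcalc S s e (fun a => f a ^+ (2 ^ k))).
  elim: k => [|k IH].
    rewrite expn0 expr1; congr cnorm; apply: eq_fcalc => a _.
  rewrite expnSr exprM IH -cnorm_starM; congr cnorm.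
  rewrite -[star _]/(adj S _) (fcalc_adj sd) (fcalcM sd); apply: eq_fcalc => a _.
  by rewrite -expr2 -exprM -expnSr.
by apply: bound => a as_; rewrite normrX lerXn2r ?nnegrE ?ft.
Qed.

(** For self-adjoint [h] this characterises positivity by the norm. Sums of positive elements are
    then handled by the triangle inequality, without any spectral information on the sum. *)
Definition cpos h := exists t : R, cnorm (rs t - h) <= t.

Lemma cposD h h' : cpos h -> cpos h' -> cpos (h + h').
Proof.
move=> [t ht] [t' ht']; exists (t + t').
by rewrite !rmorphD opprD addrACA (le_trans (cnormD_le _ _)) // lerD.
Qed.

Lemma cpos0 : cpos 0.
Proof. by exists 0; rewrite subr0 !rmorph0 cnorm0. Qed.

Lemma cpos_sum I (r : seq I) (P : pred I) (f : I -> A) :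
  (forall i, P i -> cpos (f i)) -> cpos (\sum_(i <- r | P i) f i).
Proof. by move=> H; elim/big_ind: _ => //; [exact: cpos0 | exact: cposD]. Qed.

Lemma cpos_fcalc h s (e : R -> A) f : spectral_dec S F h s e ->
  {in s, forall a, 0 <= f a} -> cpos (fcalc S s e f).
Proof.
move=> sd f0; pose t := \sum_(a <- s) f a.
have ft a : a \in s -> f a <= t.
  move=> as_; rewrite /t (bigD1_seq a) ?(sd_uniq sd) //= lerDl.
  by rewrite big_seq_cond sumr_ge0 // => b /andP[/f0].
exists t; have -> : rs t - fcalc S s e f = fcalc S s e (fun a => t - f a).
  rewrite -[rs t]mulr1 -(sd_sum sd) mulr_sumr /fcalc -sumrB.
  by apply: eq_bigr => a _; rewrite !rmorphB mulrBl.
apply: (cnorm_fcalc sd); first by rewrite /t big_seq sumr_ge0.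
by move=> a as_; have := f0 _ as_; have := ft _ as_ => H1 H2; rewrite ger0_norm; lra.
Qed.

Lemma cpos_sqr h : F h -> star h = h -> cpos (h * h).
Proof.
move=> Fh hh; have [s [e sd]] := spectral FA Fh hh.
rewrite -(fcalc_id sd) (fcalcM sd); apply: (cpos_fcalc sd) => a _.
by rewrite -expr2 sqr_ge0.
Qed.

Lemma cpos_eig h e (a : R) : cpos h -> e != 0 -> h * e = rs a * e -> 0 <= a.
Proof.
move=> [t ht] e0 he.
have ne : 0 < cnorm e.
  by rewrite lt_neqAle cnorm_ge0 andbT eq_sym; apply: contra_neq e0; exact: cnorm_eq0.
have : cnorm ((rs t - h) * e) <= t * cnorm e.
  by apply: (le_trans (cnormM_le _ _)); rewrite ler_pM2r.
rewrite mulrBl he -mulrBl -!rmorphB cnormZr ler_pM2r // ler_norml => /andP[_].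
lra.
Qed.

(* Kaplansky's argument: if x^* x had an eigenvalue a < 0 on e, then y = x e
   has y^* y = a e, so that y y^* is a sum of squares, hence positive, although
   (y y^* ) y = a y. *)
Lemma star_mul_eig_ge0 x e (a : R) : F x -> F e -> star e = e -> e * e = e -> e != 0 ->
  star x * x * e = rs a * e -> 0 <= a.
Proof.
move=> Fx Fe eh ee e0 xe; rewrite leNgt; apply/negP => a0.
pose i1 := scal S 'i%C.
pose y := x * e; have Fy : F y by apply: (asM FA).
have Fay : F (star y) by apply: (asadj FA).
have yy : star y * y = rs a * e.
  by rewrite /y starM eh -mulrA [star x * _]mulrA xe mulrA -cstar_scalC -mulrA ee.
pose c := y + star y; pose d := i1 * (y - star y).
have ch : star c = c by rewrite /c starD starK addrC.
have i1h : star i1 = - i1.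
  rewrite /i1 cstar_adjZ -rmorphN; congr (in_alg A _).
  by apply/eqP; rewrite eq_complex /= oppr0 !eqxx.
have dh : star d = d.
  rewrite /d starM i1h starD starN starK mulrN -mulNr opprB.
  by rewrite -cstar_scalC.
have ii : i1 * i1 = -1.
  by rewrite /i1 -rmorphM -expr2 sqr_i rmorphN rmorph1.
have Fc : F c by apply: (asD FA).
have Fd : F d by apply: (asM FA); [exact: (asZ FA) | exact: (asB FA)].
pose g := rs (Num.sqrt (- a)) * e.
have Fg : F g by apply: (asM FA) => //; exact: (asZ FA).
have gh : star g = g by rewrite /g starM eh star_rs cstar_scalC.
have gg : g * g = - (rs a * e).
  rewrite /g; set r := rs _; have er : e * r = r * e by rewrite /r (scalC S).
  rewrite mulrA -[r * e * r]mulrA er mulrA -mulrA ee /r -rmorphM -rmorphM.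
  by rewrite -expr2 sqr_sqrtr ?oppr_ge0 ?ltW // !rmorphN mulNr.
have dd : d * d = - ((y - star y) * (y - star y)).
  rewrite /d; set z := y - star y; have zi : z * i1 = i1 * z by rewrite /i1 (scalC S).
  by rewrite mulrA -[i1 * z * i1]mulrA zi mulrA ii mulN1r mulNr.
(* Up to factors, [c] and [d] are the real and imaginary parts of [y], so
   [c^2 + d^2 = 2 (y y^* + y^* y)]; and [g^2 = - a e = - y^* y] since [a < 0]. *)
have key : y * star y + y * star y = c * c + d * d + (g * g + g * g).
  have ccE : c * c = (y * y + star y * star y) + (y * star y + star y * y).
    by rewrite /c mulrDl !mulrDr [star y * y + _]addrC addrACA.
  have yyE : (y - star y) * (y - star y) =
      (y * y + star y * star y) - (y * star y + star y * y).
    by rewrite mulrBl !mulrBr opprB addrACA -opprD.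
  have double s t : s + t - (s - t) = t + t :> A.
    by rewrite opprB [s + t]addrC addrACA subrr addr0.
  by rewrite dd gg -yy ccE yyE double addrACA addrK.
have pos : cpos (y * star y + y * star y).
  by rewrite key; do 2?apply: cposD; apply: cpos_sqr.
have y0 : y != 0.
  apply: contra_neq e0 => y0; move: yy; rewrite y0 mulr0 => /esym /(congr1 (fun z => rs a^-1 * z)).
  by rewrite mulr0 mulrA -rmorphM -rmorphM mulVf ?ltr0_neq0 // !rmorph1 mul1r.
have := @cpos_eig _ y (a + a) pos y0; rewrite mulrDl -mulrA yy.
have ye : y * e = y by rewrite /y -mulrA ee.
rewrite mulrA -cstar_scalC -mulrA ye -mulrDl -!rmorphD => /(_ erefl); lra.
Qed.

Lemma cpos_star_mul x : F x -> cpos (star x * x).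
Proof.
move=> Fx; set h := star x * x.
have Fh : F h by apply: (asM FA) => //; exact: (asadj FA).
have hh : star h = h by rewrite /h starM starK.
have [s [e sd]] := spectral FA Fh hh.
(* Spurious members of [s] might be negative; their components vanish, so the function may be set to
   0 there. *)
have -> : h = fcalc S s e (fun a => if e a == 0 then 0 else a).
  rewrite -(fcalc_id sd); apply: eq_big_seq => a as_.
  by have [->|//] := eqVneq (e a) 0; rewrite !mulr0.
apply: (cpos_fcalc sd) => a as_; have [//|e0] := eqVneq (e a) 0.
apply: (star_mul_eig_ge0 Fx (sd_in sd as_) _ _ e0 (sd_eig sd as_)).
  exact: (sd_adj sd).
exact: (sd_idem sd).
Qed.

(** Each summand is positive, and so is its negative, being the sum of the others. All its
    eigenvalues are therefore 0. *)
Theorem sum_star_eq0 (I : finType) (x : I -> A) : (forall i, F (x i)) ->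
  \sum_i star (x i) * x i = 0 -> forall i, x i = 0.
Proof.
move=> Fx sum0 i; apply: star_mul_eq0; set h := star (x i) * x i.
have Fh : F h by apply: (asM FA) => //; exact: (asadj FA).
have hh : star h = h by rewrite /h starM starK.
have [s [e sd]] := spectral FA Fh hh.
have hN : cpos (- h).
  move: sum0; rewrite (bigD1 i) //= => /eqP; rewrite addrC addr_eq0 => /eqP <-.
  by apply: cpos_sum => j _; apply: cpos_star_mul.
rewrite -[h]mulr1 -(sd_sum sd) mulr_sumr big1_seq // => a /andP[_ as_].
have [->|e0] := eqVneq (e a) 0; first by rewrite mulr0.
have he := sd_eig sd as_; rewrite he.
have a0 : 0 <= a by apply: (cpos_eig (cpos_star_mul (Fx i)) e0 he).
have a1 : 0 <= - a.
  by apply: (cpos_eig hN e0); rewrite mulNr he !rmorphN mulNr.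
by have -> : a = 0 by [lra]; rewrite !rmorph0 mul0r.
Qed.

End Positivity.

(** * Matrices over a C*-algebra *)

Section AdjMx.
Context {R : realType} (A : cstarAlgType R).

Lemma adjmxE m n (x : 'M[A]_(m, n)) i j : adjmx x i j = star (x j i).
Proof. by rewrite !mxE. Qed.

Lemma adjmxD m n (x y : 'M[A]_(m, n)) : adjmx (x + y) = adjmx x + adjmx y.
Proof. by apply/matrixP => i j; rewrite !(adjmxE, mxE) starD. Qed.

Lemma star_sum I (r : seq I) (P : pred I) (f : I -> A) :
  star (\sum_(i <- r | P i) f i) = \sum_(i <- r | P i) star (f i).
Proof. by apply: (big_morph star); [exact: starD | exact: star0]. Qed.

Lemma adjmxM m n k (x : 'M[A]_(m, n)) (y : 'M[A]_(n, k)) :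
  adjmx (x *m y) = adjmx y *m adjmx x.
Proof.
apply/matrixP => i j; rewrite adjmxE !mxE star_sum.
by apply: eq_bigr => l _; rewrite starM !adjmxE.
Qed.

Lemma adjmxK m n (x : 'M[A]_(m, n)) : adjmx (adjmx x) = x.
Proof. by apply/matrixP => i j; rewrite !adjmxE starK. Qed.

Lemma adjmx0 m n : adjmx (0 : 'M[A]_(m, n)) = 0.
Proof. by apply/matrixP => i j; rewrite !(adjmxE, mxE) star0. Qed.

Lemma adjmx_scalar n (a : A) : adjmx (a%:M : 'M[A]_n) = (star a)%:M.
Proof.
apply/matrixP => i j; rewrite adjmxE !mxE eq_sym.
by case: eqP; rewrite ?mulr1n ?mulr0n ?star0.
Qed.

Lemma adjmx_row_mx m n1 n2 (x : 'M[A]_(m, n1)) (y : 'M[A]_(m, n2)) :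
  adjmx (row_mx x y) = col_mx (adjmx x) (adjmx y).
Proof. by rewrite /adjmx tr_row_mx map_col_mx. Qed.

Lemma adjmx_dsum m n (p : 'M[A]_m) (q : 'M[A]_n) :
  adjmx (dsum p q) = dsum (adjmx p) (adjmx q).
Proof. by rewrite /dsum {1}/adjmx tr_block_mx map_block_mx -!/(adjmx _) !adjmx0. Qed.

Lemma mul_central_mx m n (a : A) (x : 'M[A]_(m, n)) :
  (forall y, a * y = y * a) -> a%:M *m x = x *m a%:M.
Proof.
move=> aC; rewrite mul_scalar_mx; apply/matrixP => i j; rewrite !mxE aC.
rewrite (bigD1 j) //= !mxE eqxx mulr1n big1 ?addr0 // => k kj.
by rewrite mxE (negbTE kj) mulr0n mulr0.
Qed.

End AdjMx.

Section MxInstance.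
Context {R : realType} (A : cstarAlgType R) (n : nat).
Local Notation T := 'M[A]_n.+1.
Implicit Types x y : T.

Definition mx_scal : {rmorphism R[i] -> T} := scalar_mx \o in_alg A.

Lemma mx_scalE c : mx_scal c = (in_alg A c)%:M.
Proof. by []. Qed.

Lemma mx_scalC c x : mx_scal c * x = x * mx_scal c.
Proof. by apply: mul_central_mx => y; exact: cstar_scalC. Qed.

Lemma mx_adjZ c : adjmx (mx_scal c) = mx_scal (conjc c).
Proof. by rewrite !mx_scalE adjmx_scalar cstar_adjZ. Qed.

Definition mx_alg : star_alg R T :=
  @StarAlg R T mx_scal mx_scalC (@adjmx R A n.+1 n.+1) (@adjmxD R A _ _)
    (@adjmxM R A _ _ _) (@adjmxK R A _ _) mx_adjZ.

Definition mx_norm1 x : R := \sum_i \sum_j cnorm (x i j).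

Lemma cnorm_le_mx_norm1 x i j : cnorm (x i j) <= mx_norm1 x.
Proof.
rewrite /mx_norm1 (bigD1 i) //= (bigD1 j) //= -addrA lerDl addr_ge0 //.
  by apply: sumr_ge0 => k _; exact: cnorm_ge0.
by apply: sumr_ge0 => k _; apply: sumr_ge0 => l _; exact: cnorm_ge0.
Qed.

Lemma mx_norm1_eq0 x : mx_norm1 x = 0 -> x = 0.
Proof.
move=> x0; apply/matrixP => i j; rewrite mxE; apply: cnorm_eq0; apply/eqP.
by rewrite eq_le cnorm_ge0 andbT -x0 cnorm_le_mx_norm1.
Qed.

Lemma mx_norm1D x y : mx_norm1 (x + y) <= mx_norm1 x + mx_norm1 y.
Proof.
rewrite /mx_norm1 -big_split ler_sum // => i _; rewrite -big_split ler_sum // => j _.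
by rewrite mxE cnormD_le.
Qed.

Lemma cnorm_sum I (r : seq I) (f : I -> A) :
  cnorm (\sum_(i <- r) f i) <= \sum_(i <- r) cnorm (f i).
Proof.
elim/big_rec2: _ => [|i y x _ IH]; first by rewrite cnorm0.
by apply: (le_trans (cnormD_le _ _)); rewrite lerD2l.
Qed.

Lemma mx_norm1M x y : mx_norm1 (x * y) <= mx_norm1 x * mx_norm1 y.
Proof.
have le1 : mx_norm1 (x * y) <=
    \sum_i \sum_j \sum_k cnorm (x i k) * cnorm (y k j).
  apply: ler_sum => i _; apply: ler_sum => j _; rewrite mxE.
  apply: (le_trans (cnorm_sum _ _)); apply: ler_sum => k _; exact: cnormM_le.
apply: (le_trans le1); rewrite /mx_norm1 mulr_suml; apply: ler_sum => i _.
rewrite exchange_big mulr_suml /=; apply: ler_sum => k _.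
rewrite -mulr_sumr ler_wpM2l ?cnorm_ge0 // [leRHS](bigD1 k) //= lerDl.
by apply: sumr_ge0 => l _; apply: sumr_ge0 => j _; exact: cnorm_ge0.
Qed.

Lemma mx_norm1Z (a : R) x : mx_norm1 (scal mx_alg a%:C%C * x) = `|a| * mx_norm1 x.
Proof.
rewrite /= -[_ * x]/(_ *m x) mul_scalar_mx /mx_norm1 mulr_sumr.
apply: eq_bigr => i _; rewrite mulr_sumr; apply: eq_bigr => j _.
by rewrite mxE -cnormZr.
Qed.

Lemma mx_norm1_adj x : mx_norm1 (adjmx x) = mx_norm1 x.
Proof.
rewrite /mx_norm1 exchange_big; apply: eq_bigr => i _; apply: eq_bigr => j _.
by rewrite adjmxE cnorm_star.
Qed.

Lemma mx_norm1_complete (u : nat -> T) :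
  (forall e : R, 0 < e -> exists N, forall m k, (N <= m)%N -> (N <= k)%N ->
      mx_norm1 (u m - u k) < e) ->
  exists l, forall e : R, 0 < e -> exists N, forall k, (N <= k)%N ->
      mx_norm1 (u k - l) < e.
Proof.
move=> ucau.
have /choice[l lP] (ij : 'I_n.+1 * 'I_n.+1) : exists l, forall e : R, 0 < e ->
    exists N, forall k, (N <= k)%N -> cnorm (u k ij.1 ij.2 - l) < e.
  apply: (@cnorm_cauchy R A (fun k => u k ij.1 ij.2)) => e /ucau[N NP].
  exists N => m k Nm Nk; apply: le_lt_trans (NP m k Nm Nk).
  by have := cnorm_le_mx_norm1 (u m - u k) ij.1 ij.2; rewrite !mxE.
exists (\matrix_(i, j) l (i, j)) => e e0.
pose d : R := e / (n.+1 * n.+1)%:R / 2.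
have nn0 : 0 < (n.+1 * n.+1)%:R :> R by rewrite ltr0n muln_gt0.
have d0 : 0 < d by rewrite !divr_gt0.
have /choice[N NP] ij := lP ij d d0.
exists (\max_ij N ij) => k Nk.
apply: (@le_lt_trans _ _ (\sum_(i < n.+1) \sum_(j < n.+1) d)).
  apply: ler_sum => i _; apply: ler_sum => j _; rewrite !mxE; apply/ltW.
  by apply: (NP (i, j)); apply: leq_trans Nk; exact: (leq_bigmax (i, j)).
rewrite !sumr_const !card_ord -mulrnA -mulr_natr /d mulrAC divfK ?gt_eqF //.
by rewrite ltr_pdivrMr // ltr_pMr // ltr1n.
Qed.

Definition mx_banach : banach_norm mx_alg :=
  @BanachNorm R T mx_alg mx_norm1 mx_norm1_eq0 mx_norm1D mx_norm1M mx_norm1Z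
    mx_norm1_adj mx_norm1_complete.

End MxInstance.

Section FdSub.
Context {R : realType} (A : cstarAlgType R) (F : set A).
Hypothesis Ffd : fd_unital_subCstar F.

Lemma fd_sum I (r : seq I) (f : I -> A) : (forall i, F (f i)) ->
  F (\sum_(i <- r) f i).
Proof.
have F0 : F 0 by rewrite -(scale0r 1); apply: (fd_scale Ffd); exact: (fd_one Ffd).
by move=> Ff; elim/big_ind: _ => //; exact: (fd_add Ffd).
Qed.

Lemma fd_algebraic : algebraic_sub (cstar_alg A) F.
Proof.
have F1 := fd_one Ffd.
split.
- exact: (fd_add Ffd).
- exact: (fd_mul Ffd).
- by move=> c; apply: (fd_scale Ffd).
- exact: (fd_star Ffd).
- move=> x Fx; have [d [b bP]] := fd_dim Ffd.
  apply: (@algebraic_of_span _ _ _ _ b) => i.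
  have /bP[c ->] : F (x ^+ i).
    by elim: i => [|i IH]; rewrite ?expr0 // exprS; apply: (fd_mul Ffd).
  by exists c; apply: eq_bigr => j _; rewrite /= mulr_algl.
- by move=> x _; exact: star_mul_eq0.
Qed.

Definition mx_over n : set 'M[A]_n.+1 := fun x => forall i j, F (x i j).

Lemma mx_over_scalar n a : F a -> mx_over (a%:M : 'M[A]_n.+1).
Proof.
move=> Fa i j; rewrite mxE; case: eqP => _; rewrite ?mulr1n // mulr0n.
exact: (as0 fd_algebraic).
Qed.

(** The diagonal entry at [j] of the sum is a sum of [t^* t] over the [j]-th columns of all three
    matrices, to which [sum_star_eq0] applies. *)
Lemma mx_over_pos n (x y z : 'M[A]_n.+1) : mx_over x -> mx_over y -> mx_over z ->
  adjmx x * x + adjmx y * y + adjmx z * z = 0 -> x = 0.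
Proof.
move=> Fx Fy Fz s0; apply/matrixP => i j; rewrite mxE.
pose f (t : 'I_n.+1 + ('I_n.+1 + 'I_n.+1)) :=
  match t with inl k => x k j | inr (inl k) => y k j | inr (inr k) => z k j end.
apply: (@sum_star_eq0 R A F fd_algebraic _ f _ _ (inl i)); first by case=> [|[]] k /=.
rewrite !big_sumType /=.
have := congr1 (fun M : 'M[A]_n.+1 => M j j) s0; rewrite !mxE addrA.
move=> E; rewrite -[RHS]E; congr (_ + _ + _);
  by apply: eq_bigr => k _; rewrite adjmxE.
Qed.

Lemma mx_over_algebraic n : algebraic_sub (mx_alg A n) (@mx_over n).
Proof.
have FA := fd_algebraic; have F1 := fd_one Ffd.
have overM x y : @mx_over n x -> @mx_over n y -> @mx_over n (x * y).
  move=> Fx Fy i j; rewrite mxE; apply: fd_sum => k.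
  by apply: (fd_mul Ffd).
have over_scal c : @mx_over n (mx_scal A n c).
  by apply: mx_over_scalar; apply: (fd_scale Ffd).
split=> //.
- by move=> x y Fx Fy i j; rewrite mxE; apply: (fd_add Ffd).
- by move=> x Fx i j; rewrite adjmxE; apply: (fd_star Ffd).
- move=> x Fx; have [d [b bP]] := fd_dim Ffd.
  apply: (@algebraic_of_span _ _ _ ('I_n.+1 * 'I_n.+1 * 'I_d)%type
    (fun t => b t.2 *: delta_mx t.1.1 t.1.2)) => m.
  have Fm : @mx_over n (x ^+ m).
    elim: m => [|m IH]; first by rewrite expr0; apply: mx_over_scalar.
    by rewrite exprS; apply: overM.
  have /choice[c cP] (ij : 'I_n.+1 * 'I_n.+1) : exists c : 'I_d -> R[i],
      (x ^+ m) ij.1 ij.2 = \sum_k c k *: b k by exact: (bP _ (Fm _ _)).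
  exists (fun t => c t.1 t.2); rewrite [LHS]matrix_sum_delta pair_bigA /=.
  rewrite -(pair_bigA _ (fun ij k => scal (mx_alg A n) (c ij k) *
    (b k *: delta_mx ij.1 ij.2))) /=.
  apply: eq_bigr => ij _; rewrite cP scaler_suml; apply: eq_bigr => k _.
  by rewrite -[RHS]/(_ *m _) mul_scalar_mx scalerA mulr_algl.
- move=> x Fx xx; apply: (mx_over_pos Fx (y := 0) (z := 0)).
  + by move=> i j; rewrite mxE; exact: (as0 FA).
  + by move=> i j; rewrite mxE; exact: (as0 FA).
  + by rewrite !mulr0 !addr0.
Qed.

End FdSub.

Section Embedding.
Context {R : realType} (A : cstarAlgType R).

Definition emb m n (f : 'I_m -> 'I_n) : 'M[A]_(n, m) :=
  \matrix_(i, j) (i == f j)%:R.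

Lemma adjmx_emb_mul m k n (f : 'I_m -> 'I_n) (g : 'I_k -> 'I_n) i j :
  (adjmx (emb f) *m emb g) i j = (f i == g j)%:R.
Proof.
rewrite mxE (bigD1 (f i)) //= big1 ?addr0; last first.
  by move=> l lf; rewrite adjmxE !mxE (negbTE lf) star0 mul0r.
by rewrite adjmxE !mxE eqxx star1 mul1r.
Qed.

Lemma adjmx_emb m n (f : 'I_m -> 'I_n) : injective f ->
  adjmx (emb f) *m emb f = 1%:M.
Proof. by move=> fi; apply/matrixP => i j; rewrite adjmx_emb_mul mxE inj_eq. Qed.

Lemma adjmx_emb0 m k n (f : 'I_m -> 'I_n) (g : 'I_k -> 'I_n) :
  (forall i j, f i != g j) -> adjmx (emb f) *m emb g = 0.
Proof. by move=> fg; apply/matrixP => i j; rewrite adjmx_emb_mul mxE (negbTE (fg _ _)). Qed.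

End Embedding.

(** * Cancellation for matrix projections over an AF algebra *)

Section Compress.
Context {R : realType} (A : cstarAlgType R).

Lemma conj_proj m n (E : 'M[A]_(n.+1, m)) (p : 'M[A]_m) :
  adjmx E *m E = 1%:M -> is_projmx p -> sa_proj (mx_alg A n) (E *m p *m adjmx E).
Proof.
move=> EE [pp ph]; split.
  by rewrite -[LHS]/(_ *m _) !mulmxA -(mulmxA _ (adjmx E)) EE mulmx1 -(mulmxA E p p) pp.
change (adjmx (E *m p *m adjmx E) = E *m p *m adjmx E).
by rewrite !adjmxM adjmxK ph mulmxA.
Qed.

Lemma conj_absorb m n (E : 'M[A]_(n, m)) (x : 'M[A]_m) : adjmx E *m E = 1%:M ->
  E *m adjmx E *m (E *m x *m adjmx E) = E *m x *m adjmx E.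
Proof. by move=> EE; rewrite !mulmxA -(mulmxA E (adjmx E)) EE mulmx1. Qed.

Theorem mx_cancellation m n k (p : 'M[A]_m) (q : 'M[A]_n) (r : 'M[A]_k) :
  AF_algebra A -> is_projmx p -> is_projmx q -> is_projmx r ->
  mvn_mx (dsum p r) (dsum q r) -> mvn_mx p q.
Proof.
move=> [F [Ffd Fincr Fdense]] pP qP rP [v [vp vq]].
(* The three projections are placed in disjoint diagonal blocks of one matrix algebra. Its size is
   [N.+1], with index 0 idle, so that it is a nonzero ring even when all blocks are empty. *)
pose N := (m + (n + k))%N.
pose Em : 'M[A]_(N.+1, m) := emb A (fun i => rshift 1 (lshift (n + k) i)).
pose En : 'M[A]_(N.+1, n) := emb A (fun i => rshift 1 (rshift m (lshift k i))).
pose Ek : 'M[A]_(N.+1, k) := emb A (fun i => rshift 1 (rshift m (rshift n i))).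
have EEm : adjmx Em *m Em = 1%:M.
  by apply: adjmx_emb => i j /= /(@rshift_inj 1 _ _ _) /(@lshift_inj _ _ _ _).
have EEn : adjmx En *m En = 1%:M.
  by apply: adjmx_emb => i j /= /(@rshift_inj 1 _ _ _) /(@rshift_inj _ _ _ _) /(@lshift_inj _ _ _ _).
have EEk : adjmx Ek *m Ek = 1%:M.
  by apply: adjmx_emb => i j /= /(@rshift_inj 1 _ _ _) /(@rshift_inj _ _ _ _) /(@rshift_inj _ _ _ _).
have Emk : adjmx Em *m Ek = 0.
  apply: adjmx_emb0 => i j /=; apply/negP => /eqP /(@rshift_inj 1 _ _ _) /eqP.
  by rewrite eq_lrshift.
have Enk : adjmx En *m Ek = 0.
  apply: adjmx_emb0 => i j /=; apply/negP => /eqP /(@rshift_inj 1 _ _ _).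
  by move=> /(@rshift_inj _ _ _ _) /eqP; rewrite eq_lrshift.
have Ekm : adjmx Ek *m Em = 0 by rewrite -[LHS]adjmxK adjmxM adjmxK Emk adjmx0.
have Ekn : adjmx Ek *m En = 0 by rewrite -[LHS]adjmxK adjmxM adjmxK Enk adjmx0.
pose U1 := row_mx Em Ek; pose U2 := row_mx En Ek.
have UU1 : adjmx U1 *m U1 = 1%:M.
  by rewrite adjmx_row_mx mul_col_row EEm EEk Emk Ekm -scalar_mx_block.
have UU2 : adjmx U2 *m U2 = 1%:M.
  by rewrite adjmx_row_mx mul_col_row EEn EEk Enk Ekn -scalar_mx_block.
have U1E : U1 *m dsum p r *m adjmx U1 = Em *m p *m adjmx Em + Ek *m r *m adjmx Ek.
  by rewrite adjmx_row_mx mul_row_block !mulmx0 addr0 add0r mul_row_col.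
have U2E : U2 *m dsum q r *m adjmx U2 = En *m q *m adjmx En + Ek *m r *m adjmx Ek.
  by rewrite adjmx_row_mx mul_row_block !mulmx0 addr0 add0r mul_row_col.
pose S := mx_alg A N; pose T := 'M[A]_N.+1.
pose V : T := U2 *m v *m adjmx U1.
set P := Em *m p *m _ in U1E; set Q := En *m q *m _ in U2E.
set Rr := Ek *m r *m _ in U1E U2E.
have VE : star_equiv S (P + Rr : T) (Q + Rr : T) V.
  split.
    rewrite -[LHS]/(adjmx V *m V) -U1E -vp /V !adjmxM adjmxK !mulmxA.
    by rewrite -(mulmxA _ (adjmx U2)) UU2 mulmx1.
  rewrite -[LHS]/(V *m adjmx V) -U2E -vq /V !adjmxM adjmxK !mulmxA.
  by rewrite -(mulmxA _ (adjmx U1)) UU1 mulmx1.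
have F0 j : F j 0 by apply: (as0 (fd_algebraic (Ffd j))).
(* The block projections have entries 0 and 1, so they belong to every [F j], as [proj_approx]
   demands of its corners. *)
have Femb l (f : 'I_l -> 'I_N.+1) j : mx_over (F j) (emb A f *m adjmx (emb A f)).
  move=> a b; rewrite mxE; apply: (fd_sum (Ffd j)) => c.
  have Fnat (d : bool) : F j d%:R by case: d; [exact: (fd_one (Ffd j)) | exact: F0].
  apply: (fd_mul (Ffd j)); first by rewrite mxE.
  by rewrite adjmxE; apply: (fd_star (Ffd j)); rewrite mxE.
have one_proj l : is_projmx (1%:M : 'M[A]_l).
  by split; rewrite ?mulmx1 // adjmx_scalar star1.
have cproj l (E : 'M[A]_(N.+1, l)) : adjmx E *m E = 1%:M ->
    sa_proj S (E *m adjmx E : T).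
  by move=> EE; have := conj_proj EE (one_proj l); rewrite mulmx1.
have orth l l' (E : 'M[A]_(N.+1, l)) (E' : 'M[A]_(N.+1, l')) : adjmx E *m E' = 0 ->
    E *m adjmx E *m (E' *m adjmx E') = 0.
  by move=> EE; rewrite !mulmxA -(mulmxA E) EE mulmx0 mul0mx.
have incr j x : @mx_over R A (F j) N x -> @mx_over R A (F j.+1) N x.
  by move=> Fx a b; apply: Fincr.
have dense (x : T) (e : R) : 0 < e ->
    exists j y, @mx_over R A (F j) N y /\ mx_norm1 (x - y) < e.
  move=> e0; pose d : R := e / (N.+1 * N.+1)%:R / 2.
  have nn0 : 0 < (N.+1 * N.+1)%:R :> R by rewrite ltr0n muln_gt0.
  have d0 : 0 < d by rewrite !divr_gt0.
  have /choice[jy jyP] (ab : 'I_N.+1 * 'I_N.+1) : exists jy : nat * A,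
      F jy.1 jy.2 /\ cnorm (x ab.1 ab.2 - jy.2) < d.
    have : norm_closure (\bigcup_j F j)%classic (x ab.1 ab.2) by rewrite Fdense.
    by move=> /(_ d d0)[y [j _ Fy] xy]; exists (j, y).
  have Fle j j' y : (j <= j')%N -> F j y -> F j' y.
    by move=> /subnK <-; elim: (j' - j)%N => //= l IH /IH; exact: Fincr.
  exists (\max_ab (jy ab).1), (\matrix_(a, b) (jy (a, b)).2); split.
    move=> a b; rewrite mxE; apply: (Fle (jy (a, b)).1); last exact: (jyP _).1.
    exact: (leq_bigmax (a, b)).
  apply: (@le_lt_trans _ _ (\sum_(i < N.+1) \sum_(j < N.+1) d)).
    apply: ler_sum => i _; apply: ler_sum => j _; rewrite !mxE; apply/ltW.
    exact: (jyP (i, j)).2.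
  rewrite !sumr_const !card_ord -mulrnA -mulr_natr /d mulrAC divfK ?gt_eqF //.
  by rewrite ltr_pdivrMr // ltr_pMr // ltr1n.
have [u uE] := @cancellation R T S (mx_banach A N) (fun j => @mx_over R A (F j) N)
  (fun j => mx_over_algebraic (Ffd j) N) (fun j => @mx_over_pos R A (F j) (Ffd j) N)
  incr dense _ _ _ P Q Rr V
  (Femb _ _) (Femb _ _) (Femb _ _) (cproj _ _ EEm) (cproj _ _ EEn) (cproj _ _ EEk)
  (orth _ _ _ _ Emk) (orth _ _ _ _ Enk)
  (conj_proj EEm pP) (conj_proj EEn qP) (conj_proj EEk rP)
  (conj_absorb p EEm) (conj_absorb q EEn) (conj_absorb r EEk) VE.
have := star_equiv_corner (conj_proj EEm pP) (conj_proj EEn qP) uE.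
set w := _ * u * _ => -[].
rewrite -[adj S w * w]/(adjmx w *m w) -[w * adj S w]/(w *m adjmx w) => wp wq.
have Qw : En *m adjmx En *m w = w.
  change (En *m adjmx En *m (Q *m u *m P) = Q *m u *m P).
  by rewrite 2!mulmxA conj_absorb.
have wP : w *m (Em *m adjmx Em) = w.
  have Pc : P *m (Em *m adjmx Em) = P.
    by rewrite /P -mulmxA [adjmx Em *m _]mulmxA EEm mul1mx.
  change (Q *m u *m P *m (Em *m adjmx Em) = Q *m u *m P).
  by rewrite -[LHS]mulmxA Pc.
have back l (E : 'M[A]_(N.+1, l)) x : adjmx E *m E = 1%:M ->
    adjmx E *m (E *m x *m adjmx E) *m E = x.
  by move=> EE; rewrite !mulmxA EE mul1mx -mulmxA EE mulmx1.
clearbody w; exists (adjmx En *m w *m Em); rewrite !adjmxM adjmxK; split.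
  rewrite -[RHS](back _ _ _ EEm) -wp -!mulmxA; congr (_ *m _).
  by rewrite (mulmxA En) (mulmxA _ w) Qw.
rewrite -[RHS](back _ _ _ EEn) -wq -!mulmxA; congr (_ *m _).
by rewrite (mulmxA Em) (mulmxA w) wP.
Qed.

End Compress.

(** * K_0 of an AF algebra and of its quotients *)

Section K0Theory.
Context {R : realType} (A : cstarAlgType R) (AF : AF_algebra A).
Context (V : zmodType) (G P : set V) (u : V) (cls : forall n, 'M[A]_n -> V).
Hypothesis K : K0_iso G P u cls.

Lemma projmx0 n : is_projmx (0 : 'M[A]_n).
Proof. by split; rewrite ?mulmx0 ?adjmx0. Qed.

Lemma projmx_dsum m n (p : 'M[A]_m) (q : 'M[A]_n) :
  is_projmx p -> is_projmx q -> is_projmx (dsum p q).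
Proof.
move=> [pp ph] [qq qh]; split; last by rewrite adjmx_dsum ph qh.
by rewrite /dsum mulmx_block !(mulmx0, mul0mx, addr0) add0r pp qq.
Qed.

Lemma cls_mvn m n (p : 'M[A]_m) (q : 'M[A]_n) :
  is_projmx p -> is_projmx q -> mvn_mx p q -> cls p = cls q.
Proof.
move=> pP qP [v [vp vq]]; apply/(K0_eq K pP qP); exists 0%N, 0; split.
  exact: projmx0.
exists (block_mx v 0 0 0); rewrite /dsum.
have -> : adjmx (block_mx v 0 0 (0 : 'M_0)) = block_mx (adjmx v) 0 0 0.
  by rewrite {1}/adjmx tr_block_mx map_block_mx -!/(adjmx _) !adjmx0.
by rewrite !mulmx_block !(mulmx0, mul0mx, addr0) vp vq.
Qed.

(** [K0_eq] by itself yields only stable equivalence; cancellation removes the extra summand. *)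
Lemma cls_eq m n (p : 'M[A]_m) (q : 'M[A]_n) :
  is_projmx p -> is_projmx q -> cls p = cls q -> mvn_mx p q.
Proof.
move=> pP qP /(K0_eq K pP qP)[k [r [rP pq]]].
exact: (mx_cancellation AF pP qP rP pq).
Qed.

Lemma cls0 n : cls (0 : 'M[A]_n) = 0.
Proof.
have H := K0_add K (projmx0 n) (projmx0 n).
have E : cls (dsum (0 : 'M[A]_n) (0 : 'M[A]_n)) = cls (0 : 'M[A]_n).
  apply: cls_mvn; [by apply: projmx_dsum; exact: projmx0 | exact: projmx0 |].
  exists 0; rewrite adjmx0 mulmx0 mul0mx; split=> //.
  by rewrite /dsum block_mx0.
by apply: (addrI (cls (0 : 'M[A]_n))); rewrite addr0 -H E.
Qed.

Definition pcls (x : A) : V := cls (x%:M : 'M[A]_1).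

Lemma mx11_mul (x y : A) : (x%:M : 'M_1) *m y%:M = (x * y)%:M.
Proof. by rewrite -scalar_mxM. Qed.

Lemma projmx_scalar (x : A) : is_proj x -> is_projmx (x%:M : 'M[A]_1).
Proof.
by case/andP => /eqP xx /eqP xh; split; rewrite ?mx11_mul ?adjmx_scalar ?xx ?xh.
Qed.

Lemma pcls0 : pcls 0 = 0.
Proof. by rewrite /pcls raddf0 cls0. Qed.

Lemma pcls1 : pcls 1 = u.
Proof. exact: (K0_unit K). Qed.

Lemma pcls_pos x : is_proj x -> G (pcls x) /\ P (pcls x).
Proof.
move=> xP; have : (G `&` P)%classic (pcls x).
  rewrite (K0_pos K); exists 1%N, x%:M; split=> //; exact: projmx_scalar.
by [].
Qed.

Lemma is_projD (x y : A) : is_proj x -> is_proj y -> x * y = 0 -> is_proj (x + y).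
Proof.
move=> /andP[/eqP xx /eqP xh] /andP[/eqP yy /eqP yh] xy.
have yx : y * x = 0 by rewrite -xh -yh -starM xy star0.
by rewrite /is_proj mulrDl !mulrDr xx yy xy yx addr0 add0r starD xh yh !eqxx.
Qed.

Lemma pclsD (x y : A) : is_proj x -> is_proj y -> x * y = 0 ->
  pcls (x + y) = pcls x + pcls y.
Proof.
move=> xP yP xy; rewrite -(K0_add K) ?projmx_scalar //; try exact: projmx_scalar.
apply/esym/cls_mvn.
- by apply: projmx_dsum; exact: projmx_scalar.
- by apply: projmx_scalar; exact: is_projD.
move/andP: xP => [/eqP xx /eqP xh]; move/andP: yP => [/eqP yy /eqP yh].
have yx : y * x = 0 by rewrite -xh -yh -starM xy star0.
exists (row_mx x%:M y%:M); rewrite adjmx_row_mx !adjmx_scalar xh yh; split.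
  by rewrite mul_col_row !mx11_mul xx yy xy yx !raddf0.
by rewrite mul_row_col !mx11_mul xx yy -raddfD.
Qed.

(** The positive elements [f] and [g] are classes of matrix projections [a] and [b]. By cancellation
    [dsum a b] is equivalent to [y], and the equivalence carries the two summands to orthogonal
    subprojections of [y]. *)
Lemma pcls_split (y : A) (f g : V) : is_proj y -> G f -> P f -> G g -> P g ->
  pcls y = f + g ->
  exists x d, [/\ is_proj x, is_proj d, x * d = 0, y = x + d &
    pcls x = f /\ pcls d = g].
Proof.
move=> yP Gf Pf Gg Pg yfg.
have : (G `&` P)%classic f by [].
rewrite (K0_pos K) => -[m [a [aP fE]]].
have : (G `&` P)%classic g by [].
rewrite (K0_pos K) => -[n [b [bP gE]]].
have yS := projmx_scalar yP.
have : cls (dsum a b) = cls (y%:M : 'M_1).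
  by rewrite (K0_add K) // -fE -gE -yfg.
move=> /(cls_eq (projmx_dsum aP bP) yS)[v [vab vy]].
have [aa ah] := aP; have [bb bh] := bP.
pose a' := dsum a (0 : 'M[A]_n); pose b' := dsum (0 : 'M[A]_m) b.
have aP' : is_projmx a' by apply: projmx_dsum => //; exact: projmx0.
have bP' : is_projmx b' by apply: projmx_dsum => //; exact: projmx0.
have ab0 : a' *m b' = 0.
  by rewrite /a' /b' /dsum mulmx_block !(mulmx0, mul0mx, addr0) block_mx0.
have abD : a' + b' = dsum a b by rewrite /a' /b' /dsum add_block_mx !addr0 add0r.
have ba0 : b' *m a' = 0.
  by rewrite /a' /b' /dsum mulmx_block !(mulmx0, mul0mx, addr0) block_mx0.
have compress (c : 'M[A]_(m + n)) : is_projmx c -> dsum a b *m c = c ->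
    c *m dsum a b = c ->
    is_projmx (v *m c *m adjmx v) /\ cls (v *m c *m adjmx v) = cls c.
  move=> [cc ch] abc cab.
  have vcP : is_projmx (v *m c *m adjmx v).
    split; last by rewrite !adjmxM adjmxK ch mulmxA.
    rewrite !mulmxA -(mulmxA (v *m c) (adjmx v) v) vab -(mulmxA v c _) cab.
    by rewrite -(mulmxA v c c) cc.
  split=> //; apply/esym/cls_mvn => //.
  exists (v *m c); rewrite adjmxM ch; split.
    by rewrite mulmxA -(mulmxA c (adjmx v) v) vab cab cc.
  by rewrite mulmxA -(mulmxA v c c) cc.
have [aE1 aE2] : dsum a b *m a' = a' /\ a' *m dsum a b = a'.
  by rewrite -abD mulmxDl mulmxDr ba0 ab0 !addr0 (aP').1.
have [bE1 bE2] : dsum a b *m b' = b' /\ b' *m dsum a b = b'.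
  by rewrite -abD mulmxDl mulmxDr ba0 ab0 !add0r (bP').1.
have [xP xcls] := compress a' aP' aE1 aE2.
have [dP dcls] := compress b' bP' bE1 bE2.
set X := v *m a' *m _ in xP xcls; set D := v *m b' *m _ in dP dcls.
have scal_proj (c : 'M[A]_1) : is_projmx c -> is_proj (c 0 0).
  move=> [cc ch]; apply/andP; split; apply/eqP.
    have := congr1 (fun M : 'M[A]_1 => M 0 0) cc.
    by rewrite {1}[c]mx11_scalar {2}[c]mx11_scalar mx11_mul mxE eqxx mulr1n.
  by have := congr1 (fun M : 'M[A]_1 => M 0 0) ch; rewrite adjmxE.
have XE : X = (X 0 0)%:M by rewrite {1}[X]mx11_scalar.
have DE : D = (D 0 0)%:M by rewrite {1}[D]mx11_scalar.
exists (X 0 0), (D 0 0); split; try exact: scal_proj.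
- have XD : X *m D = 0.
    rewrite /X /D !mulmxA -(mulmxA (v *m a') (adjmx v) v) vab -(mulmxA v a') aE2.
    by rewrite -(mulmxA v a' b') ab0 mulmx0 mul0mx.
  have := congr1 (fun M : 'M[A]_1 => M 0 0) XD.
  by rewrite {1}XE {1}DE mx11_mul !mxE eqxx mulr1n.
- have XD : X + D = y%:M.
    rewrite /X /D -mulmxDl -mulmxDr abD -vab -vy !mulmxA vy -mulmxA vy.
    by rewrite (yS).1.
  have := congr1 (fun M : 'M[A]_1 => M 0 0) XD.
  by rewrite !mxE eqxx mulr1n.
- rewrite /pcls -XE -DE xcls dcls /a' /b' !(K0_add K) ?cls0 ?addr0 ?add0r //;
  exact: projmx0.
Qed.

End K0Theory.

(** * Finiteness and equivalence of projections in the quotient *)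

Section QuotientK0.
Context {R : realType} (A Q : cstarAlgType R) (AF : AF_algebra A).
Context (J : set A) (pi : cstar_quotient J Q).

Lemma quot_AF : AF_algebra Q.
Proof.
have [F [Ffd Fincr Fdense]] := AF.
exists (fun n => pi @` F n)%classic; split.
- move=> n; have Fn := Ffd n; split.
  + by exists 1; [exact: (fd_one Fn) | rewrite rmorph1].
  + move=> _ _ [x Fx <-] [y Fy <-]; exists (x + y); last by rewrite rmorphD.
    exact: (fd_add Fn).
  + move=> c _ [x Fx <-]; exists (c *: x); last by rewrite linearZ.
    exact: (fd_scale Fn).
  + move=> _ _ [x Fx <-] [y Fy <-]; exists (x * y); last by rewrite rmorphM.
    exact: (fd_mul Fn).
  + move=> _ [x Fx <-]; exists (star x); last by rewrite cq_star.
    exact: (fd_star Fn).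
  + have [d [b bP]] := fd_dim Fn; exists d, (fun i => pi (b i)).
    move=> _ [x /bP[c ->] <-]; exists c; rewrite linear_sum.
    by apply: eq_bigr => i _; rewrite linearZ.
- by move=> n _ [x Fx <-]; exists x => //; exact: Fincr.
apply/seteqP; split=> // b _ e e0; have [a <-] := cq_surj pi b.
have : norm_closure (\bigcup_n F n)%classic a by rewrite Fdense.
move=> /(_ e e0)[y [n _ Fy] ay]; exists (pi y); first by exists n => //; exists y.
rewrite -rmorphB; apply: le_lt_trans ay; rewrite -[X in _ <= cnorm X]addr0.
by apply: cq_norm_le; apply/(cq_ker pi); rewrite rmorph0.
Qed.

Lemma AF_finite (v : Q) : AF_algebra Q -> star v * v = 1 -> v * star v = 1.
Proof.
move=> [F [Ffd Fincr Fdense]] v1.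
apply: (@isometry_unitary R Q (cstar_alg Q) (cstar_norm Q) F _ _ v v1).
- by move=> n; apply: fd_algebraic.
- move=> x e e0; have : norm_closure (\bigcup_n F n)%classic x by rewrite Fdense.
  by move=> /(_ e e0)[y [n _ Fy] xy]; exists n, y.
- move=> y /=; apply: (@pexpIrn _ 2) => //; rewrite ?nnegrE ?cnorm_ge0 //.
  by rewrite -!cnorm_starM starM mulrA -(mulrA (star y)) v1 mulr1.
Qed.

Context (V : zmodType) (G P : set V) (u : V) (cls : forall n, 'M[A]_n -> V).
Hypothesis K : K0_iso G P u cls.

Lemma quot_adjmx m n (x : 'M[A]_(m, n)) : adjmx (map_mx pi x) = map_mx pi (adjmx x).
Proof. by apply/matrixP => i j; rewrite !(adjmxE, mxE) cq_star. Qed.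

(** The hypothesis gives an equivalence of [x + b] with [y + a] as direct sums, where [a] and [b]
    have entries in [J]. Applying [pi] erases both, and the upper left entry of the image, cut down
    by [pi y] and [pi x], is the required [w]. *)
Lemma pcls_quot_equiv (x y : A) : is_proj x -> is_proj y ->
  K0_image cls J (pcls cls x - pcls cls y) ->
  exists w : Q, star w * w = pi x /\ w * star w = pi y.
Proof.
move=> xP yP [m [n [a [b [[aP aJ] [bP bJ] xy]]]]].
have xS := projmx_scalar xP; have yS := projmx_scalar yP.
have : cls (dsum (x%:M : 'M_1) b) = cls (dsum (y%:M : 'M_1) a).
  rewrite !(K0_add K) //; apply/eqP; rewrite -subr_eq0 opprD addrACA.
  by rewrite -/(pcls cls x) -/(pcls cls y) xy subrKA subrr.
move=> /(cls_eq AF K (projmx_dsum xS bP) (projmx_dsum yS aP))[v [vx vy]].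
have quot0 k (c : 'M[A]_k) : (forall i j, J (c i j)) -> map_mx pi c = 0.
  by move=> cJ; apply/matrixP => i j; rewrite !mxE; apply/(cq_ker pi).
have quot_dsum (z : A) k (c : 'M[A]_k) : (forall i j, J (c i j)) ->
    map_mx pi (dsum (z%:M : 'M_1) c) = block_mx ((pi z)%:M : 'M_1) 0 0 0.
  by move=> cJ; rewrite /dsum map_block_mx map_scalar_mx !map_mx0 quot0.
pose w : 'M[Q]_(1 + m, 1 + n) := map_mx pi v.
have wx : adjmx w *m w = block_mx ((pi x)%:M : 'M_1) 0 0 0.
  by rewrite quot_adjmx -map_mxM vx quot_dsum.
have wy : w *m adjmx w = block_mx ((pi y)%:M : 'M_1) 0 0 0.
  by rewrite quot_adjmx -map_mxM vy quot_dsum.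
have xPi := is_proj_quot pi (exist _ x xP); have yPi := is_proj_quot pi (exist _ y yP).
rewrite /= in xPi yPi.
move/andP: (xPi) => [/eqP xx /eqP xh]; move/andP: (yPi) => [/eqP yy /eqP yh].
have adj_block k l (w11 : 'M[Q]_(1, 1)) w12 w21 (w22 : 'M[Q]_(k, l)) :
    adjmx (block_mx w11 w12 w21 w22) =
    block_mx (adjmx w11) (adjmx w21) (adjmx w12) (adjmx w22).
  by rewrite {1}/adjmx tr_block_mx map_block_mx.
pose w00 := ulsubmx w 0 0.
have w00E : ulsubmx w = w00%:M by rewrite /w00 -mx11_scalar.
have Ex : star w00 * pi y * w00 = pi x.
  have : adjmx w *m (w *m adjmx w) *m w = adjmx w *m w.
    rewrite !mulmxA -mulmxA wx mulmx_block !(mulmx0, mul0mx, addr0) mx11_mul xx.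
    by [].
  rewrite wy wx -[w]submxK adj_block !mulmx_block !(mulmx0, mul0mx, addr0).
  move=> /(congr1 ulsubmx); rewrite !block_mxKul w00E adjmx_scalar !mx11_mul.
  by move=> /(congr1 (fun M : 'M[Q]_1 => M 0 0)); rewrite !mxE eqxx !mulr1n.
have Ey : w00 * pi x * star w00 = pi y.
  have : w *m (adjmx w *m w) *m adjmx w = w *m adjmx w.
    rewrite !mulmxA -mulmxA wy mulmx_block !(mulmx0, mul0mx, addr0) mx11_mul yy.
    by [].
  rewrite wx wy -[w]submxK adj_block !mulmx_block !(mulmx0, mul0mx, addr0).
  move=> /(congr1 ulsubmx); rewrite !block_mxKul w00E adjmx_scalar !mx11_mul.
  by move=> /(congr1 (fun M : 'M[Q]_1 => M 0 0)); rewrite !mxE eqxx !mulr1n.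
exists (pi y * w00 * pi x); rewrite !starM xh yh; split.
  have -> : pi x * (star w00 * pi y) * (pi y * w00 * pi x) =
      pi x * (star w00 * (pi y * pi y) * w00) * pi x by rewrite !mulrA.
  by rewrite yy Ex !xx.
have -> : pi y * w00 * pi x * (pi x * (star w00 * pi y)) =
    pi y * (w00 * (pi x * pi x) * star w00) * pi y by rewrite !mulrA.
by rewrite xx Ey !yy.
Qed.

Lemma ideal_K0_image (x : A) : is_proj x -> J x -> K0_image cls J (pcls cls x).
Proof.
move=> xP Jx; exists 1%N, 1%N, x%:M, 0.
have J0 : J 0 by apply/(cq_ker pi); rewrite rmorph0.
split; last by rewrite (cls0 K) subr0.
- split; first exact: projmx_scalar.
  by move=> i j; rewrite mxE !ord1 eqxx mulr1n.
- by split; [exact: projmx0 | move=> i j; rewrite mxE].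
Qed.

End QuotientK0.

(** * Germs at 0 of piecewise linear functions *)

Section Germs.
Context {R : realType}.
Local Notation I := (I01 R).
Implicit Types (f g : I -> R) (x : I).

Lemma I01_itv x : 0 <= val x <= 1.
Proof. by have := valP x; rewrite inE /= in_itv. Qed.

(** A retraction onto the unit interval: composing with it extends functions on [I01] to continuous
    functions on [R], where the intermediate value theorem applies. *)
Definition clamp (t : R) : R := Num.max 0 (Num.min t 1).

Lemma clamp_subproof t : clamp t \in (`[0%R, 1%R]%classic : set R).
Proof.
rewrite inE /= in_itv /= /clamp le_max lexx /= ge_max ler01 /=.
by rewrite ge_min lexx orbT.
Qed.

Definition clampI t : I := exist _ (clamp t) (clamp_subproof t).

Lemma clampI_val x : clampI (val x) = x.
Proof.
apply/val_inj => /=; rewrite /clamp; have /andP[x0 x1] := I01_itv x.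
by rewrite (min_idPl x1) (max_idPr x0).
Qed.

Lemma val_clampI t : 0 <= t <= 1 -> val (clampI t) = t.
Proof.
by case/andP => t0 t1; rewrite /= /clamp (min_idPl t1) (max_idPr t0).
Qed.

Lemma continuous_idR : continuous (@id R).
Proof. by move=> t; exact: cvg_id. Qed.

Lemma continuous_mulR (f g : R -> R) :
  continuous f -> continuous g -> continuous (fun t => f t * g t).
Proof. by move=> fc gc t; exact: continuousM (fc t) (gc t). Qed.

Lemma continuous_subR (f g : R -> R) :
  continuous f -> continuous g -> continuous (fun t => f t - g t).
Proof. by move=> fc gc t; exact: continuousB (fc t) (gc t). Qed.

Lemma continuous_normR (f : R -> R) :
  continuous f -> continuous (fun t => `|f t|).
Proof. by move=> fc t; exact: cvg_norm (fc t). Qed.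

Lemma continuous_clamp : continuous clamp.
Proof.
move=> t; apply: (@continuous_max R R (fun=> 0) (fun t => Num.min t 1)).
  exact: cst_continuous.
by apply: (@continuous_min R R id (fun=> 1)); [exact: continuous_idR|exact: cst_continuous].
Qed.

Lemma continuous_clampI : continuous (clampI : R -> I).
Proof. by apply: continuous_comp_initial; exact: continuous_clamp. Qed.

Lemma continuous_ext f : continuous f -> continuous (fun t => f (clampI t)).
Proof.
by move=> fc t; apply: continuous_comp; [exact: continuous_clampI | exact: fc].
Qed.

Definition line (ab : int * int) (t : R) : R := ab.1%:~R + ab.2%:~R * t.

Definition germ f (a b : int) :=
  exists2 d : R, 0 < d & forall x, val x < d -> f x = a%:~R + b%:~R * val x.

Lemma continuous_line ab : continuous (line ab).
Proof.
move=> t; apply: continuousD; first exact: cst_continuous.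
by apply: continuousM; [exact: cst_continuous | exact: continuous_idR].
Qed.

(** If two of the lines meet at [t], their constants differ by an integer equal to [t] times a slope
    difference. Below [1 / (K + 1)], with [K] bounding all slope differences, that integer is 0, and
    the slopes agree too. *)
Lemma lines_apart (s : seq (int * int)) : exists2 d : R, 0 < d &
  forall p q t, p \in s -> q \in s -> 0 < t -> t < d -> line p t = line q t -> p = q.
Proof.
pose K : R := \sum_(p <- s) \sum_(q <- s) `|p.2 - q.2|%:~R.
have K0 : 0 <= K.
  by apply: sumr_ge0 => p _; apply: sumr_ge0 => q _; rewrite ler0z.
have Kpq p q : p \in s -> q \in s -> `|p.2%:~R - q.2%:~R| <= K.
  move=> ps qs; rewrite -intrB -intr_norm /K (big_rem p ps) /= (big_rem q qs) /=.
  rewrite -addrA lerDl addr_ge0 //.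
    by apply: sumr_ge0 => r _; rewrite ler0z.
  by apply: sumr_ge0 => r _; apply: sumr_ge0 => r' _; rewrite ler0z.
exists (K + 1)^-1; first by rewrite invr_gt0; lra.
move=> [a b] [c e] t ps qs t0 td; rewrite /line /= => E.
have D : (a - c)%:~R = (e%:~R - b%:~R) * t :> R by rewrite intrB; lra.
have be : `|(a - c)%:~R : R| < 1.
  rewrite D normrM (gtr0_norm t0) distrC.
  have := Kpq _ _ ps qs => /= H.
  have tK : t * (K + 1) < 1 by rewrite -ltr_pdivlMr ?div1r //; lra.
  by have := normr_ge0 (b%:~R - e%:~R : R); nra.
have ac : a = c.
  apply/eqP; rewrite -subr_eq0 -normr_le0.
  by move: be; rewrite -intr_norm -[1]/(1%:~R) ltr_int; lia.
congr (_, _) => //; apply/eqP; rewrite eq_sym -(eqr_int R) -subr_eq0.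
move: D; rewrite ac subrr => /esym/eqP; rewrite mulf_eq0 => /orP[//|].
by rewrite gt_eqF.
Qed.

Lemma M1_germ f : M1 f -> exists a b, germ f a b.
Proof.
move=> [fc [s fs]]; have [d d0 sd] := lines_apart s.
pose h t := f (clampI t); have hc := continuous_ext fc.
pose d1 := Num.min d 1; have d10 : 0 < d1 by rewrite lt_min d0 ltr01.
have hs t : 0 <= t <= 1 -> exists2 ab, ab \in s & h t = line ab t.
  by move=> /val_clampI t01; have [ab abs E] := fs (clampI t); exists ab; rewrite // /h E t01.
have t1P : 0 <= d1 / 2 <= 1.
  by have : d1 <= 1 by [rewrite ge_min lexx orbT]; lra.
have [ab abs hab] := hs _ t1P.
(* On the open interval from 0 to [d1], exactly one of [w] and [h - line ab] vanishes at each point.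
   So [k] below never vanishes there, and it is positive at [d1 / 2]; by the intermediate value
   theorem it cannot become negative. *)
pose w t := \prod_(q <- s | q != ab) (h t - line q t).
have wc : continuous w.
  rewrite /w; elim: (s) => [|q r IH].
    by under eq_fun do rewrite big_nil; exact: cst_continuous.
  have [qab|qab] := boolP (q != ab).
    under eq_fun do rewrite big_cons qab.
    apply: continuous_mulR IH; apply: continuous_subR => //.
    exact: continuous_line.
  by under eq_fun do rewrite big_cons (negbTE qab); exact: IH.
pose k t := `|w t| - `|h t - line ab t|.
have kc : continuous k.
  apply: continuous_subR; apply: continuous_normR => //.
  by apply: continuous_subR => //; exact: continuous_line.
have w0 t : 0 < t -> t < d1 -> h t = line ab t -> w t != 0.
  move=> t0 td ht; rewrite /w prodf_seq_neq0; apply/allP => q qs /=.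
  apply/implyP => qab; rewrite ht subr_eq0; apply: contra_neq qab => E.
  by apply/esym/(sd _ _ t) => //; apply: lt_le_trans td _; rewrite ge_min lexx.
have d1d : d1 <= d by rewrite ge_min lexx.
have d11 : d1 <= 1 by rewrite ge_min lexx orbT.
have dich t : 0 < t -> t < d1 -> h t = line ab t \/ (w t = 0 /\ h t != line ab t).
  move=> t0 td; have [ht|ht] := eqVneq (h t) (line ab t); [by left | right; split=> //].
  have [q qs hq] : exists2 q, q \in s & h t = line q t by apply: hs; lra.
  apply/eqP; rewrite /w prodf_seq_eq0; apply/hasP; exists q => //=.
  rewrite hq subrr eqxx andbT; apply: contraNneq ht => qab; by rewrite hq qab.
have kpos : 0 < k (d1 / 2).
  by rewrite /k hab subrr normr0 subr0 normr_gt0; apply: w0 => //; lra.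
have hab_all t : 0 < t -> t < d1 -> h t = line ab t.
  move=> t0 td; case: (dich t t0 td) => // -[wt0 hne].
  have kneg : k t < 0.
    by rewrite /k wt0 normr0 sub0r oppr_lt0 normr_gt0 subr_eq0.
  have [c c01 kc0] : exists2 c, 0 < c < d1 & k c = 0.
    have [le|le] := lerP t (d1 / 2).
      have [||c] := @IVT R k t (d1 / 2) 0 le.
      - exact: continuous_subspaceT.
      - by rewrite ge_min le_max (ltW kneg) (ltW kpos) orbT.
      by rewrite in_itv /= => /andP[c1 c2] kc0; exists c => //; lra.
    have [||c] := @IVT R k (d1 / 2) t 0 (ltW le).
    - exact: continuous_subspaceT.
    - by rewrite ge_min le_max (ltW kneg) (ltW kpos) orbT.
    by rewrite in_itv /= => /andP[c1 c2] kc0; exists c => //; lra.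
  case/andP: c01 => c0 cd; case: (dich c c0 cd) => [hc0|[wc0 hc0]].
    by have := w0 c c0 cd hc0; move/eqP: kc0; rewrite /k hc0 subrr normr0 subr0 normr_eq0 => /eqP ->; rewrite eqxx.
  by move/eqP: kc0; rewrite /k wc0 normr0 sub0r oppr_eq0 normr_eq0 subr_eq0 (negbTE hc0).
(* A jump at 0 would make the distance to the line skip the value halfway between its value at 0 and
   0. *)
have h0 : h 0 = line ab 0.
  apply/eqP; rewrite -subr_eq0 -normr_le0 leNgt; apply/negP => hpos.
  pose k' t := `|h t - line ab t|.
  have k'c : continuous k'.
    by apply/continuous_normR/continuous_subR => //; exact: continuous_line.
  have k'd : k' (d1 / 2) = 0 by rewrite /k' hab subrr normr0.
  have [||c] := @IVT R k' 0 (d1 / 2) (k' 0 / 2) (proj1 (andP t1P)).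
  - exact: continuous_subspaceT.
  - rewrite k'd ge_min le_max; rewrite -/(k' 0) in hpos.
    by apply/andP; split; apply/orP; [right | left]; lra.
  rewrite in_itv /= => /andP[c1 c2] kc0; rewrite -/(k' 0) in hpos.
  move: c1; rewrite le_eqVlt => /orP[/eqP c0|c0].
    by move: kc0; rewrite -c0; lra.
  move: kc0; rewrite {1}/k' hab_all //; last by lra.
  by rewrite subrr normr0; lra.
exists ab.1, ab.2, d1 => // x xd; have /andP[x0 _] := I01_itv x.
rewrite -{1}(clampI_val x) -/(h (val x)).
move: x0; rewrite le_eqVlt => /orP[/eqP <- //|x0]; exact: hab_all.
Qed.


Lemma germ_uniq f a b a' b' : germ f a b -> germ f a' b' -> a = a' /\ b = b'.
Proof.
move=> [d d0 fd] [d' d0' fd'].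
have [e e0 H] := lines_apart [:: (a, b); (a', b')].
pose t := Num.min (Num.min d d') (Num.min e 1) / 2.
have m0 : 0 < Num.min (Num.min d d') (Num.min e 1) by rewrite !lt_min d0 d0' e0 ltr01.
have le1 : Num.min (Num.min d d') (Num.min e 1) <= Num.min d d' by rewrite ge_min lexx.
have le2 : Num.min (Num.min d d') (Num.min e 1) <= Num.min e 1 by rewrite ge_min lexx orbT.
have [l1 l2] : Num.min d d' <= d /\ Num.min d d' <= d'.
  by rewrite !ge_min !lexx orbT.
have [l3 l4] : Num.min e 1 <= e /\ Num.min e 1 <= 1 by rewrite !ge_min !lexx orbT.
have t01 : 0 <= t <= 1 by rewrite /t; lra.
have tE := val_clampI t01.
have E : (a, b) = (a', b').
  apply: (H _ _ t); rewrite ?inE ?eqxx ?orbT //; try by rewrite /t; lra.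
  rewrite /line /= -[t in LHS]tE -[t in RHS]tE -fd -?fd' // tE /t; lra.
by case: E.
Qed.

Lemma germD f g a b a' b' : germ f a b -> germ g a' b' ->
  germ (f + g) (a + a') (b + b').
Proof.
move=> [d d0 fd] [d' d0' fd']; exists (Num.min d d'); first by rewrite lt_min d0.
move=> x; rewrite lt_min => /andP[xd xd'].
have -> : (f + g) x = f x + g x by [].
by rewrite fd // fd' // !intrD; ring.
Qed.

Lemma germN f a b : germ f a b -> germ (- f) (- a) (- b).
Proof.
move=> [d d0 fd]; exists d => // x xd.
have -> : (- f) x = - f x by [].
by rewrite fd // !rmorphN /=; ring.
Qed.

Lemma germB f g a b a' b' : germ f a b -> germ g a' b' ->
  germ (f - g) (a - a') (b - b').
Proof. by move=> fg gg; apply: germD => //; apply: germN. Qed.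

Definition lex_le (a b a' b' : int) := (a < a') || (a == a') && (b <= b').

(** Distinct integer values at 0 differ by at least 1, a gap that the slopes cannot close for
    arguments below [1 / K]. *)
Lemma germ_lex f g a b a' b' : germ f a b -> germ g a' b' -> lex_le a b a' b' ->
  exists2 d : R, 0 < d & forall x, val x < d -> f x <= g x.
Proof.
move=> [d d0 fd] [d' d0' fd'] ab.
pose K : R := `|b%:~R| + `|b'%:~R| + 1.
have K0 : 0 < K by rewrite /K; have := normr_ge0 (b%:~R : R); have := normr_ge0 (b'%:~R : R); lra.
exists (Num.min (Num.min d d') K^-1); first by rewrite !lt_min d0 d0' invr_gt0.
move=> x; rewrite !lt_min => /andP[/andP[xd xd'] xK].
rewrite fd // fd' //; have /andP[x0 _] := I01_itv x.
case/orP: ab => [aa'|/andP[/eqP <- bb']]; last first.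
  by rewrite lerD2l ler_wpM2r // ler_int.
have : (a + 1)%:~R <= a'%:~R :> R by rewrite ler_int; lia.
rewrite intrD => H.
have xK1 : val x * K < 1 by rewrite -ltr_pdivlMr // div1r.
have := ler_norm (b%:~R : R); have := ler_norm (- (b'%:~R : R)); rewrite normrN.
rewrite /K in xK1 *; set B := `|b%:~R : R| in xK1 *; set B' := `|b'%:~R : R| in xK1 *.
by nra.
Qed.

Lemma germ_min f g a b a' b' : germ f a b -> germ g a' b' -> lex_le a b a' b' ->
  germ (fun x => Num.min (f x) (g x)) a b.
Proof.
move=> fG gG ab; have [d d0 fg] := germ_lex fG gG ab; have [d' d0' fd] := fG.
exists (Num.min d d'); first by rewrite lt_min d0.
by move=> x; rewrite lt_min => /andP[xd xd']; rewrite (min_idPl (fg x xd)) fd.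
Qed.

Lemma M1_min f g : M1 f -> M1 g -> M1 (fun x => Num.min (f x) (g x)).
Proof.
move=> [fc [s fs]] [gc [s' gs]]; split.
  by move=> x; exact: continuous_min (fc x) (gc x).
exists (s ++ s') => x; have [p ps fx] := fs x; have [q qs gx] := gs x.
have [fg|gf] := lerP (f x) (g x).
  by exists p; rewrite // mem_cat ps.
by exists q; rewrite // mem_cat qs orbT.
Qed.

Lemma M1_maxB f g : M1 f -> M1 g -> M1 (fun x => Num.max (g x - f x) 0).
Proof.
move=> [fc [s fs]] [gc [s' gs]]; split.
  move=> x; apply: (@continuous_max R I (g - f) (fun=> 0)); last exact: cst_continuous.
  exact: continuousB (gc x) (fc x).
exists ((0, 0) :: [seq (p.1 - q.1, p.2 - q.2) | p <- s', q <- s]) => x.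
have [p ps fx] := fs x; have [q qs gx] := gs x.
have [gf|fg] := lerP (g x - f x) 0.
  by exists (0, 0); rewrite ?inE ?eqxx // mul0r addr0.
exists (q.1 - p.1, q.2 - p.2).
  by rewrite inE; apply/orP; right; apply/allpairsP; exists (q, p).
by rewrite gx fx /= !intrB; ring.
Qed.

Lemma M1B f g : M1 f -> M1 g -> M1 (f - g).
Proof.
move=> [fc [s fs]] [gc [s' gs]]; split.
  by move=> x; exact: continuousB (fc x) (gc x).
exists [seq (p.1 - q.1, p.2 - q.2) | p <- s, q <- s'] => x.
have [p ps fx] := fs x; have [q qs gx] := gs x.
exists (p.1 - q.1, p.2 - q.2); first by apply/allpairsP; exists (p, q).
have -> : (f - g) x = f x - g x by [].
by rewrite gx fx /= !intrB; ring.
Qed.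

Lemma clampI0 : clampI 0 = I01_0 R.
Proof. by apply/val_inj; rewrite val_clampI // lexx ler01. Qed.

(** The difference quotient of a germ [a + b x] is the constant [b]. An integer smaller than 1 in
    absolute value is 0. *)
Lemma J0plus_germ f : M1 f -> J0plus f <-> germ f 0 0.
Proof.
move=> fM; split.
  move=> [_ f0 fq]; have [a [b fG]] := M1_germ fM; have [d d0 fd] := fG.
  have a0 : a = 0.
    by move: f0; rewrite fd //= mulr0 addr0 => /eqP; rewrite intr_eq0 => /eqP.
  suff b0 : b = 0 by rewrite a0 b0 in fG.
  apply/eqP/negP => /negP b0.
  have /cvgrPdist_lt /(_ 1 ltr01) := fq.
  rewrite /dnbhs /within /= => H.
  (* The punctured neighbourhood in [I01] is pulled back to [R], where a small positive [t] can be
     chosen explicitly. *)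
  have := @continuous_clampI 0; rewrite /continuous_at clampI0 => /(_ _ H).
  move=> /nbhs_ballP[e /= e0 He].
  pose t := Num.min e (Num.min d 1) / 2.
  have m0 : 0 < Num.min e (Num.min d 1) by rewrite !lt_min e0 d0 ltr01.
  have le1 : Num.min e (Num.min d 1) <= e by rewrite ge_min lexx.
  have le2 : Num.min e (Num.min d 1) <= d by rewrite !ge_min lexx orbT.
  have le3 : Num.min e (Num.min d 1) <= 1 by rewrite !ge_min lexx !orbT.
  have t0 : 0 < t by rewrite /t; lra.
  have t01 : 0 <= t <= 1 by rewrite /t; lra.
  have tE := val_clampI t01.
  have td : val (clampI t) < d by rewrite tE /t; lra.
  have : ball (0 : R) e t.
    by rewrite /ball /= sub0r normrN gtr0_norm // /t; lra.
  have ne : clampI t != I01_0 R.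
    apply/eqP => /(congr1 val); rewrite tE /= => t00.
    by rewrite t00 ltxx in t0.
  move=> /He /(_ ne) Ht.
  have : `|0 - (f (clampI t) - f (I01_0 R)) / val (clampI t)| < 1 := Ht.
  rewrite f0 fd // a0 tE sub0r normrN subr0 mulr0z add0r mulfK ?gt_eqF // -intr_norm.
  by rewrite -[1]/(1%:~R) ltr_int ltNge -gtz0_ge1 normr_gt0 b0.
move=> [d d0 fd]; have f0 : f (I01_0 R) = 0 by rewrite fd //= mul0r addr0.
split=> //; apply/cvgrPdist_lt => e e0.
have vc : continuous (val : I -> R) by exact: initial_continuous.
have : nbhs (I01_0 R) ((val : I -> R) @^-1` (fun y => y < d))%classic.
  apply: vc; apply/nbhs_ballP; exists d => // y /=.
  rewrite /ball /= sub0r normrN; exact/le_lt_trans/ler_norm.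
move=> /nbhs_dnbhs; apply: filterS => x xd.
by rewrite fd // f0 mul0r addr0 subrr mul0r subrr normr0.
Qed.

End Germs.

(** * Evaluation of formulas in Chang's algebra *)

(* Elements of Chang's MV-algebra, the unit interval of Z x_lex Z: (false, n)
   stands for (0, n) and (true, n) for (1, -n). *)
Definition chang := (bool * nat)%type.

(** Addition of the lexicographic group followed by the meet with the unit [(1, 0)]: truncation of
    natural subtraction performs that meet. *)
Definition chang_plus (v w : chang) : chang :=
  match v.1, w.1 with
  | false, false => (false, v.2 + w.2)%N
  | false, true => (true, w.2 - v.2)%N
  | true, false => (true, v.2 - w.2)%N
  | true, true => (true, 0%N)
  end.

Definition chang_star (v : chang) : chang := (~~ v.1, v.2).

Fixpoint chang_eval (x : chang) (phi : formula) : chang :=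
  match phi with
  | FZero => (false, 0%N)
  | FX => x
  | FStar a => chang_star (chang_eval x a)
  | FPlus a b => chang_plus (chang_eval x a) (chang_eval x b)
  end.

Definition chang_fst (v : chang) : int := if v.1 then 1 else 0.
Definition chang_snd (v : chang) : int := if v.1 then - v.2%:Z else v.2%:Z.

Definition chang_le (v w : chang) :=
  lex_le (chang_fst v) (chang_snd v) (chang_fst w) (chang_snd w).

Lemma chang_le_total v w : chang_le v w || chang_le w v.
Proof.
by case: v w => [[] n] [[] m]; rewrite /chang_le /lex_le /chang_fst /chang_snd /=; lia.
Qed.

Lemma chang_inj v w : chang_fst v = chang_fst w -> chang_snd v = chang_snd w -> v = w.
Proof.
case: v w => [[] n] [[] m]; rewrite /chang_fst /chang_snd //=.
  by move=> _ /oppr_inj [->].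
by move=> _ [->].
Qed.

Lemma chang_plus_le v w : chang_le w (chang_star v) ->
  chang_fst (chang_plus v w) = chang_fst v + chang_fst w /\
  chang_snd (chang_plus v w) = chang_snd v + chang_snd w.
Proof.
case: v w => [[] n] [[] m];
  by rewrite /chang_le /lex_le /chang_plus /chang_star /chang_fst /chang_snd /=; lia.
Qed.

Lemma chang_plus_ge v w : ~~ chang_le w (chang_star v) -> chang_plus v w = (true, 0%N).
Proof.
case: v w => [[] n] [[] m];
  rewrite /chang_le /lex_le /chang_plus /chang_star /chang_fst /chang_snd /=;
  by [|lia|move=> H; congr (_, _); lia].
Qed.

Lemma mvn_classP (R : realType) (A : cstarAlgType R) (p q : projection A) :
  mvn_class p = mvn_class q <-> exists v : A, star v * v = val p /\ v * star v = val q.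
Proof.
split; first by move=> /eqmodP /asboolP.
by move=> H; apply/eqmodP/asboolP.
Qed.

(** * Classes in the quotient as elements of Chang's algebra *)

Section Chang.
Context (R : realType) (A Q : cstarAlgType R) (AF : AF_algebra A).
Context (cls : forall n, 'M[A]_n -> (I01 R -> R)).
Hypothesis K : K0_iso (@M1 R) (@M1_pos R) (fun _ => 1) cls.
Context (J : set A) (JK : K0_image cls J = @J0plus R).
Context (pi : cstar_quotient J Q) (E : elliottMonoid Q).
Implicit Types (x y d : A) (v w : chang).

Definition has_val x v :=
  is_proj x /\ germ (pcls cls x) (chang_fst v) (chang_snd v).

Lemma is_projB1 x : is_proj x -> is_proj (1 - x).
Proof. by move=> xP; exact: (is_projC (exist _ x xP)). Qed.

Lemma proj_mulB1 x : is_proj x -> x * (1 - x) = 0 /\ (1 - x) * x = 0.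
Proof.
by case/andP => /eqP xx _; rewrite mulrBr mulrBl mulr1 mul1r xx subrr.
Qed.

Lemma pclsB1 x : is_proj x -> pcls cls (1 - x) = (fun _ => 1) - pcls cls x.
Proof.
move=> xP; have [xx _] := proj_mulB1 xP.
apply/eqP; rewrite eq_sym subr_eq; apply/eqP.
rewrite addrC -(pclsD K xP (is_projB1 xP) xx) addrC subrK.
by rewrite (pcls1 K).
Qed.

Lemma germ1 : germ (fun _ : I01 R => 1 : R) 1 0.
Proof. by exists 1 => // x _; rewrite mul0r addr0. Qed.

Lemma has_val1 : has_val 1 (true, 0%N).
Proof.
split; first by rewrite /is_proj mulr1 star1 !eqxx.
by rewrite (pcls1 K) /chang_fst /chang_snd /=; exact: germ1.
Qed.

Lemma has_val0 : has_val 0 (false, 0%N).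
Proof.
split; first exact: is_proj0.
by rewrite (pcls0 K); exists 1 => // x _; rewrite mul0r addr0.
Qed.

Lemma has_valC x v : has_val x v -> has_val (1 - x) (chang_star v).
Proof.
move=> [xP xG]; split; first exact: is_projB1.
rewrite pclsB1 //; have := germB germ1 xG.
by case: v {xG} => [[] n]; rewrite /chang_fst /chang_snd /= ?subrr ?subr0 ?sub0r ?opprK.
Qed.

(** The class of a projection is a function between 0 and 1: its value at 0 is an integer, hence 0
    or 1, and the bound attained there fixes the sign of the slope. *)
Lemma has_val_ex x : is_proj x -> exists v, has_val x v.
Proof.
move=> xP; have [fM f0] := pcls_pos K xP.
have [_] := pcls_pos K (is_projB1 xP); rewrite pclsB1 // => f1.
have [a [b fG]] := M1_germ fM; have [e e0 fe] := fG.
set f := pcls cls x in fM f0 f1 fG fe.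
have {}f1 t : f t <= 1.
  by have : 0 <= 1 - f t := f1 t; rewrite subr_ge0.
pose t := clampI (R := R) (Num.min e 1 / 2).
have m0 : 0 < Num.min e 1 by rewrite lt_min e0 ltr01.
have [l1 l2] : Num.min e 1 <= e /\ Num.min e 1 <= 1 by rewrite !ge_min !lexx orbT.
have tE : val t = Num.min e 1 / 2 by apply: val_clampI; lra.
have te : val t < e by rewrite tE; lra.
have t0 : 0 < val t by rewrite tE; lra.
have f00 : f (I01_0 R) = a%:~R by rewrite fe //= mulr0 addr0.
have a01 : (0 <= a) && (a <= 1).
  by rewrite -!(ler_int R) -f00 (f0 _) (f1 _).
have [a0|a1] : a = 0 \/ a = 1 by lia.
  have b0 : 0 <= b.
    have := f0 t; rewrite fe // a0 add0r pmulr_lge0 // ler0z //.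
  exists (false, `|b|%N); split=> //.
  by rewrite a0 in fG; rewrite /chang_fst /chang_snd /= gez0_abs.
have b0 : b <= 0.
  by have := f1 t; rewrite fe // a1 gerDl pmulr_lle0 // lerz0.
exists (true, `|b|%N); split=> //.
by rewrite a1 in fG; rewrite /chang_fst /chang_snd /= lez0_abs // opprK.
Qed.

Definition qcls x (xP : is_proj x) : elliott Q :=
  mvn_class (proj_quot pi (exist _ x xP)).

Lemma qcls_eq x y v (xP : is_proj x) (yP : is_proj y) :
  has_val x v -> has_val y v -> qcls xP = qcls yP.
Proof.
move=> [_ xG] [_ yG]; apply/mvn_classP; apply: (pcls_quot_equiv AF pi K xP yP).
rewrite JK; have [xM _] := pcls_pos K xP; have [yM _] := pcls_pos K yP.
have G := germB xG yG; rewrite !subrr in G.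
by apply/(J0plus_germ _).2 => //; exact: M1B.
Qed.

(** Decompose the class [g] of [y] as the minimum of [f] and [g] plus the positive part of [g - f].
    Only germs are compared, so [f <= g] may fail away from 0; near 0 the minimum is [f]. *)
Lemma split_le x y v w : has_val x v -> has_val y w -> chang_le v w ->
  exists x' d, [/\ is_proj d, x' * d = 0, y = x' + d, has_val x' v &
    germ (pcls cls d) (chang_fst w - chang_fst v) (chang_snd w - chang_snd v)].
Proof.
move=> [xP xG] [yP yG] vw; set f := pcls cls x in xG; set g := pcls cls y in yG.
have [fM f0] := pcls_pos K xP; have [gM g0] := pcls_pos K yP.
pose mn : I01 R -> R := fun t => Num.min (f t) (g t).
pose mx : I01 R -> R := fun t => Num.max (g t - f t) 0.
have mn0 : M1_pos mn by move=> t; rewrite /mn le_min (f0 t) (g0 t).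
have mx0 : M1_pos mx by move=> t; rewrite /mx le_max lexx orbT.
have gE : g = mn + mx.
  apply/funext => t; have -> : (mn + mx) t = mn t + mx t by [].
  rewrite /mn /mx; have [fg|gf] := lerP (f t) (g t).
    by rewrite (max_idPl _) ?subr_ge0 // addrC subrK.
  by rewrite (max_idPr _) ?addr0 // subr_le0 ltW.
have [x' [d [x'P dP xd yE [x'E dE]]]] :=
  pcls_split AF K yP (M1_min fM gM) mn0 (M1_maxB fM gM) mx0 gE.
have x'G : germ (pcls cls x') (chang_fst v) (chang_snd v).
  by rewrite x'E; exact: germ_min vw.
exists x', d; split=> //.
have -> : pcls cls d = g - pcls cls x'.
  by rewrite /g yE (pclsD K x'P dP xd) addrC addKr.
exact: germB.
Qed.

(** Adding [1 - q] to the partial isometry gives an isometry of the whole algebra, which is unitary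
    by finiteness. *)
Lemma quot_finite_corner (p q : Q) : is_proj p -> is_proj q -> p * q = p ->
  (exists v : Q, star v * v = q /\ v * star v = p) -> p = q.
Proof.
move=> /andP[/eqP pp /eqP ph] /andP[/eqP qq /eqP qh] pq [s [sq sp]].
have qp : q * p = p by rewrite -ph -qh -starM pq.
pose v := p * s * q.
have vq : star v * v = q.
  rewrite /v !starM ph qh.
  have -> : q * (star s * p) * (p * s * q) = q * (star s * (p * p) * s) * q by rewrite !mulrA.
  by rewrite pp -sp !mulrA -(mulrA q) sq qq -(mulrA q) sq qq qq.
have vp : v * star v = p.
  rewrite /v !starM ph qh.
  have -> : p * s * q * (q * (star s * p)) = p * (s * (q * q) * star s) * p by rewrite !mulrA.
  by rewrite qq -sq !mulrA -(mulrA p) sp pp -(mulrA p) sp pp pp.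
have vqE : v * q = v by rewrite /v -mulrA qq.
have qv : q * v = v by rewrite /v !mulrA qp.
have qsv : q * star v = star v by rewrite -{1}qh -starM vqE.
have svq : star v * q = star v by rewrite -{1}qh -starM qv.
have [c cE] : exists c, c = 1 - q by eexists.
have ch : star c = c by rewrite cE starD starN star1 qh.
have vc : v * c = 0 by rewrite cE mulrBr mulr1 vqE subrr.
have cv : c * v = 0 by rewrite cE mulrBl mul1r qv subrr.
have svc : star v * c = 0 by rewrite cE mulrBr mulr1 svq subrr.
have csv : c * star v = 0 by rewrite cE mulrBl mul1r qsv subrr.
have cc : c * c = c by rewrite cE mulrBl mul1r mulrBr mulr1 qq subrr subr0.
have W1 : star (v + c) * (v + c) = 1.
  rewrite starD ch mulrDl !mulrDr vq svc cv cc addr0 add0r.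
  by rewrite cE addrC subrK.
have := AF_finite (quot_AF AF pi) W1.
rewrite starD ch mulrDl !mulrDr vp vc csv cc addr0 add0r cE.
move=> H; apply/eqP; rewrite -subr_eq0; apply/eqP.
by apply: (addrI 1); rewrite addr0 -[RHS]H addrCA.
Qed.

(** If [v <= w], some [x'] of value [v] lies below [y]. Equal classes and finiteness force
    [pi x' = pi y], so the difference [d] lies in [J] and its germ [w - v] is zero. *)
Lemma qcls_inj x y v w (xP : is_proj x) (yP : is_proj y) :
  has_val x v -> has_val y w -> qcls xP = qcls yP -> v = w.
Proof.
wlog vw : x y v w xP yP / chang_le v w => [W xv yw xy|xv yw xy].
  case/orP: (chang_le_total v w) => H; first exact: (W x y v w xP yP).
  by symmetry; apply: (W y x w v yP xP).
have [x' [d [dP xd yE x'v dG]]] := split_le xv yw vw.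
have x'P := x'v.1; have := qcls_eq x'P xP x'v xv; rewrite xy.
move=> /esym/mvn_classP /= [s sE].
have x'x' : x' * x' = x' by case/andP: x'P => /eqP.
have : pi x' = pi y.
  apply: quot_finite_corner; last by exists s.
  - exact: (is_proj_quot pi (exist _ x' x'P)).
  - exact: (is_proj_quot pi (exist _ y yP)).
  - by rewrite -rmorphM yE mulrDr x'x' xd addr0.
rewrite yE rmorphD -[LHS]addr0 => /addrI /esym /(cq_ker pi) dJ.
have := ideal_K0_image pi K dP dJ; rewrite JK => dJ0.
have [dM _] := pcls_pos K dP.
have := (J0plus_germ dM).1 dJ0 => /(germ_uniq dG)[/eqP + /eqP +].
rewrite !subr_eq0 => /eqP E1 /eqP E2.
by apply: chang_inj.
Qed.

Lemma proj_quotC x (xP : is_proj x) :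
  projC (proj_quot pi (exist _ x xP)) = proj_quot pi (exist _ (1 - x) (is_projB1 xP)).
Proof. by apply/val_inj; rewrite /= rmorphB rmorph1. Qed.

Lemma estar_qcls x (xP : is_proj x) : estar E (qcls xP) = qcls (is_projB1 xP).
Proof. by rewrite /qcls estarE proj_quotC. Qed.

Lemma eplus_qcls x y z (xP : is_proj x) (yP : is_proj y) (zP : is_proj z) :
  x * y = 0 -> z = x + y -> eplus E (qcls xP) (qcls yP) = qcls zP.
Proof.
by move=> xy zE; apply: eplusE => /=; rewrite -?rmorphM ?xy ?rmorph0 // zE rmorphD.
Qed.

Lemma mvn_le_one (a : elliott Q) (oP : is_proj (1 : A)) :
  mvn_le (qcls oP) a -> a = qcls oP.
Proof.
move=> [p [q [pE -> pq]]]; rewrite pE.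
have /mvn_classP[v /= [v1 vp]] := pE; rewrite rmorph1 in v1.
have p1 : val p = 1 := etrans (esym vp) (AF_finite (quot_AF AF pi) v1).
congr mvn_class; apply/val_inj; rewrite p1.
by have := pq; rewrite p1 mul1r.
Qed.

(** If [w] is below the complement of [v], then [y] can be replaced by a projection orthogonal to
    [x], and Elliott's partial addition applies. Otherwise [[1 - x] <= [y]], and monotonicity
    squeezes the sum up to [[1 - x] + [x] = [1]]. *)
Lemma eplus_val x y v w (xP : is_proj x) (yP : is_proj y) :
  has_val x v -> has_val y w -> exists z (zP : is_proj z),
    has_val z (chang_plus v w) /\ eplus E (qcls xP) (qcls yP) = qcls zP.
Proof.
move=> xv yw; have xCv := has_valC xv; have xCP := is_projB1 xP.
have [le|nle] := boolP (chang_le w (chang_star v)).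
  have [y' [d [dP yd xCE y'w _]]] := split_le yw xCv le.
  have y'P := y'w.1.
  have [/eqP y'y' /eqP y'h] := andP y'P; have [_ /eqP dh] := andP dP.
  have dy : d * y' = 0 by rewrite -y'h -dh -starM yd star0.
  have xy' : x * y' = 0.
    have -> : x = 1 - (y' + d) by rewrite -xCE opprB addrC subrK.
    by rewrite mulrBl mul1r mulrDl y'y' dy addr0 subrr.
  have zP := is_projD xP y'P xy'.
  exists (x + y'), zP; split.
    split=> //; rewrite (pclsD K xP y'P xy').
    have [-> ->] := chang_plus_le le.
    by apply: germD; [case: xv | case: y'w].
  by rewrite (qcls_eq yP y'P yw y'w); apply: eplus_qcls.
rewrite (chang_plus_ge nle); have oP := has_val1.1.
exists 1, oP; split; first exact: has_val1.
have le : chang_le (chang_star v) w.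
  by have := chang_le_total w (chang_star v); rewrite (negbTE nle).
have [x' [d [dP xd yE x'v _]]] := split_le xCv yw le.
have x'P := x'v.1; have [/eqP x'x' _] := andP x'P.
rewrite eplusC; apply: mvn_le_one.
have <- : eplus E (qcls xCP) (qcls xP) = qcls oP.
  apply: eplus_qcls; last by rewrite subrK.
  by have [] := proj_mulB1 xP.
apply: eplus_mono; exists (proj_quot pi (exist _ x' x'P)), (proj_quot pi (exist _ y yP)).
split=> //=; first exact: qcls_eq xCv x'v.
by rewrite -rmorphM yE mulrDr x'x' xd addr0.
Qed.

Lemma code_val p v (pP : is_proj p) (phi : formula) : has_val p v ->
  exists x (xP : is_proj x), has_val x (chang_eval v phi) /\
    code_of E (qcls pP) phi = qcls xP.
Proof.
move=> pv; elim: phi => [||a [x [xP [xv xE]]]|a [x [xP [xv xE]]] b [y [yP [yw yE]]]] /=.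
- have zP := has_val0.1; exists 0, zP; split; first exact: has_val0.
  by congr mvn_class; apply/val_inj; rewrite /= rmorph0.
- by exists p, pP.
- exists (1 - x), (is_projB1 xP); split; first exact: has_valC.
  by rewrite xE; exact: estar_qcls.
- by rewrite xE yE; exact: eplus_val.
Qed.

Theorem code_eq_chang (p : projection A) : exists v, forall phi psi,
  code_of E (mvn_class (proj_quot pi p)) phi = code_of E (mvn_class (proj_quot pi p)) psi
  <-> chang_eval v phi = chang_eval v psi.
Proof.
case: p => p pP; have [v pv] := has_val_ex pP; exists v => phi psi.
have [x [xP [xv xE]]] := code_val pP phi pv.
have [y [yP [yv yE]]] := code_val pP psi pv.
rewrite -/(qcls pP) xE yE; split; first exact: qcls_inj.
by move=> H; apply: qcls_eq xv _; rewrite H.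
Qed.

End Chang.

(** * A Turing machine for Chang's algebra *)

Local Open Scope nat_scope.

Lemma chang_eval_scale e n m phi :
  chang_eval (e, n * m) phi =
  ((chang_eval (e, m) phi).1, n * (chang_eval (e, m) phi).2).
Proof.
elim: phi => [||a IHa|a IHa b IHb] /=; rewrite ?muln0 // ?IHa ?IHb //.
rewrite /chang_plus; case: (chang_eval _ a) (chang_eval _ b) => [[] i] [[] j] /=;
  by rewrite ?muln0 ?mulnDr ?mulnBr.
Qed.

(** By [chang_eval_scale] a positive [n] only multiplies second coordinates, which preserves and
    reflects equality; so the machine need know only whether [n] is 0. *)
Lemma chang_eval_unit e n phi psi :
  chang_eval (e, n) phi = chang_eval (e, n) psi <->
  chang_eval (e, (0 < n) : nat) phi = chang_eval (e, (0 < n) : nat) psi.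
Proof.
case: n => [//|n]; rewrite -[n.+1]muln1 !(chang_eval_scale e n.+1 1) /=.
case: (chang_eval _ phi) (chang_eval _ psi) => e1 i [e2 j] /=.
split=> [[-> /eqP]|[-> ->//]].
by rewrite -!/(muln n.+1 _) eqn_pmul2l // => /eqP ->.
Qed.

(* The value (e, n) of a processed subformula is kept in place: e in the finite
   control, or in the mark replacing the next delimiter, and n as the number of
   ticks in the cells of the subformula.  The operations never increase the
   total number of ticks, so nothing has to be moved. *)
Inductive tm_mark := Tick | Fill | PlusM of bool | HashM of bool.

Definition mark_code (a : tm_mark) : bool + bool * bool :=
  match a with
  | Tick => inl true | Fill => inl false
  | PlusM e => inr (true, e) | HashM e => inr (false, e)
  end.

Definition mark_decode (c : bool + bool * bool) : tm_mark :=
  match c with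
  | inl true => Tick | inl false => Fill
  | inr (true, e) => PlusM e | inr (false, e) => HashM e
  end.

Lemma mark_codeK : cancel mark_code mark_decode.
Proof. by case. Qed.

HB.instance Definition _ := Equality.copy tm_mark (can_type mark_codeK).
HB.instance Definition _ := Choice.copy tm_mark (can_type mark_codeK).
HB.instance Definition _ := Countable.copy tm_mark (can_type mark_codeK).
HB.instance Definition _ := Finite.copy tm_mark (can_type mark_codeK).

(* Scan: at the start of an operand.  After e: just past an operand with first
   component e.  Fetch, LeftPass, RightPass, Merge: processing of the redex
   (s1 + s2) delimited by the closing parenthesis just met; the flag rt
   tells in which operand the head is.  CmpR, CmpL, CmpBack: comparison of the
   two results by cancelling ticks pairwise. *)
Inductive tm_control :=
  | Scan | After of bool | Fetch of bool
  | LeftPass of bool & bool & bool & bool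
  | RightPass of bool & bool & bool & bool
  | Merge of bool
  | CmpR of bool & bool | CmpL of bool & bool & bool | CmpBack of bool
  | Accept | Reject.

Definition control_code (q : tm_control) : 'I_11 * (bool * bool * bool * bool) :=
  match q with
  | Scan => (@Ordinal 11 0 isT, (false, false, false, false))
  | After e => (@Ordinal 11 1 isT, (e, false, false, false))
  | Fetch e => (@Ordinal 11 2 isT, (e, false, false, false))
  | LeftPass a b c d => (@Ordinal 11 3 isT, (a, b, c, d))
  | RightPass a b c d => (@Ordinal 11 4 isT, (a, b, c, d))
  | Merge e => (@Ordinal 11 5 isT, (e, false, false, false))
  | CmpR a b => (@Ordinal 11 6 isT, (a, b, false, false))
  | CmpL a b c => (@Ordinal 11 7 isT, (a, b, c, false))
  | CmpBack e => (@Ordinal 11 8 isT, (e, false, false, false))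
  | Accept => (@Ordinal 11 9 isT, (false, false, false, false))
  | Reject => (@Ordinal 11 10 isT, (false, false, false, false))
  end.

Definition control_decode (x : 'I_11 * (bool * bool * bool * bool)) : tm_control :=
  let: (i, (a, b, c, d)) := x in
  match nat_of_ord i with
  | 0 => Scan | 1 => After a | 2 => Fetch a
  | 3 => LeftPass a b c d | 4 => RightPass a b c d | 5 => Merge a
  | 6 => CmpR a b | 7 => CmpL a b c | 8 => CmpBack a
  | 9 => Accept | _ => Reject
  end.

Lemma control_codeK : cancel control_code control_decode.
Proof. by case. Qed.

HB.instance Definition _ := Equality.copy tm_control (can_type control_codeK).
HB.instance Definition _ := Choice.copy tm_control (can_type control_codeK).
HB.instance Definition _ := Countable.copy tm_control (can_type control_codeK).
HB.instance Definition _ := Finite.copy tm_control (can_type control_codeK).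

Section Machine.
Variables (e0 b0 : bool).

Local Notation cell := (option (option symbol + tm_mark)).

Definition mark (b : bool) : cell := Some (inr (if b then Tick else Fill)).
Definition sym (s : symbol) : cell := Some (inl (Some s)).
Definition plusm e : cell := Some (inr (PlusM e)).
Definition hashm e : cell := Some (inr (HashM e)).

(** In [LeftPass] the flag [f] records that this sweep erased a tick of the operand with first
    component 0; in [RightPass] the flag [g] records that the matching erasure was made. [Fetch]
    exits with [g = true], so that the way back to the parenthesis erases nothing. When both
    components are 1 the left sweep clears all ticks, the sum being the unit. *)
Definition chang_delta (q : tm_control) (c : cell) : tm_control * cell * move :=
  match q, c with
  | Scan, Some (inl (Some SOpen)) => (Scan, c, MRight)
  | Scan, Some (inl (Some SX)) => (After e0, mark b0, MRight)
  | Scan, Some (inl (Some SZero)) => (After false, mark false, MRight)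
  | After e, Some (inl (Some SStar)) => (After (~~ e), mark false, MRight)
  | After e, Some (inl (Some SPlus)) => (Scan, plusm e, MRight)
  | After e, Some (inl (Some SClose)) => (Fetch e, c, MLeft)
  | After e, Some (inl None) => (Scan, hashm e, MRight)
  | After e, None => (CmpR e false, None, MLeft)
  | Fetch e2, Some (inr (PlusM e1)) => (RightPass e1 e2 true true, c, MRight)
  | Fetch e2, Some (inr _) => (Fetch e2, c, MLeft)
  | LeftPass e1 e2 rt f, Some (inr Tick) =>
      if e1 && e2 then (q, mark false, MLeft)
      else if [&& e1 != e2, ~~ (if rt then e2 else e1) & ~~ f]
      then (LeftPass e1 e2 rt true, mark false, MLeft)
      else (q, c, MLeft)
  | LeftPass e1 e2 rt f, Some (inr Fill) => (q, c, MLeft)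
  | LeftPass e1 e2 rt f, Some (inr (PlusM _)) => (LeftPass e1 e2 false f, c, MLeft)
  | LeftPass e1 e2 rt f, Some (inl (Some SOpen)) =>
      if f then (RightPass e1 e2 false false, c, MRight)
      else (Merge (e1 || e2), mark false, MRight)
  | RightPass e1 e2 rt g, Some (inr Tick) =>
      if (if rt then e2 else e1) && ~~ g
      then (RightPass e1 e2 rt true, mark false, MRight)
      else (q, c, MRight)
  | RightPass e1 e2 rt g, Some (inr Fill) => (q, c, MRight)
  | RightPass e1 e2 rt g, Some (inr (PlusM _)) => (RightPass e1 e2 true g, c, MRight)
  | RightPass e1 e2 rt g, Some (inl (Some SClose)) =>
      (LeftPass e1 e2 true false, c, MLeft)
  | Merge e, Some (inr (PlusM _)) => (q, mark false, MRight)
  | Merge e, Some (inr _) => (q, c, MRight)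
  | Merge e, Some (inl (Some SClose)) => (After e, mark false, MRight)
  | CmpR e f, Some (inr Tick) =>
      if f then (q, c, MLeft) else (CmpR e true, mark false, MLeft)
  | CmpR e f, Some (inr Fill) => (q, c, MLeft)
  | CmpR e f, Some (inr (HashM e1)) =>
      if e == e1 then (CmpL e f false, c, MLeft) else (Reject, c, MStay)
  | CmpL e f g, Some (inr Tick) =>
      if g then (q, c, MLeft) else (CmpL e f true, mark false, MLeft)
  | CmpL e f g, Some (inr Fill) => (q, c, MLeft)
  | CmpL e f g, None =>
      if f && g then (CmpBack e, None, MRight)
      else if f || g then (Reject, None, MStay) else (Accept, None, MStay)
  | CmpBack e, Some (inr _) => (q, c, MRight)
  | CmpBack e, None => (CmpR e false, None, MLeft)
  | _, _ => (Reject, c, MStay)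
  end.

Lemma accept_neq_reject : Accept != Reject.
Proof. by apply/eqP. Qed.

Definition chang_tm : turing_machine (option symbol) :=
  @TuringMachine (option symbol) tm_control tm_mark Scan Accept Reject
    accept_neq_reject chang_delta.

Local Notation config := (config chang_tm).
Local Notation Rc q l r := (@Config (option symbol) chang_tm q l r).
(* The head scans the first cell of l. *)
Definition Lc (q : tm_control) (l r : seq cell) : config :=
  Rc q (behead l) (head None l :: r).

Definition reach n (c c' : config) := iter n (@step _ chang_tm) c = c'.

Lemma reach_trans m n c1 c2 c3 : reach m c1 c2 -> reach n c2 c3 -> reach (m + n) c1 c3.
Proof. by rewrite /reach addnC iterD => -> ->. Qed.

Definition working (q : tm_control) := (q != Accept) && (q != Reject).

Lemma stepE q l r : working q ->
  step (Rc q l r) = let: (q', b, d) := chang_delta q (head None r) in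
  match d with
  | MLeft => Lc q' l (b :: behead r)
  | MStay => Rc q' l (b :: behead r)
  | MRight => Rc q' (b :: l) (behead r)
  end.
Proof. by rewrite /working /step /halted /= => /andP[/negbTE -> /negbTE ->]. Qed.

Lemma reachRR q q' y l x r : working q -> chang_delta q x = (q', y, MRight) ->
  reach 1 (Rc q l (x :: r)) (Rc q' (y :: l) r).
Proof. by move=> wq d; rewrite /reach /= stepE //= d. Qed.

Lemma reachRL q q' y l r : working q -> chang_delta q (head None r) = (q', y, MLeft) ->
  reach 1 (Rc q l r) (Lc q' l (y :: behead r)).
Proof. by move=> wq d; rewrite /reach /= stepE //= d. Qed.

Lemma reachLL q q' y x l r : working q -> chang_delta q x = (q', y, MLeft) ->
  reach 1 (Lc q (x :: l) r) (Lc q' l (y :: r)).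
Proof. by move=> wq d; rewrite /reach /= stepE //= d. Qed.

Lemma reachLR q q' y l r : working q -> chang_delta q (head None l) = (q', y, MRight) ->
  reach 1 (Lc q l r) (Rc q' (y :: behead l) r).
Proof. by move=> wq d; rewrite /reach /= stepE //= d. Qed.

Lemma reach_stay q q' y l r : working q -> chang_delta q (head None l) = (q', y, MStay) ->
  reach 1 (Lc q l r) (Rc q' (behead l) (y :: r)).
Proof. by move=> wq d; rewrite /reach /= stepE //= d. Qed.

(** * Sweeps of the head over a block of marks *)

Notation marks s := (map mark s).
Notation ticks s := (count id s).

Lemma keepL q s l r : working q ->
  (forall b, chang_delta q (mark b) = (q, mark b, MLeft)) ->
  reach (size s) (Lc q (marks (rev s) ++ l) r) (Lc q l (marks s ++ r)).
Proof.
move=> wq d; elim/last_ind: s r => [//|s b IH] r.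
rewrite rev_rcons size_rcons map_rcons cat_rcons -add1n.
by apply: reach_trans (IH _); apply: reachLL.
Qed.

Lemma keepR q s l r : working q ->
  (forall b, chang_delta q (mark b) = (q, mark b, MRight)) ->
  reach (size s) (Rc q l (marks s ++ r)) (Rc q (marks (rev s) ++ l) r).
Proof.
move=> wq d; elim: s l => [//|b s IH] l.
rewrite rev_cons map_rcons cat_rcons /= -add1n.
by apply: reach_trans (IH _); apply: reachRR.
Qed.

(** Abstracting the state as a family indexed by its flag lets one sweep serve [LeftPass], [CmpR]
    and [CmpL]. *)
Lemma eraseL (q : bool -> tm_control) s l r f : (forall f, working (q f)) ->
  (forall f, chang_delta (q f) (mark false) = (q f, mark false, MLeft)) ->
  chang_delta (q true) (mark true) = (q true, mark true, MLeft) ->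
  chang_delta (q false) (mark true) = (q true, mark false, MLeft) ->
  exists s', [/\ size s' = size s,
    ticks s' = (if f then ticks s else (ticks s).-1) &
    reach (size s) (Lc (q f) (marks (rev s) ++ l) r)
      (Lc (q (f || (0 < ticks s))) l (marks s' ++ r))].
Proof.
move=> wq dF dT dE; elim/last_ind: s f r => [|s b IH] f r.
  by exists [::]; rewrite orbF; split=> //; case: f.
pose b' := if b && ~~ f then false else b.
have [s' [sz tk H]] := IH (f || b) (mark b' :: r).
exists (rcons s' b'); split.
- by rewrite !size_rcons sz.
- rewrite -!cats1 !count_cat tk /= /b' !addn0.
  by case: (f) (b) => [] [] /=; rewrite ?addn0 ?addn1 //; case: (count id s).
- rewrite rev_rcons size_rcons map_rcons cat_rcons -add1n.
  have -> : f || (0 < ticks (rcons s b)) = f || b || (0 < ticks s).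
    rewrite -cats1 count_cat /= addn0 addn_gt0 lt0b.
    by case: (f) (b) => [] [] /=; rewrite ?orbT ?orbF.
  apply: reach_trans H; apply: reachLL => //.
  by rewrite /b'; case: (f) (b) => [] [] /=; rewrite ?dF ?dT ?dE.
Qed.

Lemma eraseR (q : bool -> tm_control) s l r f : (forall f, working (q f)) ->
  (forall f, chang_delta (q f) (mark false) = (q f, mark false, MRight)) ->
  chang_delta (q true) (mark true) = (q true, mark true, MRight) ->
  chang_delta (q false) (mark true) = (q true, mark false, MRight) ->
  exists s', [/\ size s' = size s,
    ticks s' = (if f then ticks s else (ticks s).-1) &
    reach (size s) (Rc (q f) l (marks s ++ r))
      (Rc (q (f || (0 < ticks s))) (marks (rev s') ++ l) r)].
Proof.
move=> wq dF dT dE; elim: s f l => [|b s IH] f l.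
  by exists [::]; rewrite orbF; split=> //; case: f.
pose b' := if b && ~~ f then false else b.
have [s' [sz tk H]] := IH (f || b) (mark b' :: l).
exists (b' :: s'); split.
- by rewrite /= sz.
- by rewrite /= tk /b'; case: (f) (b) => [] [].
- rewrite rev_cons map_rcons cat_rcons /= -add1n addn_gt0 lt0b orbA.
  apply: reach_trans H; apply: reachRR => //.
  by rewrite /b'; case: (f) (b) => [] [] /=; rewrite ?dF ?dT ?dE.
Qed.

Lemma killL q s l r : working q ->
  (forall b, chang_delta q (mark b) = (q, mark false, MLeft)) ->
  reach (size s) (Lc q (marks (rev s) ++ l) r) (Lc q l (marks (nseq (size s) false) ++ r)).
Proof.
move=> wq d; elim/last_ind: s r => [//|s b IH] r.
rewrite rev_rcons size_rcons -add1n /=.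
have -> : mark false :: marks (nseq (size s) false) ++ r =
    marks (nseq (size s) false) ++ mark false :: r.
  by elim: (size s) => //= n ->.
by apply: reach_trans (IH _); apply: reachLL.
Qed.


Definition start_redex e1 e2 x s1 s2 l r : config :=
  Lc (LeftPass e1 e2 true false)
    (marks (rev s2) ++ plusm x :: marks (rev s1) ++ sym SOpen :: l) (sym SClose :: r).

(** The three unticked cells are those of the parentheses and the plus sign, so a processed formula
    occupies exactly its original length. *)
Definition merged (s1 s2 : seq bool) := false :: s1 ++ false :: rcons s2 false.

Lemma size_merged s1 s2 : size (merged s1 s2) = size s1 + size s2 + 3.
Proof. by rewrite /merged /= size_cat /= size_rcons; lia. Qed.

Lemma ticks_merged s1 s2 : ticks (merged s1 s2) = ticks s1 + ticks s2.
Proof. by rewrite /merged /= count_cat /= -cats1 count_cat /= !addn0. Qed.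

Lemma reach_merge e1 e2 x s1 s2 l r :
  reach (size s1 + size s2 + 3)
    (Lc (LeftPass e1 e2 false false) (sym SOpen :: l)
      (marks s1 ++ plusm x :: marks s2 ++ sym SClose :: r))
    (Rc (After (e1 || e2)) (marks (rev (merged s1 s2)) ++ l) r).
Proof.
have -> : size s1 + size s2 + 3 = 1 + (size s1 + (1 + (size s2 + 1))) by lia.
apply: reach_trans; first by apply: reachLR.
apply: reach_trans; first by apply: keepR => // -[].
apply: reach_trans; first by apply: reachRR.
apply: reach_trans; first by apply: keepR => // -[].
have -> : marks (rev (merged s1 s2)) ++ l =
    mark false :: marks (rev s2) ++ mark false :: marks (rev s1) ++ mark false :: l.
  rewrite /merged rev_cons rev_cat rev_cons rev_rcons -!cats1 !map_cat.
  by rewrite -!catA.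
exact: reachRR.
Qed.

Lemma reach_equal_redex e x s1 s2 l r : exists s' t,
  [/\ size s' = size s1 + size s2 + 3,
    ticks s' = (if e then 0 else ticks s1 + ticks s2),
    t <= 2 * (size s1 + size s2 + 3) &
    reach t (start_redex e e x s1 s2 l r) (Rc (After e) (marks (rev s') ++ l) r)].
Proof.
have ee : e = e || e by rewrite orbb.
case: e ee => ee.
  pose z (s : seq bool) := nseq (size s) false.
  have tz s : ticks (z s) = 0 by rewrite count_nseq mul0n.
  have sz s : size (z s) = size s by rewrite size_nseq.
  exists (merged (z s1) (z s2)), (size s2 + (1 + (size s1 + (size (z s1) + size (z s2) + 3)))).
  rewrite size_merged ticks_merged !tz !sz; split=> //; first by lia.
  apply: reach_trans; first by apply: killL => // -[].
  apply: reach_trans; first by apply: reachLL.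
  apply: reach_trans; first by apply: killL => // -[].
  by rewrite -{1}(sz s1) -{1}(sz s2); exact: reach_merge.
exists (merged s1 s2), (size s2 + (1 + (size s1 + (size s1 + size s2 + 3)))).
rewrite size_merged ticks_merged; split=> //; first by lia.
apply: reach_trans; first by apply: keepL => // -[].
apply: reach_trans; first by apply: reachLL.
apply: reach_trans; first by apply: keepL => // -[].
exact: (reach_merge false false).
Qed.

(* One round cancels a tick of the operand with first component 0 against a
   tick, if any, of the other one. *)
Lemma reach_mixed_redex e x s1 s2 l r : exists s' t,
  [/\ size s' = size s1 + size s2 + 3,
    ticks s' = (if e then ticks s1 - ticks s2 else ticks s2 - ticks s1),
    t <= (ticks (if e then s2 else s1)).+1 * (2 * (size s1 + size s2 + 3)) &
    reach t (start_redex e (~~ e) x s1 s2 l r) (Rc (After true) (marks (rev s') ++ l) r)].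
Proof.
case: e.
  have [n tn] := ubnP (ticks s2); elim: n => // n IH in s1 s2 tn *.
  have [s2' [sz2 tk2 H2]] := @eraseL (fun f => LeftPass true false true f) s2
    (plusm x :: marks (rev s1) ++ sym SOpen :: l) (sym SClose :: r) false
    (fun _ => isT) (fun _ => erefl) erefl erefl.
  have H1 f : reach (1 + size s1)
      (Lc (LeftPass true false true f) (plusm x :: marks (rev s1) ++ sym SOpen :: l)
        (marks s2' ++ sym SClose :: r))
      (Lc (LeftPass true false false f) (sym SOpen :: l)
        (marks s1 ++ plusm x :: marks s2' ++ sym SClose :: r)).
    by apply: reach_trans; [apply: reachLL | apply: keepL => // -[]].
  have {H1}H1 := reach_trans H2 (H1 _).
  case: posnP H1 => [t0|tpos] H1 /=.
    exists (merged s1 s2'), (size s2 + (1 + size s1) + (size s1 + size s2' + 3)).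
    rewrite size_merged ticks_merged sz2 tk2 t0 subn0 addn0; split=> //; first by lia.
    by rewrite -{2}sz2; apply: reach_trans H1 (reach_merge true false _ _ _ _ _).
  have [s1' [sz1 tk1 H3]] := @eraseR (fun g => RightPass true false false g) s1
    (sym SOpen :: l) (plusm x :: marks s2' ++ sym SClose :: r) false
    (fun _ => isT) (fun _ => erefl) erefl erefl.
  have [|s' [t [szs tks tt H]]] := IH s1' s2'; first by rewrite tk2; lia.
  exists s', (size s2 + (1 + size s1) + (1 + (size s1 + (1 + (size s2' + (1 + t)))))); split.
  - by rewrite szs sz1 sz2.
  - by rewrite tks tk1 tk2; lia.
  - move: tt; rewrite sz1 sz2 tk2; case: (count id s2) tpos => //= k _.
    by rewrite [k.+2 * _]mulSn; lia.
  apply: reach_trans H1 _.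
  apply: reach_trans; first by apply: reachLR.
  apply: reach_trans; first exact: H3.
  apply: reach_trans; first by apply: reachRR.
  apply: reach_trans; first by apply: keepR => // -[].
  by apply: reach_trans H; apply: reachRL.
have [n tn] := ubnP (ticks s1); elim: n => // n IH in s1 s2 tn *.
have [s1' [sz1 tk1 H2]] := @eraseL (fun f => LeftPass false true false f) s1
  (sym SOpen :: l) (plusm x :: marks s2 ++ sym SClose :: r) false
  (fun _ => isT) (fun _ => erefl) erefl erefl.
have H1 : reach (size s2 + 1) (start_redex false true x s1 s2 l r)
    (Lc (LeftPass false true false false) (marks (rev s1) ++ sym SOpen :: l)
      (plusm x :: marks s2 ++ sym SClose :: r)).
  by apply: reach_trans; [apply: keepL => // -[] | apply: reachLL].
have {H2}H1 := reach_trans H1 H2.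
case: posnP H1 => [t0|tpos] H1 /=.
  exists (merged s1' s2), (size s2 + 1 + size s1 + (size s1' + size s2 + 3)).
  rewrite size_merged ticks_merged sz1 tk1 t0 subn0 add0n; split=> //; first by lia.
  by rewrite -{2}sz1; apply: reach_trans H1 (reach_merge false true _ _ _ _ _).
have [s2' [sz2 tk2 H3]] := @eraseR (fun g => RightPass false true true g) s2
  (plusm x :: marks (rev s1') ++ sym SOpen :: l) (sym SClose :: r) false
  (fun _ => isT) (fun _ => erefl) erefl erefl.
have [|s' [t [szs tks tt H]]] := IH s1' s2'; first by rewrite tk1; lia.
exists s', (size s2 + 1 + size s1 + (1 + (size s1' + (1 + (size s2 + (1 + t)))))); split.
- by rewrite szs sz1 sz2.
- by rewrite tks tk1 tk2; lia.
- move: tt; rewrite sz1 sz2 tk1; case: (count id s1) tpos => //= k _.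
  by rewrite [k.+2 * _]mulSn; lia.
apply: reach_trans H1 _.
apply: reach_trans; first by apply: reachLR.
apply: reach_trans; first by apply: keepR => // -[].
apply: reach_trans; first by apply: reachRR.
apply: reach_trans; first exact: H3.
by apply: reach_trans H; apply: reachRL.
Qed.

(** With [L] the length of the redex, there are fewer than [L] rounds of at most [2 * L] steps; the
    trip that fetches [e1] fits in the remaining half of the bound. *)
Lemma reach_redex e1 e2 s1 s2 l r : exists s' t,
  let v := chang_plus (e1, ticks s1) (e2, ticks s2) in
  [/\ size s' = size s1 + size s2 + 3, ticks s' = v.2,
    t <= 4 * (size s1 + size s2 + 3) ^ 2 &
    reach t (Rc (After e2)
        (marks (rev s2) ++ plusm e1 :: marks (rev s1) ++ sym SOpen :: l) (sym SClose :: r))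
      (Rc (After v.1) (marks (rev s') ++ l) r)].
Proof.
have H0 : reach (1 + (size s2 + (1 + (size s2 + 1))))
    (Rc (After e2)
        (marks (rev s2) ++ plusm e1 :: marks (rev s1) ++ sym SOpen :: l) (sym SClose :: r))
    (start_redex e1 e2 e1 s1 s2 l r).
  apply: reach_trans; first by apply: reachRL.
  apply: reach_trans; first by apply: keepL => // -[].
  apply: reach_trans; first by apply: reachLR.
  apply: reach_trans; first by apply: keepR => //; case: e1 e2 => [] [] [].
  exact: reachRL.
have [ee|ne] := eqVneq e1 e2.
  subst e2; have [s' [t [sz tk tt H]]] := reach_equal_redex e1 e1 s1 s2 l r.
  exists s', (1 + (size s2 + (1 + (size s2 + 1))) + t); split=> //.
  - by rewrite tk; case: (e1).
  - by rewrite expnS expn1; nia.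
  - by apply: reach_trans H0 _; case: (e1) H.
have e2E : e2 = ~~ e1 by case: (e1) (e2) ne => [] [].
subst e2; have [s' [t [sz tk tt H]]] := reach_mixed_redex e1 e1 s1 s2 l r.
exists s', (1 + (size s2 + (1 + (size s2 + 1))) + t); split=> //.
- by rewrite tk; case: (e1).
- have := count_size id s1; have := count_size id s2; rewrite expnS expn1.
  by case: (e1) tt => /= tt c1 c2; nia.
- by apply: reach_trans H0 _; case: (e1) H.
Qed.

Lemma flen_pos phi : 0 < flen phi.
Proof. by case: phi => [||a|a b] //; rewrite /flen /= size_rcons. Qed.

Lemma flen_plus a b : flen (FPlus a b) = flen a + flen b + 3.
Proof. by rewrite /flen /= size_cat /= size_cat /=; lia. Qed.

(** The surrounding tape is arbitrary because operands are processed inside a partly evaluated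
    formula. Quadratic work per redex adds up to a cubic bound. *)
Lemma reach_formula phi l r : exists s t,
  let v := chang_eval (e0, b0 : nat) phi in
  [/\ size s = flen phi, ticks s = v.2, t <= 4 * flen phi ^ 3 &
    reach t (Rc Scan l (map sym (fstr phi) ++ r)) (Rc (After v.1) (marks (rev s) ++ l) r)].
Proof.
elim: phi l r => [||a IH|a IHa b IHb] l r /=.
- by exists [:: false], 1; split=> //; apply: reachRR.
- by exists [:: b0], 1; split=> //; rewrite /= addn0.
- have [s [t [sz tk tt H]]] := IH l (sym SStar :: r).
  exists (rcons s false), (t + 1); rewrite /flen /= !size_rcons -/(flen a); split.
  + by rewrite sz.
  + by rewrite -cats1 count_cat tk /= !addn0.
  + have := flen_pos a; rewrite !expnS expn0 in tt *; nia.
  + rewrite map_rcons cat_rcons rev_rcons /=.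
    by apply: reach_trans H _; apply: reachRR.
have [s1 [t1 [sz1 tk1 tt1 H1]]] :=
  IHa (sym SOpen :: l) (sym SPlus :: map sym (fstr b) ++ sym SClose :: r).
set v := chang_eval _ a in tk1 H1 *.
have [s2 [t2 [sz2 tk2 tt2 H2]]] :=
  IHb (plusm v.1 :: marks (rev s1) ++ sym SOpen :: l) (sym SClose :: r).
set w := chang_eval _ b in tk2 H2 *.
have [s' [t [sz tk tt H]]] := reach_redex v.1 w.1 s1 s2 l r.
rewrite tk1 tk2 -!surjective_pairing sz1 sz2 in sz tk tt H.
exists s', (1 + (t1 + (1 + (t2 + t)))); rewrite flen_plus; split=> //.
- set m := flen a in tt1 tt *; set n := flen b in tt2 tt *.
  rewrite !expnS !expn0 !muln1 in tt1 tt2 tt *; nia.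
rewrite !map_cat /= map_cat -!catA /= -catA.
apply: reach_trans; first by apply: reachRR.
apply: reach_trans; first exact: H1.
apply: reach_trans; first by apply: reachRR.
by apply: reach_trans; first exact: H2.
Qed.

(** Each round erases one tick on either side, and equality means that both sides run out in the
    same round. Only the first cells of [l] and [r] are required to be blank, since turning around
    writes explicit blanks there. *)
Lemma reach_compare e s1 s2 l r : head None l = None -> head None r = None ->
  exists t c,
  [/\ t <= (ticks s2).+1 * (2 * (size s1 + size s2 + 3)),
    reach t (Lc (CmpR e false) (marks (rev s2) ++ hashm e :: marks (rev s1) ++ l) r) c,
    halted c & cfg_state c = Accept <-> ticks s1 = ticks s2].
Proof.
have [n tn] := ubnP (ticks s2); elim: n => // n IH in s1 s2 l r tn * => lN rN.
have [s2' [sz2 tk2 H2]] := @eraseL (fun f => CmpR e f) s2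
    (hashm e :: marks (rev s1) ++ l) r false
    (fun _ => isT) (fun _ => erefl) erefl erefl.
set f := _ || _ in H2.
have [s1' [sz1 tk1 H1]] := @eraseL (fun g => CmpL e f g) s1
    l (hashm e :: marks s2' ++ r) false
    (fun _ => isT) (fun _ => erefl) erefl erefl.
set g := _ || _ in H1.
have H : reach (size s2 + (1 + size s1))
    (Lc (CmpR e false) (marks (rev s2) ++ hashm e :: marks (rev s1) ++ l) r)
    (Lc (CmpL e f g) l (marks s1' ++ hashm e :: marks s2' ++ r)).
  apply: reach_trans H2 _; apply: reach_trans H1; apply: reachLL => //=.
  by rewrite eqxx.
have [/andP[fT gT]|nfg] := boolP (f && g).
  have [|//|//|t [c [tt Hc hc cE]]] := IH s1' s2' (None :: behead l) (None :: behead r).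
    by rewrite tk2; move: fT; rewrite /f /=; lia.
  exists (size s2 + (1 + size s1) + (1 + (size s1' + (1 + (size s2' + (1 + t)))))), c.
  split=> //.
  - move: tt; rewrite sz1 sz2 tk2 /=; move: fT; rewrite /f /=.
    by case: (count id s2) => //= k _; rewrite [k.+2 * _]mulSn; lia.
  - apply: reach_trans H _.
    apply: reach_trans; first by apply: reachLR => //=; rewrite lN /= fT gT.
    apply: reach_trans; first by apply: keepR => // -[].
    apply: reach_trans; first by apply: reachRR.
    apply: reach_trans; first by apply: keepR => // -[].
    by apply: reach_trans Hc; apply: reachRL => //=; rewrite rN.
  - rewrite cE tk1 tk2 /=; move: fT gT; rewrite /f /g /=; lia.
exists (size s2 + (1 + size s1) + 1).
have [fg|fg] := boolP (f || g).
  exists (Rc Reject (behead l) (None :: marks s1' ++ hashm e :: marks s2' ++ r)); split=> //.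
  - by rewrite mulSn; lia.
  - apply: reach_trans H _; apply: reach_stay => //=.
    by rewrite lN /= (negbTE nfg) fg.
  - by split=> // E; move: nfg fg; rewrite /f /g /= E; lia.
exists (Rc Accept (behead l) (None :: marks s1' ++ hashm e :: marks s2' ++ r)); split=> //.
- by rewrite mulSn; lia.
- apply: reach_trans H _; apply: reach_stay => //=.
  by rewrite lN /= (negbTE nfg) (negbTE fg).
- by split=> // _; move: fg; rewrite /f /g /=; lia.
Qed.

(** For lengths [m] and [n] the evaluations take at most [4 m^3 + 4 n^3] steps and the comparison at
    most [2 (n + 1) (m + n + 3)]; the shift by 5 covers this, the single transition steps and the
    strict inequality. *)
Theorem chang_tm_decides phi psi :
  decides_within chang_tm (('X + 5%:P) ^+ 3 * 4%:P : {poly nat})%R.[flen phi + flen psi]%R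
    (pair_input phi psi)
    (chang_eval (e0, b0 : nat) phi = chang_eval (e0, b0 : nat) psi).
Proof.
have [s1 [t1 [sz1 tk1 tt1 H1]]] :=
  reach_formula phi [::] (Some (inl None) :: map sym (fstr psi)).
set v := chang_eval _ phi in tk1 H1 *.
have [s2 [t2 [sz2 tk2 tt2 H2]]] := reach_formula psi (hashm v.1 :: marks (rev s1)) [::].
set w := chang_eval _ psi in tk2 H2 *.
rewrite cats0 in H1; rewrite cats0 in H2.
have H : reach (t1 + (1 + (t2 + 1))) (@initial_config _ chang_tm (pair_input phi psi))
    (Lc (CmpR w.1 false) (marks (rev s2) ++ hashm v.1 :: marks (rev s1)) [:: None]).
  rewrite /initial_config /pair_input map_cat /= -!map_comp.
  apply: reach_trans H1 _.
  apply: reach_trans; first by apply: reachRR.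
  by apply: reach_trans H2 _; apply: reachRL.
suff [t [c [tt Hc hc cE]]] : exists t c,
    [/\ t <= (size s2).+1 * (2 * (size s1 + size s2 + 3)),
      reach t (Lc (CmpR w.1 false) (marks (rev s2) ++ hashm v.1 :: marks (rev s1)) [:: None]) c,
      halted c & cfg_state c = Accept <-> v = w].
  have {}H := reach_trans H Hc.
  exists (t1 + (1 + (t2 + 1)) + t); rewrite H; split=> //.
  rewrite hornerM hornerC horner_exp hornerD hornerX hornerC.
  rewrite sz1 sz2 in tt; set m := flen phi in tt1 tt *; set n := flen psi in tt2 tt *.
  rewrite -[X in _ < X]/((m + n + 5) ^ 3 * 4).
  rewrite !expnS !expn0 !muln1 in tt1 tt2 *; nia.
have [ee|ne] := eqVneq v.1 w.1.
  rewrite ee; have [|//|t [c [tt Hc hc cE]]] := @reach_compare w.1 s1 s2 [::] [:: None].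
    by [].
  exists t, c; split=> //.
  - by apply: (leq_trans tt); rewrite leq_mul2r ltnS count_size orbT.
  - by rewrite cats0 in Hc.
  - rewrite cE tk1 tk2; split=> [E|->//].
    by rewrite [v]surjective_pairing [w]surjective_pairing ee E.
have [s2' [sz2' _ H2']] := @eraseL (fun f => CmpR w.1 f) s2
    (hashm v.1 :: marks (rev s1)) [:: None] false
    (fun _ => isT) (fun _ => erefl) erefl erefl.
exists (size s2 + 1), (Rc Reject (marks (rev s1)) (hashm v.1 :: marks s2' ++ [:: None])); split=> //.
- by rewrite mulSn; lia.
- apply: reach_trans H2' _; apply: reach_stay => //=.
  by rewrite eq_sym (negbTE ne).
- by split=> // E; rewrite E eqxx in ne.
Qed.

End Machine.

Local Close Scope nat_scope.

Theorem theorem6p1 (R : realType)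
  (M1alg : cstarAlgType R)
  (M1alg_AF : AF_algebra M1alg)
  (cls : forall n, 'M[M1alg]_n -> (I01 R -> R))
  (M1alg_K0 : K0_iso (@M1 R) (@M1_pos R) (fun _ => 1) cls)
  (E1 : elliottMonoid M1alg)
  (p : projection M1alg)
  (p_gen : generates E1 (mvn_class p))
  (J : set M1alg)
  (J_ideal : closed_ideal J)
  (J_K0 : K0_image cls J = @J0plus R)
  (A01 : cstarAlgType R)
  (pi : cstar_quotient J A01)
  (E01 : elliottMonoid A01) :
  exists (T : {poly nat}) (TM : turing_machine (option symbol)),
    forall phi psi : formula,
      decides_within TM T.[(flen phi + flen psi)%N] (pair_input phi psi)
        (code_of E01 (mvn_class (proj_quot pi p)) phi =
         code_of E01 (mvn_class (proj_quot pi p)) psi).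
Proof.
have [[e n] codeE] := code_eq_chang M1alg_AF M1alg_K0 J_K0 pi E01 p.
(* The value of [p] enters the machine as two bits of its transition table: the first component of
   its germ, and whether the second is nonzero. *)
exists (('X + 5%:P) ^+ 3 * 4%:P), (chang_tm e (0 < n)%N) => phi psi.
have [t [tT ht tP]] := chang_tm_decides e (0 < n)%N phi psi.
by exists t; split=> //; rewrite codeE chang_eval_unit.
Qed.
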